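(* Assume the global noise law, the edge condition, and the holomorphic subspace local law (all defined in the context). Let $J\subset(b,\infty)$ be a stable compact interval with stable contour $\Gamma$, and assume weighted compatibility on a compact neighborhood of $\Gamma$. Suppose that $J$ contains exactly one deterministic location, generated by a simple spike $\theta_{n,i}\to\theta>\theta_\star$ (where $i=i(n)$), and no other deterministic location. Let $(\widehat u_n,\widehat v_n)$ be the corresponding unit left and right singular vectors of $W_n$ (for the singular value of $W_n$ in $J$, which is unique with probability tending to one). Then $$|\langle u_{n,i},\widehat u_n\rangle|^2\to\kappa_{\mathrm L}(\theta),\qquad|\langle v_{n,i},\widehat v_n\rangle|^2\to\kappa_{\mathrm R}(\theta)$$ in probability, and the projections onto every other signal direction vanish: $\max_{k\ne i}|\langle u_{n,k},\widehat u_n\rangle|\to0$ and $\max_{k\ne i}|\langle v_{n,k},\widehat v_n\rangle|\to0$ in probability. Moreover, without any additional phase convention, $$\langle u_{n,i},\widehat u_n\rangle\,\overline{\langle v_{n,i},\widehat v_n\rangle}\to\kappa_{\mathrm{LR}}(\theta)$$ in probability.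
   Context: Setting. $\mathbb F\in\{\mathbb R,\mathbb C\}$; for each $n$, $m=m(n)\ge n$ is an integer and $n/m\to c\in(0,1]$. $X_n$ is a random $n\times m$ matrix over $\mathbb F$; $P_n$ is an $n\times m$ matrix of rank $r_n$ (deterministic, or random on the same probability space; neither independence from $X_n$ nor any rank restriction is assumed); $W_n=X_n+P_n$. With $\mathrm{St}(N,r)=\{Q\in\mathbb F^{N\times r}:Q^*Q=I_r\}$, fix $P_n=U_n\Theta_nV_n^*$, $U_n\in\mathrm{St}(n,r_n)$ with columns $u_{n,k}$, $V_n\in\mathrm{St}(m,r_n)$ with columns $v_{n,k}$, $\Theta_n=\operatorname{diag}(\theta_{n,1},\dots,\theta_{n,r_n})$, $\theta_{n,1}\ge\dots\ge\theta_{n,r_n}>0$. $\langle x,y\rangle=x^*y$. Singular vectors are paired: $W_n\widehat v_n=\sigma\widehat u_n$, $W_n^*\widehat u_n=\sigma\widehat v_n$. Global noise law. There is a compactly supported probability measure $\mu$ on $[0,\infty)$ such that the empirical spectral measure of $X_nX_n^*$ converges weakly to $\mu$ in probability and $\|X_n\|_{\mathrm{op}}\to b:=\sqrt{\sup\operatorname{supp}\mu}$ in probability. Transforms. For $\zeta\in\mathbb C\setminus[-b,b]$: $\phi(\zeta)=\int\frac{\zeta}{\zeta^2-x}\,\mu(dx)$, $\widetilde\phi(\zeta)=c\,\phi(\zeta)+\frac{1-c}{\zeta}$, $d(\zeta)=\phi(\zeta)\widetilde\phi(\zeta)$ (positive, strictly decreasing on $(b,\infty)$). Edge condition. $d(b+):=\lim_{z\downarrow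 b}d(z)\in(0,\infty)$. Put $\theta_\star=d(b+)^{-1/2}$; $\rho(\theta)=d^{-1}(\theta^{-2})\in(b,\infty)$ for $\theta>\theta_\star$ and $\rho(\theta)=b$ for $0\le\theta\le\theta_\star$. The deterministic locations are the numbers $\rho(\theta_{n,k})$ (counted with multiplicity). Overlap weights. For $\theta>\theta_\star$, $\rho=\rho(\theta)$: $\kappa_{\mathrm L}(\theta)=-\frac{2\phi(\rho)}{\theta^2d'(\rho)}$, $\kappa_{\mathrm R}(\theta)=-\frac{2\widetilde\phi(\rho)}{\theta^2d'(\rho)}$, $\kappa_{\mathrm{LR}}(\theta)=-\frac{2}{\theta^3d'(\rho)}$. Linearization. $\mathcal X_n=\begin{pmatrix}0&X_n\\ X_n^*&0\end{pmatrix}$, $\mathcal E_n=\begin{pmatrix}U_n&0\\0&V_n\end{pmatrix}$, $\mathcal K_n=\begin{pmatrix}0&\Theta_n\\\Theta_n&0\end{pmatrix}$, $\mathcal G_n(\zeta)=\mathcal E_n^*(\zeta I-\mathcal X_n)^{-1}\mathcal E_n$, $\mathcal M(\zeta)=\begin{pmatrix}\phi(\zeta)I_{r_n}&0\\0&\widetilde\phi(\zeta)I_{r_n}\end{pmatrix}$. Holomorphic subspace local law. For every compact $K\subset\mathbb C\setminus[-b,b]$ there is a deterministic sequence $\varepsilon_n(K)\to0$ such that, with probability tending to one, $\sup_{\zeta\in K}\|\mathcal G_n(\zeta)-\mathcal M(\zeta)\|_{\mathrm{op}}\le\varepsilon_n(K)$. Weighted compatibility on a compact $K\subset\mathbb C\setminus[-b,b]$: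 $\sup_{\zeta\in K}\big(\|(\mathcal G_n(\zeta)-\mathcal M(\zeta))\mathcal K_n\|_{\mathrm{op}}+\|\mathcal K_n(\mathcal G_n(\zeta)-\mathcal M(\zeta))\|_{\mathrm{op}}\big)\to0$ in probability. (Suprema are $+\infty$ if $\mathcal G_n$ is undefined somewhere on $K$.) Stability. A contour $\Gamma$ (fixed positively oriented finite union of rectifiable Jordan curves, $\Omega_\Gamma$ the union of their interiors) is stable if $\overline{\Omega_\Gamma}$ is a compact subset of $\mathbb C\setminus[-b,b]$, it encloses a specified subset of the positive roots $\rho(\theta_{n,k})$ ($\theta_{n,k}>\theta_\star$), and $\sup_n\sup_{\zeta\in\Gamma}\|(I_{2r_n}-\mathcal M(\zeta)\mathcal K_n)^{-1}\|_{\mathrm{op}}<\infty$. A compact interval $J\subset(b,\infty)$ is stable if the deterministic locations stay a fixed positive distance from $\partial J$ and there is a stable $\Gamma$ with $\Omega_\Gamma\cap\mathbb R=\operatorname{int}J$ whose enclosed positive roots are exactly those in $J$. If $\Theta_n$ is random, the separation and the inverse bound are required (with fixed constants and deterministic $\Gamma$) on events of probability tending to one, and conclusions are understood on those events. *)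

(* Defs.v *)
From HB Require Import structures.
From mathcomp Require Import all_boot all_order all_algebra spectral complex.
From mathcomp Require Import all_classical all_reals all_analysis.

Set Implicit Arguments.
Unset Strict Implicit.
Unset Printing Implicit Defensive.

Import Order.TTheory GRing.Theory Num.Theory.
Import numFieldNormedType.Exports.
Import ComplexField.

Local Open Scope classical_set_scope.
Local Open Scope ring_scope.
Local Open Scope complex_scope.
Local Open Scope sesquilinear_scope.

(* Both scalar fields are treated inside R[i]: a matrix over F is a matrix over
   R[i] all of whose entries satisfy [in_scalars F]. *)
Inductive scalar_field := RealScalars | ComplexScalars.

Definition in_scalars (R : realType) (F : scalar_field) : {pred R[i]} :=
  fun z => if F is RealScalars then complex.Im z == 0 else true.

(* Events of probability tending to one, for a sequence of probability spaces
   that may vary with n. No measurability of [E n] is required: it suffices that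
   it contains a measurable event. For measurable [E n] this is just
   Pr n (E n) --> 1, and for random variables [cvg_prob] is the usual
   convergence in probability. *)
Definition whp (R : realType) (d : nat -> measure_display)
    (Omega : forall n, measurableType (d n))
    (Pr : forall n, probability (Omega n) R) (E : forall n, set (Omega n)) :=
  exists A : forall n, set (Omega n),
    (forall n, measurable (A n) /\ A n `<=` E n) /\
    (fun n => Pr n (A n)) @ \oo --> 1%E.

Definition cvg_prob (R : realType) (d : nat -> measure_display)
    (Omega : forall n, measurableType (d n))
    (Pr : forall n, probability (Omega n) R)
    (Y : forall n, Omega n -> R) (l : R) :=
  forall e : R, 0 < e -> whp Pr (fun n => [set w | `|Y n w - l| < e]).

(* Convergence in probability of the i-th entry of a family with a random number
   r of entries; [i n w] is a natural number, and being a valid index with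
   probability tending to one is part of the claim. *)
Definition cvg_prob_at (R : realType) (d : nat -> measure_display)
    (Omega : forall n, measurableType (d n))
    (Pr : forall n, probability (Omega n) R)
    (r i : forall n, Omega n -> nat)
    (Y : forall n (w : Omega n), 'I_(r n w) -> R) (l : R) :=
  forall e : R, 0 < e -> whp Pr (fun n =>
    [set w | exists2 k : 'I_(r n w), k = i n w :> nat & `|Y n w k - l| < e]).

Definition random_mx (R : realType) d (T : measurableType d) n m
    (A : T -> 'M[R[i]]_(n, m)) :=
  forall i j, measurable_fun setT (fun w => complex.Re (A w i j)) /\
              measurable_fun setT (fun w => complex.Im (A w i j)).

Definition inner (R : realType) n (x y : 'cV[R[i]]_n) : R[i] :=
  (x^t* *m y) ord0 ord0.

Definition enorm (R : realType) n (x : 'cV[R[i]]_n) : R :=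
  Num.sqrt (\sum_(j < n) Normc.normc (x j ord0) ^+ 2).

Definition opnorm (R : realType) n m (A : 'M[R[i]]_(n, m)) : R :=
  sup [set enorm (A *m x) | x in [set x : 'cV_m | enorm x <= 1]].

Definition stiefel (R : realType) (F : scalar_field) n r
    (Q : 'M[R[i]]_(n, r)) :=
  Q \is a mxOver (in_scalars F) /\ Q^t* *m Q = 1%:M.

(* Eigenvalues of a Hermitian matrix, with multiplicity. *)
Definition eigenvalues (R : realType) n (A : 'M[R[i]]_n) : seq R :=
  [seq complex.Re (spectral_diag A ord0 j) | j <- enum 'I_n].

Definition singular_values (R : realType) n m (A : 'M[R[i]]_(n, m)) : seq R :=
  [seq Num.sqrt x | x <- eigenvalues (A *m A^t*)].

Definition empirical_measure (R : realType) (s : seq R) :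
    {measure set R -> \bar R} :=
  mscale ((size s)%:R^-1)%:nng (msum (fun k => \d_(nth 0 s k)) (size s)).

Definition msupport (R : realType) (mu : probability R R) : set R :=
  [set x | forall U : set R, open U -> U x -> (0 < mu U)%E].

Definition edge (R : realType) (mu : probability R R) : R :=
  Num.sqrt (sup (msupport mu)).

Definition global_noise_law (R : realType) (d : nat -> measure_display)
    (Omega : forall n, measurableType (d n))
    (Pr : forall n, probability (Omega n) R) (m : nat -> nat)
    (X : forall n, Omega n -> 'M[R[i]]_(n, m n)) (mu : probability R R) :=
  [/\ mu `[0, +oo[%classic = 1%E,
      compact (msupport mu),
      forall f : R -> R, continuous f -> (exists M : R, forall x, `|f x| <= M) ->
        cvg_prob Pr (fun n w => Rintegral
            (empirical_measure (eigenvalues (X n w *m (X n w)^t*))) setT f)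
          (Rintegral mu setT f) &
      cvg_prob Pr (fun n w => opnorm (X n w)) (edge mu)].

Definition cintegral (R : realType) (mu : probability R R) (f : R -> R[i]) :
    R[i] :=
  Rintegral mu setT (fun x => complex.Re (f x)) +i*
  Rintegral mu setT (fun x => complex.Im (f x)).

(* [(R[i])^o] is R[i] with the topology of its norm. *)
Definition off_cut (R : realType) (b : R) : set (R[i])^o :=
  [set z | ~ (complex.Im z = 0 /\ - b <= complex.Re z <= b)].

Definition phi (R : realType) (mu : probability R R) (z : R[i]) : R[i] :=
  cintegral mu (fun x => z / (z ^+ 2 - x%:C)).

Definition phit (R : realType) (mu : probability R R) (c : R) (z : R[i]) :
    R[i] :=
  c%:C * phi mu z + (1 - c)%:C / z.

Definition dtrans (R : realType) (mu : probability R R) (c : R) (z : R[i]) :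
    R[i] :=
  phi mu z * phit mu c z.

(* The restrictions to the real axis, where the transforms are real. As they are
   holomorphic, the complex derivative at a real point is the derivative of the
   restriction. *)
Definition phiR (R : realType) (mu : probability R R) (z : R) : R :=
  complex.Re (phi mu z%:C).

Definition phitR (R : realType) (mu : probability R R) (c z : R) : R :=
  complex.Re (phit mu c z%:C).

Definition dR (R : realType) (mu : probability R R) (c z : R) : R :=
  complex.Re (dtrans mu c z%:C).

Definition d_edge (R : realType) (mu : probability R R) (c : R) : R :=
  lim (dR mu c z @[z --> (edge mu)^'+]).

Definition edge_condition (R : realType) (mu : probability R R) (c : R) :=
  cvg (dR mu c z @[z --> (edge mu)^'+]) /\ 0 < d_edge mu c.

Definition theta_star (R : realType) (mu : probability R R) (c : R) : R :=
  (Num.sqrt (d_edge mu c))^-1.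

(* [dR] is injective on (edge, +oo), so [xget] picks d^-1 (th ^- 2). *)
Definition rho (R : realType) (mu : probability R R) (c th : R) : R :=
  if theta_star mu c < th
  then xget (edge mu) [set z | edge mu < z /\ dR mu c z = th ^- 2]
  else edge mu.

Definition kappaL (R : realType) (mu : probability R R) (c th : R) : R :=
  - (2 * phiR mu (rho mu c th) / (th ^+ 2 * derive1 (dR mu c) (rho mu c th))).

Definition kappaR (R : realType) (mu : probability R R) (c th : R) : R :=
  - (2 * phitR mu c (rho mu c th) / (th ^+ 2 * derive1 (dR mu c) (rho mu c th))).

Definition kappaLR (R : realType) (mu : probability R R) (c th : R) : R :=
  - (2 / (th ^+ 3 * derive1 (dR mu c) (rho mu c th))).

Definition Theta_mx (R : realType) r (th : 'I_r -> R) : 'M[R[i]]_r :=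
  diag_mx (\row_k (th k)%:C).

Definition linearization (R : realType) n m (X : 'M[R[i]]_(n, m)) :
    'M[R[i]]_(n + m) :=
  block_mx 0 X (X^t*) 0.

Definition E_mx (R : realType) n m r (U : 'M[R[i]]_(n, r))
    (V : 'M[R[i]]_(m, r)) : 'M[R[i]]_(n + m, r + r) :=
  block_mx U 0 0 V.

Definition K_mx (R : realType) r (th : 'I_r -> R) : 'M[R[i]]_(r + r) :=
  block_mx 0 (Theta_mx th) (Theta_mx th) 0.

Definition M_mx (R : realType) (mu : probability R R) (c : R) r (z : R[i]) :
    'M[R[i]]_(r + r) :=
  block_mx (phi mu z)%:M 0 0 (phit mu c z)%:M.

(* [invmx] is the identity on singular matrices, so that G is meaningful only
   where [G_defined] holds. *)
Definition G_defined (R : realType) n m (X : 'M[R[i]]_(n, m)) (z : R[i]) :=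
  z%:M - linearization X \in unitmx.

Definition G_mx (R : realType) n m r (X : 'M[R[i]]_(n, m))
    (U : 'M[R[i]]_(n, r)) (V : 'M[R[i]]_(m, r)) (z : R[i]) :
    'M[R[i]]_(r + r) :=
  (E_mx U V)^t* *m invmx (z%:M - linearization X) *m E_mx U V.

Definition local_law (R : realType) (d : nat -> measure_display)
    (Omega : forall n, measurableType (d n))
    (Pr : forall n, probability (Omega n) R) (m : nat -> nat)
    (r : forall n, Omega n -> nat)
    (X : forall n, Omega n -> 'M[R[i]]_(n, m n))
    (U : forall n (w : Omega n), 'M[R[i]]_(n, r n w))
    (V : forall n (w : Omega n), 'M[R[i]]_(m n, r n w))
    (mu : probability R R) (c : R) :=
  forall K : set (R[i])^o, compact K -> K `<=` off_cut (edge mu) ->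
  exists eps : nat -> R, eps @ \oo --> (0 : R) /\
    whp Pr (fun n => [set w | forall z, K z -> G_defined (X n w) z /\
      opnorm (G_mx (X n w) (U n w) (V n w) z - M_mx mu c (r n w) z) <= eps n]).

Definition weighted_compatibility (R : realType) (d : nat -> measure_display)
    (Omega : forall n, measurableType (d n))
    (Pr : forall n, probability (Omega n) R) (m : nat -> nat)
    (r : forall n, Omega n -> nat)
    (X : forall n, Omega n -> 'M[R[i]]_(n, m n))
    (U : forall n (w : Omega n), 'M[R[i]]_(n, r n w))
    (V : forall n (w : Omega n), 'M[R[i]]_(m n, r n w))
    (theta : forall n (w : Omega n), 'I_(r n w) -> R)
    (mu : probability R R) (c : R) (K : set (R[i])^o) :=
  forall e : R, 0 < e ->
    whp Pr (fun n => [set w | forall z, K z -> G_defined (X n w) z /\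
      (let D := G_mx (X n w) (U n w) (V n w) z - M_mx mu c (r n w) z in
       opnorm (D *m K_mx (theta n w)) + opnorm (K_mx (theta n w) *m D) <= e)]).

Definition jordan_curve (R : realType) (g : R -> (R[i])^o) :=
  [/\ {within `[0, 1]%classic, continuous g}, g 0 = g 1 & set_inj `[0, 1[%classic g].

Definition rectifiable (R : realType) (g : R -> (R[i])^o) :=
  exists L : R, forall s : seq R, itv_partition 0 1 s ->
    \sum_(0 <= k < size s)
      Normc.normc (g (nth 1 (0 :: s) k.+1) - g (nth 1 (0 :: s) k)) <= L.

Definition curve_image (R : realType) (g : R -> (R[i])^o) : set (R[i])^o :=
  g @` `[0, 1]%classic.

Definition curve_inside (R : realType) (g : R -> (R[i])^o) : set (R[i])^o :=
  [set z | ~ curve_image g z /\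
     bounded_set (connected_component (~` curve_image g) z)].

(* A contour is a finite list of parametrized rectifiable Jordan curves. Only its
   image and its interior are used below; since a Jordan curve can always be
   reparametrized positively, its orientation imposes no condition on them. *)
Definition contour (R : realType) (G : seq (R -> (R[i])^o)) :=
  forall j, (j < size G)%N ->
    jordan_curve (nth (fun=> 0) G j) /\ rectifiable (nth (fun=> 0) G j).

Definition contour_image (R : realType) (G : seq (R -> (R[i])^o)) :
    set (R[i])^o :=
  [set z | exists2 j, (j < size G)%N & curve_image (nth (fun=> 0) G j) z].

Definition contour_inside (R : realType) (G : seq (R -> (R[i])^o)) :
    set (R[i])^o :=
  [set z | exists2 j, (j < size G)%N & curve_inside (nth (fun=> 0) G j) z].

(* Theta may be random: the bound C is deterministic and holds on events of
   probability tending to one. Which roots are enclosed is specified in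
   [stable_interval]. *)
Definition stable_contour (R : realType) (d : nat -> measure_display)
    (Omega : forall n, measurableType (d n))
    (Pr : forall n, probability (Omega n) R) (r : forall n, Omega n -> nat)
    (theta : forall n (w : Omega n), 'I_(r n w) -> R)
    (mu : probability R R) (c : R) (G : seq (R -> (R[i])^o)) :=
  [/\ contour G,
      compact (closure (contour_inside G)),
      closure (contour_inside G) `<=` off_cut (edge mu) &
      exists C : R, whp Pr (fun n => [set w | forall z, contour_image G z ->
        let A := 1%:M - M_mx mu c (r n w) z *m K_mx (theta n w) in
        A \in unitmx /\ opnorm (invmx A) <= C])].

Definition stable_interval (R : realType) (d : nat -> measure_display)
    (Omega : forall n, measurableType (d n))
    (Pr : forall n, probability (Omega n) R) (r : forall n, Omega n -> nat)
    (theta : forall n (w : Omega n), 'I_(r n w) -> R)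
    (mu : probability R R) (c : R) (a1 a2 : R) (G : seq (R -> (R[i])^o)) :=
  [/\ edge mu < a1 <= a2,
      exists2 delta : R, 0 < delta & whp Pr (fun n => [set w |
        forall k, delta <= `|rho mu c (theta n w k) - a1| /\
                  delta <= `|rho mu c (theta n w k) - a2|]),
      stable_contour Pr theta mu c G,
      (forall x : R, contour_inside G x%:C <-> a1 < x < a2) &
      whp Pr (fun n => [set w | forall k, theta_star mu c < theta n w k ->
        (contour_inside G (rho mu c (theta n w k))%:C <->
         a1 <= rho mu c (theta n w k) <= a2)])].

Definition singular_pair (R : realType) (F : scalar_field) n m
    (W : 'M[R[i]]_(n, m)) (s : R) (u : 'cV[R[i]]_n) (v : 'cV[R[i]]_m) :=
  [/\ u \is a mxOver (in_scalars F) /\ v \is a mxOver (in_scalars F),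
      enorm u = 1 /\ enorm v = 1,
      W *m v = s%:C *: u &
      W^t* *m u = s%:C *: v].

Definition sv_count (R : realType) n m (W : 'M[R[i]]_(n, m)) (a1 a2 : R) : nat :=
  count (fun s => a1 <= s <= a2) (singular_values W).

(* Main.v *)
Require Import Defs.
From HB Require Import structures.
From mathcomp Require Import all_boot all_order all_algebra spectral complex.
From mathcomp Require Import all_classical all_reals all_analysis.
From mathcomp Require Import measurable_realfun ring lra.

(** Let (s, u, v) be a singular pair of W = X + U Theta V^t* with s in the
    interval J = [a1, a2].  Put x = (u, v), a = U^t* u, b = V^t* v and
    y = (Theta b, Theta a).  With L the linearization of X and E = diag(U, V),
    the equations W v = s u and W^t* u = s v read (s - L) x = E y, so that
    (a, b) = E^t* x = G(s) y.  The unknown y is the one that is already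
    multiplied by the signal strengths; it has norm between (s - B) |x| and
    (s + B) |x| as soon as B bounds the operator norm of X, however large the
    strengths are.  The local law at the real point s therefore gives
      a_l - phi(s) theta_l b_l = d1_l,   b_l - phit(s) theta_l a_l = d2_l
    with (d1, d2) small in norm.

    For every l other than the index k of the spike, the determinant
    1 - d(s) theta_l^2 of this 2 x 2 system is at least c0 (1 + theta_l^2) in
    modulus on J ([detuned]), because d is strictly decreasing and the location of theta_l is
    separated from J.  Hence these coordinates of y vanish in the limit
    ([off_spike_p], [off_spike_q], [off_spike_overlap]).  The k-th coordinates
    carry all of y, whose norm is bounded below, so d(s) theta_k^2 tends to 1,
    that is s tends to rho = rho(theta) ([spike_location]), and a_k is close to
    phi(rho) theta b_k.

    The size of b_k comes from the inner product of two such vectors.  If R is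
    the resolvent of L, then <x1, x2> = <R(s1) E y1, R(s2) E y2> is close to
    <y1, E^t* R(rho) R(rho + h) E y2>, and the resolvent identity gives
    E^t* R(rho) R(rho + h) E = (G(rho) - G(rho + h)) / h ([bilinear]).  The local
    law replaces G by the deterministic M at the cost of error / h, so with h the
    square root of the error one obtains - M'(rho) and
      <x1, x2> = b1_k^* b2_k 2 / kappaR + o(1)     ([inner_cvg]).
    For two equal pairs the left-hand side is 2, which gives the three overlaps
    ([right_cvg], [left_cvg], [mixed_cvg]).  For two orthogonal pairs it is 0,
    which contradicts the lower bound on |b1_k| and |b2_k|: the interval contains
    at most one singular value ([sv_count_le1]).

    It contains at least one since, at z = rho(theta_k), one can choose y so that
    all coordinates of the residual of x = R(z) E y vanish except the k-th ones,
    which the local law makes small ([approximate_eigenvector]); a Hermitian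
    matrix has an eigenvalue at a distance at most the relative residual
    ([eigenvalue_near], [sv_count_near]).

    All this is an estimate about matrices ([single_spike]), uniform in the
    dimensions and in the number of spikes; probability enters only through the
    intersection of finitely many events ([whp_and], [whp_eventually]). *)

Set Implicit Arguments.
Unset Strict Implicit.
Unset Printing Implicit Defensive.

Import Order.TTheory GRing.Theory Num.Theory.
Import numFieldNormedType.Exports.
Import ComplexField.

Local Open Scope classical_set_scope.
Local Open Scope ring_scope.
Local Open Scope complex_scope.
Local Open Scope sesquilinear_scope.

(** * Euclidean norm, inner product and operator norm *)

Section Enorm.
(* Opened last, so that z^* is [Num.conj z], as in the matrix adjoint, and not the
   convertible [conjc z], which rewriting does not identify with it; the same in the
   other sections. *)
Local Open Scope ring_scope.
Variable R : realType.
Local Notation C := R[i].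
Local Notation normc := (@Normc.normc R).

Lemma normr_normc (z : C) : (normc z)%:C = `|z|.
Proof. by []. Qed.

Lemma normc_ge0 (z : C) : 0 <= normc z.
Proof. by rewrite -ler0c normr_normc. Qed.

(** The next lemmas restate the morphism properties of the conjugation: in this
    form they leave [Num.conj] as the head symbol and can be rewritten with again. *)
Lemma conjM (x y : C) : (x * y)^* = x^* * y^*.
Proof. exact: rmorphM. Qed.

Lemma conjD (x y : C) : (x + y)^* = x^* + y^*.
Proof. exact: rmorphD. Qed.

Lemma conjN (x : C) : (- x)^* = - x^*.
Proof. exact: rmorphN. Qed.

Lemma normc_conj (z : C) : normc z^* = normc z.
Proof. by apply: (@complexI R); rewrite !normr_normc normcJ. Qed.

Lemma conj_sum (I : finType) (F : I -> C) : (\sum_i F i)^* = \sum_i (F i)^*.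
Proof. exact: rmorph_sum. Qed.

Lemma normcD (x y : C) : normc (x + y) <= normc x + normc y.
Proof. exact: le_normcD. Qed.

Lemma normc_opp (x : C) : normc (- x) = normc x.
Proof. exact: normcN. Qed.

Lemma normcB (x y : C) : normc (x - y) <= normc x + normc y.
Proof. by rewrite -(normc_opp y) normcD. Qed.

Lemma mulc_conj (z : C) : z^* * z = (normc z ^+ 2)%:C.
Proof. by rewrite rmorphXn /= normr_normc mulrC -sqr_normc. Qed.

Lemma normc_real (a : R) : normc a%:C = `|a|.
Proof. by rewrite /Normc.normc /= expr0n /= addr0 sqrtr_sqr. Qed.

Lemma conj_real (a : R) : (a%:C)^* = a%:C.
Proof. exact: conjc_real. Qed.

Lemma enorm_ge0 n (x : 'cV[C]_n) : 0 <= enorm x.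
Proof. exact: sqrtr_ge0. Qed.

Lemma enorm_sqr n (x : 'cV[C]_n) : enorm x ^+ 2 = \sum_j normc (x j 0) ^+ 2.
Proof. by rewrite sqr_sqrtr //; apply: sumr_ge0 => j _; exact: sqr_ge0. Qed.

Lemma innerE n (x y : 'cV[C]_n) : inner x y = \sum_j (x j 0)^* * y j 0.
Proof. by rewrite /inner mxE; apply: eq_bigr => j _; rewrite !mxE. Qed.

Lemma inner_enorm n (x : 'cV[C]_n) : inner x x = (enorm x ^+ 2)%:C.
Proof.
by rewrite innerE enorm_sqr rmorph_sum; apply: eq_bigr => j _; exact: mulc_conj.
Qed.

Lemma inner_conj n (x y : 'cV[C]_n) : inner y x = (inner x y)^*.
Proof.
rewrite !innerE conj_sum; apply: eq_bigr => j _.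
by rewrite conjM conjCK mulrC.
Qed.

Lemma innerDr n (x y z : 'cV[C]_n) : inner x (y + z) = inner x y + inner x z.
Proof. by rewrite /inner mulmxDr mxE. Qed.

Lemma innerZr n a (x y : 'cV[C]_n) : inner x (a *: y) = a * inner x y.
Proof. by rewrite /inner -scalemxAr mxE. Qed.

Lemma innerNr n (x y : 'cV[C]_n) : inner x (- y) = - inner x y.
Proof. by rewrite -scaleN1r innerZr mulN1r. Qed.

Lemma innerBr n (x y z : 'cV[C]_n) : inner x (y - z) = inner x y - inner x z.
Proof. by rewrite innerDr innerNr. Qed.

Lemma innerDl n (x y z : 'cV[C]_n) : inner (x + y) z = inner x z + inner y z.
Proof. by rewrite inner_conj innerDr conjD -!inner_conj. Qed.

Lemma innerZl n a (x y : 'cV[C]_n) : inner (a *: x) y = a^* * inner x y.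
Proof. by rewrite inner_conj innerZr conjM -!inner_conj. Qed.

Lemma innerNl n (x y : 'cV[C]_n) : inner (- x) y = - inner x y.
Proof. by rewrite inner_conj innerNr conjN -!inner_conj. Qed.

Lemma innerBl n (x y z : 'cV[C]_n) : inner (x - y) z = inner x z - inner y z.
Proof. by rewrite innerDl innerNl. Qed.

Lemma inner_adj n p (A : 'M[C]_(n, p)) (x : 'cV[C]_n) (y : 'cV[C]_p) :
  inner x (A *m y) = inner (A^t* *m x) y.
Proof. by rewrite /inner trmx_mul map_mxM trmxCK mulmxA. Qed.

Lemma inner_adjl n p (A : 'M[C]_(n, p)) (x : 'cV[C]_p) (y : 'cV[C]_n) :
  inner (A *m x) y = inner x (A^t* *m y).
Proof. by rewrite inner_adj trmxCK. Qed.

Lemma inner_col_mx n p (x1 y1 : 'cV[C]_n) (x2 y2 : 'cV[C]_p) :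
  inner (col_mx x1 x2) (col_mx y1 y2) = inner x1 y1 + inner x2 y2.
Proof.
rewrite !innerE big_split_ord /=.
by congr (_ + _); apply: eq_bigr => j _; rewrite ?col_mxEu ?col_mxEd.
Qed.

Lemma enorm_col_mx n p (x : 'cV[C]_n) (y : 'cV[C]_p) :
  enorm (col_mx x y) ^+ 2 = enorm x ^+ 2 + enorm y ^+ 2.
Proof. by apply: (@complexI R); rewrite -inner_enorm inner_col_mx !inner_enorm rmorphD. Qed.

Lemma enorm0 n : enorm (0 : 'cV[C]_n) = 0.
Proof.
apply/eqP; rewrite -sqrf_eq0 enorm_sqr big1 // => j _.
by rewrite mxE Normc.normc0 expr0n.
Qed.

Lemma normc_entry n (x : 'cV[C]_n) k : normc (x k 0) <= enorm x.
Proof.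
rewrite -(@ler_pXn2r _ 2) ?nnegrE ?enorm_ge0 ?normc_ge0 // enorm_sqr (bigD1 k) //=.
by rewrite lerDl; apply: sumr_ge0 => j _; exact: sqr_ge0.
Qed.

Lemma enorm_eq0 n (x : 'cV[C]_n) : enorm x = 0 -> x = 0.
Proof.
move=> x0; apply/colP => j; rewrite mxE; apply: Normc.eq0_normc.
by apply/eqP; rewrite eq_le normc_ge0 andbT -x0 normc_entry.
Qed.

Lemma enormZ n a (x : 'cV[C]_n) : enorm (a *: x) = normc a * enorm x.
Proof.
apply/eqP; rewrite -(@eqrXn2 _ 2) ?mulr_ge0 ?enorm_ge0 ?normc_ge0 //.
rewrite exprMn !enorm_sqr mulr_sumr; apply/eqP; apply: eq_bigr => j _.
by rewrite mxE Normc.normcM exprMn.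
Qed.

Lemma enormN n (x : 'cV[C]_n) : enorm (- x) = enorm x.
Proof. by rewrite -scaleN1r enormZ normc_opp Normc.normc1 mul1r. Qed.

(** The Cauchy-Schwarz inequality of row vectors, transposed. *)
Lemma normc_inner n (x y : 'cV[C]_n) : normc (inner x y) <= enorm x * enorm y.
Proof.
have E (u v : 'cV[C]_n) : dotmx v^T u^T = inner u v.
  rewrite dotmxE innerE mxE; apply: eq_bigr => j _.
  by rewrite !mxE mulrC.
have : `|dotmx y^T x^T| ^+ 2 <= dotmx y^T y^T * dotmx x^T x^T.
  exact: (@CauchySchwarz _ _ (@dotmx C n) y^T x^T).1.
rewrite !E !inner_enorm -normr_normc -!rmorphXn -rmorphM lecR -exprMn.
by rewrite ler_pXn2r ?nnegrE ?mulr_ge0 ?enorm_ge0 ?normc_ge0 // [leRHS]mulrC.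
Qed.

Lemma enormD n (x y : 'cV[C]_n) : enorm (x + y) <= enorm x + enorm y.
Proof.
rewrite -(@ler_pXn2r _ 2) ?nnegrE ?addr_ge0 ?enorm_ge0 //.
have := normc_inner x y; have := normc_inner y x.
have E : (enorm (x + y) ^+ 2)%:C = (enorm x ^+ 2)%:C + (enorm y ^+ 2)%:C
    + (inner x y + inner y x).
  by rewrite -!inner_enorm innerDl !innerDr; ring.
have := normcD (inner x y) (inner y x).
have -> : inner x y + inner y x = (enorm (x + y) ^+ 2 - enorm x ^+ 2 - enorm y ^+ 2)%:C.
  by rewrite !rmorphB /= E; ring.
rewrite normc_real => h1 h2 h3.
have := ler_norm (enorm (x + y) ^+ 2 - enorm x ^+ 2 - enorm y ^+ 2).
by move=> h4; nra.
Qed.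

Lemma enormB n (x y : 'cV[C]_n) : enorm (x - y) <= enorm x + enorm y.
Proof. by rewrite -(enormN y) enormD. Qed.

Lemma enorm_isometry n p (Q : 'M[C]_(n, p)) (x : 'cV[C]_p) :
  Q^t* *m Q = 1%:M -> enorm (Q *m x) = enorm x.
Proof.
move=> QQ; apply/eqP; rewrite -(@eqrXn2 _ 2) ?enorm_ge0 //; apply/eqP.
apply: (@complexI R); rewrite -!inner_enorm inner_adj mulmxA QQ mul1mx.
done.
Qed.

(** The supremum that defines [opnorm] is finite: on the unit ball, the image of a
    vector is at most the sum of the norms of the columns.  Scaling does the rest. *)
Lemma opnorm_le n p (A : 'M[C]_(n, p)) (x : 'cV[C]_p) :
  enorm (A *m x) <= opnorm A * enorm x.
Proof.
have [->|x0] := eqVneq x 0; first by rewrite mulmx0 !enorm0 mulr0.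
have ex : 0 < enorm x.
  rewrite lt_neqAle enorm_ge0 andbT eq_sym; apply: contra x0 => /eqP/enorm_eq0 ->//.
pose S := [set enorm (A *m x) | x in [set x : 'cV_p | enorm x <= 1]].
have ubS : has_ubound S.
  exists (\sum_j enorm (col j A)) => _ /= [y y1 <-].
  have -> : A *m y = \sum_j y j 0 *: col j A.
    apply/colP => k; rewrite mxE summxE; apply: eq_bigr => j _.
    by rewrite !mxE mulrC.
  suff H (s : seq 'I_p) : enorm (\sum_(j <- s) y j 0 *: col j A) <= \sum_(j <- s) enorm (col j A).
    exact: H.
  elim: s => [|j s IH]; first by rewrite !big_nil enorm0.
  rewrite !big_cons (le_trans (enormD _ _)) // lerD // enormZ.
  rewrite ler_piMl ?enorm_ge0 // (le_trans (normc_entry _ _)) //.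
rewrite -ler_pdivrMr //.
apply: ub_le_sup => //; exists ((enorm x)^-1%:C *: x) => /=.
  rewrite enormZ normc_real ger0_norm ?invr_ge0 ?enorm_ge0 // mulVf //.
  by rewrite gt_eqF.
rewrite -scalemxAr enormZ normc_real ger0_norm ?invr_ge0 ?enorm_ge0 // mulrC.
done.
Qed.

End Enorm.

(** * The Hermitian linearization and its resolvent *)

Section Linearization.
Local Open Scope ring_scope.
Variable R : realType.
Local Notation C := R[i].
Local Notation normc := (@Normc.normc R).

Lemma linearization_herm n m (X : 'M[C]_(n, m)) :
  (linearization X)^t* = linearization X.
Proof.
by rewrite /linearization tr_block_mx map_block_mx !trmx0 !map_mx0 trmxCK.
Qed.

Lemma mul_linearization n m (X : 'M[C]_(n, m)) (u : 'cV[C]_n) (v : 'cV[C]_m) :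
  linearization X *m col_mx u v = col_mx (X *m v) (X^t* *m u).
Proof. by rewrite /linearization mul_block_col !mul0mx add0r addr0. Qed.

(** A matrix and its adjoint have the same bound since
    |X^t* u|^2 = <u, X X^t* u> <= B |u| |X^t* u|. *)
Lemma enorm_adj_le n m (X : 'M[C]_(n, m)) B (u : 'cV[C]_n) : 0 <= B ->
  (forall v, enorm (X *m v) <= B * enorm v) ->
  enorm (X^t* *m u) <= B * enorm u.
Proof.
move=> B0 XB; have [->|xu0] := eqVneq (enorm (X^t* *m u)) 0.
  by rewrite mulr_ge0 ?enorm_ge0.
have xu : 0 < enorm (X^t* *m u) by rewrite lt_neqAle eq_sym xu0 enorm_ge0.
rewrite -(ler_pM2r xu) -expr2.
have -> : enorm (X^t* *m u) ^+ 2 = normc (inner u (X *m (X^t* *m u))).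
  by rewrite inner_adj inner_enorm normc_real ger0_norm ?sqr_ge0.
rewrite (le_trans (normc_inner _ _)) // (mulrC B) -mulrA ler_wpM2l ?enorm_ge0 //.
Qed.

Lemma linearization_le n m (X : 'M[C]_(n, m)) B (x : 'cV[C]_(n + m)) : 0 <= B ->
  (forall v, enorm (X *m v) <= B * enorm v) ->
  enorm (linearization X *m x) <= B * enorm x.
Proof.
move=> B0 XB; rewrite -(vsubmxK x) mul_linearization.
rewrite -(@ler_pXn2r _ 2) ?nnegrE ?mulr_ge0 ?enorm_ge0 //.
rewrite exprMn !enorm_col_mx mulrDr addrC -!exprMn.
by rewrite lerD // ler_pXn2r ?nnegrE ?mulr_ge0 ?enorm_ge0 // enorm_adj_le.
Qed.

(** The quantitative form of z > |L|: it makes the resolvent exist with norm at most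
    1 / (z - B). *)
Lemma resolvent_ge n m (X : 'M[C]_(n, m)) B z (x : 'cV[C]_(n + m)) : 0 <= B ->
  (forall v, enorm (X *m v) <= B * enorm v) -> 0 <= z ->
  (z - B) * enorm x <= enorm ((z%:C%:M - linearization X) *m x).
Proof.
move=> B0 XB z0; rewrite mulrBl lerBlDr.
apply: le_trans (lerD (lexx _) (linearization_le x B0 XB)).
apply: le_trans (enormD _ _).
by rewrite mulmxBl subrK mul_scalar_mx enormZ normc_real ger0_norm.
Qed.

Lemma resolvent_le n m (X : 'M[C]_(n, m)) B z (x : 'cV[C]_(n + m)) : 0 <= B ->
  (forall v, enorm (X *m v) <= B * enorm v) -> 0 <= z ->
  enorm ((z%:C%:M - linearization X) *m x) <= (z + B) * enorm x.
Proof.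
move=> B0 XB z0; rewrite mulmxBl mul_scalar_mx (le_trans (enormB _ _)) //.
by rewrite enormZ normc_real ger0_norm // mulrDl lerD2l linearization_le.
Qed.

Lemma unitmx_inj (F : fieldType) n (A : 'M[F]_n) :
  (forall x : 'cV_n, A *m x = 0 -> x = 0) -> A \in unitmx.
Proof.
move=> inj; rewrite -unitmx_tr -row_free_unit.
apply: inj_row_free => v vA; apply: trmx_inj; rewrite trmx0; apply: inj.
by apply: trmx_inj; rewrite trmx_mul trmxK trmx0.
Qed.

Lemma resolvent_unit n m (X : 'M[C]_(n, m)) B z : 0 <= B ->
  (forall v, enorm (X *m v) <= B * enorm v) -> B < z ->
  z%:C%:M - linearization X \in unitmx.
Proof.
move=> B0 XB Bz; apply: unitmx_inj => x x0.
have := resolvent_ge x B0 XB (le_trans B0 (ltW Bz)).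
rewrite x0 enorm0 pmulr_rle0 ?subr_gt0 // => x1.
by apply: enorm_eq0; apply/eqP; rewrite eq_le x1 enorm_ge0.
Qed.

Lemma E_mx_adj n m r (U : 'M[C]_(n, r)) (V : 'M[C]_(m, r)) :
  (E_mx U V)^t* = block_mx (U^t*) 0 0 (V^t*).
Proof. by rewrite /E_mx tr_block_mx map_block_mx !trmx0 !map_mx0. Qed.

Lemma E_mx_isometry n m r (U : 'M[C]_(n, r)) (V : 'M[C]_(m, r)) :
  U^t* *m U = 1%:M -> V^t* *m V = 1%:M -> (E_mx U V)^t* *m E_mx U V = 1%:M.
Proof.
move=> UU VV; rewrite E_mx_adj mulmx_block UU VV !mul0mx !mulmx0 !addr0 !add0r.
by rewrite -scalar_mx_block.
Qed.

(** Lets one work with a solution x of (z - L) x = E y in place of the inverse. *)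
Lemma G_mxP n m r (X : 'M[C]_(n, m)) (U : 'M[C]_(n, r)) (V : 'M[C]_(m, r)) z
    (x : 'cV[C]_(n + m)) (y : 'cV[C]_(r + r)) :
  z%:M - linearization X \in unitmx ->
  (z%:M - linearization X) *m x = E_mx U V *m y ->
  G_mx X U V z *m y = (E_mx U V)^t* *m x.
Proof. by move=> Xu xy; rewrite /G_mx -!mulmxA -xy mulKmx. Qed.

End Linearization.

(** * Eigenvalues and eigenvectors of Hermitian matrices *)

Section Spectral.
Local Open Scope ring_scope.
Variable R : realType.
Local Notation C := R[i].
Local Notation normc := (@Normc.normc R).

Section Hermitian.
Local Open Scope ring_scope.
Variables (n : nat) (A : 'M[C]_n).
Hypothesis hA : A^t* = A.

Let hermA : A \is hermsymmx.
Proof. by rewrite qualifE /= expr0 scale1r hA. Qed.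

Let lam j : R := complex.Re (spectral_diag A 0 j).
Let w j : 'cV[C]_n := col j ((spectralmx A)^t*).

Let lamE j : spectral_diag A 0 j = (lam j)%:C.
Proof.
have /mxOverP/(_ 0 j) h := hermitian_spectral_diag_real hermA.
by rewrite /lam RRe_real.
Qed.

Let spA : spectralmx A *m A = diag_mx (spectral_diag A) *m spectralmx A.
Proof.
have /orthomx_spectralP E := hermitian_normalmx hermA.
rewrite [X in _ *m X = _]E !mulmxA mulmxV ?mul1mx //.
exact: spectral_unit.
Qed.

(** In an orthonormal eigenbasis the residual multiplies the j-th coordinate of x by
    z - lambda_j; if all these factors exceeded e in modulus, the residual would be
    longer than e |x|. *)
Lemma eigenvalue_near (z e : R) (x : 'cV[C]_n) : x != 0 ->
  enorm (z%:C *: x - A *m x) <= e * enorm x ->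
  exists j, `|z - complex.Re (spectral_diag A 0 j)| <= e.
Proof.
move=> x0 xe; pose P := spectralmx A.
have PP : P *m P^t* = 1%:M by apply/unitarymxP; exact: spectral_unitarymx.
have PP' : P^t* *m P = 1%:M by apply: mulmx1C.
have eP (y : 'cV[C]_n) : enorm (P *m y) = enorm y.
  by apply: enorm_isometry.
apply: contrapT => /forallNP far.
have e0 : 0 <= e.
  have := le_trans (enorm_ge0 _) xe; rewrite pmulr_lge0 //.
  rewrite lt_neqAle enorm_ge0 andbT eq_sym.
  by apply: contra x0 => /eqP/enorm_eq0->.
pose y := P *m x.
have yE : P *m (z%:C *: x - A *m x) = \col_j ((z - lam j)%:C * y j 0).
  rewrite mulmxBr mulmxA spA -mulmxA -/P -/y -scalemxAr -/y.
  by apply/colP => j; rewrite mul_diag_mx !mxE lamE rmorphB /= mulrBl.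
have y0 : y != 0.
  apply: contra x0 => /eqP y0; apply/eqP; apply: enorm_eq0.
  by rewrite -eP -/y y0 enorm0.
have /cV0Pn[j yj] := y0.
suff : (e * enorm y) ^+ 2 < enorm (P *m (z%:C *: x - A *m x)) ^+ 2.
  rewrite !eP ltr_pXn2r ?nnegrE ?mulr_ge0 ?enorm_ge0 //.
  by rewrite ltNge xe.
have far2 k : e ^+ 2 < `|z - lam k| ^+ 2.
  by rewrite ltr_pXn2r ?nnegrE // ltNge; apply/negP/far.
rewrite exprMn !enorm_sqr mulr_sumr yE (bigD1 j) //= [ltRHS](bigD1 j) //=.
apply: ltr_leD; last first.
  apply: ler_sum => k _; rewrite mxE Normc.normcM exprMn normc_real.
  by rewrite ler_wpM2r ?sqr_ge0 // ltW.
rewrite mxE Normc.normcM exprMn normc_real ltr_pM2r // exprn_gt0 //.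
rewrite lt_neqAle normc_ge0 andbT eq_sym; apply: contra yj => /eqP/Normc.eq0_normc->.
by [].
Qed.

Lemma eigenvectors :
  exists w : 'I_n -> 'cV[C]_n,
    (forall j, A *m w j = (complex.Re (spectral_diag A 0 j))%:C *: w j) /\
    (forall j k, inner (w j) (w k) = (j == k)%:R).
Proof.
exists w; pose P := spectralmx A.
have PP : P *m P^t* = 1%:M by apply/unitarymxP; exact: spectral_unitarymx.
have PP' : P^t* *m P = 1%:M by apply: mulmx1C.
split=> [j|j k].
  have AP : A *m P^t* = P^t* *m diag_mx (spectral_diag A).
    by rewrite -[A *m _]mul1mx -PP' -mulmxA [P *m _]mulmxA spA -!mulmxA PP mulmx1.
  rewrite /w -!/P colE mulmxA AP -mulmxA -!lamE.
  rewrite -[X in _ = _ *: X]colE; apply/colP => k.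
  by rewrite mulmxA -colE !mxE (bigD1 j) //= big1 => [|l lj];
    rewrite !mxE ?eqxx ?(negbTE lj) ?mulr0 // mulr1n addr0 mulrC.
rewrite innerE; have /matrixP/(_ j k) := PP; rewrite !mxE => <-.
by apply: eq_bigr => l _; rewrite !mxE conjCK mulrC.
Qed.

End Hermitian.
End Spectral.

(** * Counting singular values in an interval *)

Section SingularValues.
Local Open Scope ring_scope.
Variable R : realType.
Local Notation C := R[i].
Local Notation normc := (@Normc.normc R).

Lemma sv_countE n m (W : 'M[C]_(n, m)) a1 a2 : sv_count W a1 a2 =
  #|[pred j | a1 <= Num.sqrt (complex.Re (spectral_diag (W *m W^t*) 0 j)) <= a2]|.
Proof.
by rewrite /sv_count /singular_values /eigenvalues !count_map cardE -size_filter
  /enum_mem filter_predI -enumT /=; congr (size _); apply: eq_filter.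
Qed.

Lemma gram_herm n m (W : 'M[C]_(n, m)) : (W *m W^t*)^t* = W *m W^t*.
Proof. by rewrite trmx_mul map_mxM trmxCK. Qed.

(** The hypotheses make u an eigenvector of W W^t* for s^2, and u = 0 would force
    v = 0. *)
Lemma sv_count_gt0 n m (W : 'M[C]_(n, m)) a1 a2 s (u : 'cV_n) (v : 'cV_m) :
  0 < a1 -> a1 <= s <= a2 -> col_mx u v != 0 ->
  W *m v = s%:C *: u -> W^t* *m u = s%:C *: v ->
  (0 < sv_count W a1 a2)%N.
Proof.
move=> a10 sJ uv0 Wv Wu; have s0 : 0 < s by case/andP: sJ => /(lt_le_trans a10).
have u0 : u != 0.
  apply: contra uv0 => /eqP u0; have /eqP := Wu.
  rewrite u0 mulmx0 eq_sym scaler_eq0 => /orP[|/eqP->]; last by rewrite col_mx0.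
  by rewrite (inj_eq (@complexI R) s 0) gt_eqF.
have [j] : exists j, `|s ^+ 2 - complex.Re (spectral_diag (W *m W^t*) 0 j)| <= 0.
  apply: (eigenvalue_near (gram_herm W) u0).
  by rewrite -mulmxA Wu -scalemxAr Wv scalerA -rmorphM -expr2 subrr enorm0 mul0r.
rewrite normr_le0 subr_eq0 => /eqP sj; rewrite sv_countE.
by apply/card_gt0P; exists j; rewrite inE -sj sqrtr_sqr ger0_norm // ltW.
Qed.

(** Two singular values in the interval, equal or not, come from two orthonormal
    eigenvectors of W W^t*; completing them by v = s^-1 W^t* u gives two singular pairs
    that are orthogonal on both sides. *)
Lemma sv_count_le1 n m (W : 'M[C]_(n, m)) a1 a2 : 0 < a1 ->
  (forall s1 s2 u1 v1 u2 v2, a1 <= s1 <= a2 -> a1 <= s2 <= a2 ->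
    singular_pair ComplexScalars W s1 u1 v1 ->
    singular_pair ComplexScalars W s2 u2 v2 ->
    inner u1 u2 = 0 -> inner v1 v2 = 0 -> False) ->
  (sv_count W a1 a2 <= 1)%N.
Proof.
move=> a10 noorth; rewrite leqNgt; apply/negP; rewrite sv_countE.
move=> /card_gt1P[j [k []]]; rewrite !inE => Jj Jk jk.
have [w [eigw orthw]] := eigenvectors (gram_herm W).
pose lam l := complex.Re (spectral_diag (W *m W^t*) 0 l).
pose s l := Num.sqrt (lam l).
pose v l := (s l)^-1%:C *: (W^t* *m w l).
have sW l : a1 <= s l <= a2 -> W *m v l = (s l)%:C *: w l /\ W^t* *m w l = (s l)%:C *: v l.
  move=> /andP[a1s _]; have s0 : s l != 0 by rewrite gt_eqF // (lt_le_trans a10).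
  have s2 : s l ^+ 2 = lam l.
    rewrite sqr_sqrtr // leNgt; apply: contra s0 => l0.
    by rewrite /s ler0_sqrtr // ltW.
  split; last by rewrite /v scalerA -rmorphM /= mulfV // scale1r.
  rewrite /v -scalemxAr mulmxA eigw -/(lam l) scalerA -rmorphM /= -s2 expr2.
  by rewrite mulrA mulVf // mul1r.
have innv l l' : a1 <= s l <= a2 -> a1 <= s l' <= a2 ->
    inner (v l) (v l') = (s l / s l')%:C * inner (w l) (w l').
  move=> Jl Jl'; have [Wv Wu] := sW _ Jl; have [Wv' Wu'] := sW _ Jl'.
  rewrite {2}/v innerZr inner_adj trmxCK Wv innerZl mulrA; congr (_ * _).
  transitivity (((s l')^-1)%:C * (s l)%:C); last by rewrite -rmorphM /= mulrC.
  by congr (_ * _); exact: conj_real.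
have pair l : a1 <= s l <= a2 -> singular_pair ComplexScalars W (s l) (w l) (v l).
  move=> Jl; have [Wv Wu] := sW _ Jl; split => //.
    by split; apply/mxOverP.
  have s0 : s l != 0 by case/andP: Jl => h _; rewrite gt_eqF // (lt_le_trans a10).
  have enorm1 p (x : 'cV[C]_p) : inner x x = 1 -> enorm x = 1.
    move=> h; apply/eqP; rewrite -(@eqrXn2 _ 2) ?enorm_ge0 //.
    by rewrite expr1n; apply/eqP/(@complexI R); rewrite -inner_enorm h.
  split; apply: enorm1; first by rewrite orthw eqxx.
  by rewrite innv // divff // orthw eqxx mulr1.
apply: (noorth _ _ _ _ _ _ Jj Jk (pair j Jj) (pair k Jk)).
  by rewrite orthw (negbTE jk).
by rewrite innv // orthw (negbTE jk) mulr0.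
Qed.

Lemma sv_count_near n m (W : 'M[C]_(n, m)) a1 a2 z e (x : 'cV_(n + m)) :
  0 < a1 -> a1 <= z - e -> z + e <= a2 -> x != 0 ->
  enorm ((z%:C%:M - linearization W) *m x) <= e * enorm x ->
  (0 < sv_count W a1 a2)%N.
Proof.
move=> a10 ze1 ze2 x0; rewrite mulmxBl mul_scalar_mx => xe.
have [j] := eigenvalue_near (linearization_herm W) x0 xe.
have [w [eigw orthw]] := eigenvectors (linearization_herm W).
set s := complex.Re _ => sz.
have wj0 : w j != 0.
  apply/eqP => w0; have := orthw j j; rewrite w0 /inner mulmx0 mxE eqxx.
  by move/esym/eqP; rewrite oner_eq0.
have := eigw j; rewrite -/s -(vsubmxK (w j)) mul_linearization scale_col_mx.
move=> /eq_col_mx[Wv Wu]; apply: (@sv_count_gt0 _ _ W _ _ s) Wv Wu => //.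
  by move: sz; rewrite ler_norml => /andP[? ?]; apply/andP; split; lra.
by rewrite vsubmxK.
Qed.
End SingularValues.

(** * The limiting noise measure lives on [0, b^2] *)

Section Support.
Local Open Scope ring_scope.
Variables (R : realType) (mu : probability R R).

(** The inverse is not continuous at 0, where it has the value 0; writing it as
    x |x|^-2 with the measurable real power avoids a case split on the domain. *)
Lemma measurable_fun_inv : measurable_fun setT (fun x : R => x^-1).
Proof.
rewrite (_ : (fun x : R => x^-1) = (fun x => x * (`|x| `^ (-1)) ^+ 2)).
  apply: measurable_funM => //; apply: measurable_funX.
  apply: (@measurableT_comp _ _ _ _ _ _ (fun x : R => x `^ (-1)) _ (@Num.norm R R)); first exact: measurable_powR.
  by [].
apply/funext => x; rewrite powR_inv1 // exprVn real_normK ?num_real //.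
by have [->|x0] := eqVneq x 0; [rewrite invr0 mul0r | field].
Qed.

(** The real line is second countable: every point of O lies in a null interval with
    rational endpoints, and there are countably many of these. *)
Lemma outside_support_null (O : set R) : open O -> O `<=` ~` msupport mu ->
  mu O = 0%E.
Proof.
move=> oO Osupp.
pose I (pq : rat * rat) : set R := `]ratr pq.1, ratr pq.2[%classic.
pose F k := if @unpickle (rat * rat)%type k is Some pq then
  if mu (I pq) == 0%E then I pq else set0 else set0.
have FE pq : F (pickle pq) = if mu (I pq) == 0%E then I pq else set0.
  by rewrite /F pickleK.
have mF k : measurable (F k).
  by rewrite /F; case: unpickle => [pq|]; [case: ifP => _; [exact: measurable_itv|]|]; exact: measurable0.
have F0 k : mu (F k) = 0%E.
  by rewrite /F; case: unpickle => [pq|]; [case: ifP => [/eqP//|]|]; rewrite measure0.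
have : mu.-negligible (\bigcup_k F k).
  by apply: negligible_bigcup => k; exists (F k); split; [exact: mF|exact: F0|].
have OF : O `<=` \bigcup_k F k.
  move=> x Ox; have /existsNP[U /not_implyP[oU /not_implyP[Ux]]] := Osupp _ Ox.
  move=> /negP; rewrite -leNgt => U0.
  have /nbhs_ballP[e /= e0 eU] : nbhs x U by apply: open_nbhs_nbhs.
  have [p /andP[xp px]] : exists p : rat, x - e < ratr p < x.
    have [p] := @rat_in_itvoo R (x - e) x ltac:(move: e0 => /= e0; lra); rewrite in_itv; by exists p.
  have [q /andP[xq qx]] : exists q : rat, x < ratr q < x + e.
    have [q] := @rat_in_itvoo R x (x + e) ltac:(move: e0 => /= e0; lra); rewrite in_itv; by exists q.
  exists (pickle (p, q)); first exact: Logic.I.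
  rewrite FE.
  have -> : mu (I (p, q)) = 0%E.
    apply/eqP; rewrite eq_le measure_ge0 andbT (le_trans _ U0) //.
    apply: le_measure; [rewrite inE; exact: measurable_itv | rewrite inE; exact: open_measurable | ].
    move=> y yI; have {yI} : y \in `]ratr p, ratr q[ by [].
    rewrite in_itv /= => /andP[py yq]; apply: eU.
      rewrite /ball /= ltr_norml; apply/andP; split; lra.
  by rewrite eqxx; change (x \in `]ratr p, ratr q[); rewrite in_itv /= px xq.
move=> [N [mN N0 FN]]; apply/eqP; rewrite eq_le measure_ge0 andbT -N0.
by apply: le_measure; rewrite ?inE //; [exact: open_measurable | apply: subset_trans FN].
Qed.

Hypothesis mu_ge0 : mu `[0, +oo[%classic = 1%E.
Hypothesis mu_cpt : compact (msupport mu).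

Lemma edge_ge0 : 0 <= edge mu.
Proof. exact: sqrtr_ge0. Qed.

Lemma noise_concentrated : mu (~` `[0, edge mu ^+ 2]%classic) = 0%E.
Proof.
have le_b x : msupport mu x -> x <= edge mu ^+ 2.
  move=> sx; have xs : x <= sup (msupport mu).
    apply: ub_le_sup => //; have [M [_ bM]] := compact_bounded mu_cpt.
    exists (M + 1) => y sy; apply: le_trans (ler_norm _) _.
    by apply: bM => //; rewrite ltrDl.
  have [s0|s0] := leP 0 (sup (msupport mu)); first by rewrite sqr_sqrtr.
  by rewrite (le_trans xs) // (le_trans (ltW s0)) // sqr_ge0.
have right0 : mu `]edge mu ^+ 2, +oo[%classic = 0%E.
  apply: outside_support_null; first exact: interval_open.
  move=> x; rewrite /= in_itv /= andbT => bx /le_b.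
  by rewrite leNgt bx.
have left0 : mu (~` `[0, +oo[%classic) = 0%E.
  by rewrite probability_setC // mu_ge0 subee.
apply/eqP; rewrite eq_le measure_ge0 andbT.
have -> : 0%E = (mu (~` `[0%R, +oo[%classic) + mu `](edge mu ^+ 2)%R, +oo[%classic)%E.
  by rewrite left0 right0 adde0.
apply: (le_trans _ (measureU2 _ _ _)) => //; last exact: measurableC.
apply: le_measure; rewrite ?inE; first exact: measurableC.
  by apply: measurableU => //; exact: measurableC.
move=> x; rewrite /= !in_itv /= => /negP; rewrite negb_and => /orP[h|h].
  by left; rewrite andbT; apply/negP.
by right; rewrite andbT ltNge.
Qed.

End Support.

(** * The transforms phi, phit and d to the right of the edge *)

Section Transforms.
Local Open Scope ring_scope.
Variables (R : realType) (mu : probability R R) (c : R).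
Hypothesis mu_ge0 : mu `[0, +oo[%classic = 1%E.
Hypothesis mu_cpt : compact (msupport mu).
Hypothesis c_range : 0 < c <= 1.
Local Notation b := (edge mu).
Local Notation D := `[0, b ^+ 2]%classic.
Local Notation I f := (Rintegral mu D f).

Let mD : measurable D. Proof. exact: measurable_itv. Qed.

Let muD : mu D = 1%E.
Proof.
have := noise_concentrated mu_ge0 mu_cpt; rewrite probability_setC //.
have /fineK <- : mu D \is a fin_num by exact: fin_num_measure.
by move=> [h]; congr (_%:E); lra.
Qed.

(** Off D the integrands have a pole and take an arbitrary value there; this lemma
    discards that part of the line. *)
Lemma Rintegral_noise (f : R -> R) : measurable_fun setT f ->
  Rintegral mu setT f = I f.
Proof.
move=> mf; rewrite [RHS]Rintegral_mkcond /Rintegral; congr fine.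
apply: ae_eq_integral => //.
- exact/measurable_EFinP.
- by apply/measurable_EFinP; apply: (measurable_restrictT _ _).1 => //; exact: measurable_funTS.
- exists (~` D); split; [exact: measurableC|exact: noise_concentrated|].
  by move=> x nfg Dx; apply: nfg => _ /=; rewrite patchE mem_set.
Qed.

(** The class in which all integrands of this file lie: it is stable under sums and
    products and contained in the integrable functions, so that integrability becomes
    a syntactic check. *)
Definition tame (f : R -> R) :=
  measurable_fun setT f /\ exists M, forall x, D x -> `|f x| <= M.

Lemma tame_integrable f : tame f -> mu.-integrable D (EFin \o f).
Proof.
move=> [mf [M fM]]; apply: measurable_bounded_integrable => //.
- by apply: (@le_lt_trans _ _ 1%E); [rewrite -muD | exact: ltry].
- exact: measurable_funTS.
- exists M; split; first exact: num_real.
  by move=> y My x Dx /=; rewrite (le_trans (fM _ Dx)) // ltW.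
Qed.

Lemma tameM f g : tame f -> tame g -> tame (fun x => f x * g x).
Proof.
move=> [mf [M fM]] [mg [N gN]]; split; first exact: measurable_funM.
by exists (M * N) => x Dx; rewrite normrM ler_pM // ?fM ?gN.
Qed.

Lemma tameD f g : tame f -> tame g -> tame (fun x => f x + g x).
Proof.
move=> [mf [M fM]] [mg [N gN]]; split; first exact: measurable_funD.
by exists (M + N) => x Dx; rewrite (le_trans (ler_normD _ _)) // lerD ?fM ?gN.
Qed.

Lemma tame_cst k : tame (fun=> k).
Proof. by split; [exact: measurable_cst|exists `|k|]. Qed.

Lemma tame_id : tame id.
Proof.
split; first exact: measurable_id.
exists (b ^+ 2) => x; rewrite /= in_itv /= => /andP[x0 xb].
by rewrite ger0_norm.
Qed.

Lemma gap_gt0 z x : b < z -> D x -> 0 < z ^+ 2 - b ^+ 2 <= z ^+ 2 - x.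
Proof.
rewrite /= in_itv /= => bz /andP[x0 xb]; have b0 := edge_ge0 mu.
by apply/andP; split; [rewrite subr_gt0 ltr_pXn2r ?nnegrE //; lra | lra].
Qed.

Lemma tame_gapV z : b < z -> tame (fun x => (z ^+ 2 - x)^-1).
Proof.
move=> bz; split.
  apply: (@measurableT_comp _ _ _ _ _ _ (fun x : R => x^-1)).
    exact: measurable_fun_inv.
  exact: measurable_funB.
exists (z ^+ 2 - b ^+ 2)^-1 => x /(gap_gt0 bz)/andP[h1 h2].
by rewrite ger0_norm ?invr_ge0 ?lef_pV2 ?posrE //; lra.
Qed.

Lemma I_le f g : tame f -> tame g -> (forall x, D x -> f x <= g x) -> I f <= I g.
Proof. by move=> tf tg fg; apply: le_Rintegral => //; exact: tame_integrable. Qed.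

Lemma I_cst k : I (fun=> k) = k.
Proof.
rewrite Rintegral_cst //.
by transitivity (k * 1); [congr (_ * _); exact: (congr1 fine muD) | rewrite mulr1].
Qed.

Lemma I_D f g : tame f -> tame g -> I (fun x => f x + g x) = I f + I g.
Proof. by move=> tf tg; rewrite RintegralD //; exact: tame_integrable. Qed.

Lemma I_Z k f : tame f -> I (fun x => k * f x) = k * I f.
Proof. by move=> tf; rewrite RintegralZl //; exact: tame_integrable. Qed.

Lemma phi_integrand z x : z%:C / (z%:C ^+ 2 - x%:C) = (z / (z ^+ 2 - x))%:C :> R[i].
Proof. by rewrite rmorphM /= fmorphV /= rmorphB /= rmorphXn. Qed.

Lemma phi_real z : phi mu z%:C = (phiR mu z)%:C.
Proof.
rewrite /phiR /phi /cintegral; congr (_ +i* _).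
rewrite (_ : (fun x => _) = fun=> 0) ?Rintegral_cst ?mul0r //.
by apply/funext => x; rewrite phi_integrand.
Qed.

Lemma phiRE z : b < z -> phiR mu z = I (fun x => z * (z ^+ 2 - x)^-1).
Proof.
move=> bz; rewrite -Rintegral_noise.
  congr Rintegral; apply/funext => x; by rewrite phi_integrand.
exact: (tameM (tame_cst z) (tame_gapV bz)).1.
Qed.

Lemma phit_realE z : phit mu c z%:C = (c * phiR mu z + (1 - c) / z)%:C.
Proof. by rewrite /phit phi_real [RHS]rmorphD /= !rmorphM /= fmorphV. Qed.

Lemma phitRE z : phitR mu c z = c * phiR mu z + (1 - c) / z.
Proof. by rewrite /phitR phit_realE. Qed.

Lemma phit_real z : phit mu c z%:C = (phitR mu c z)%:C.
Proof. by rewrite phit_realE phitRE. Qed.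

Lemma dRE z : dR mu c z = phiR mu z * phitR mu c z.
Proof. by rewrite /dR /dtrans phi_real phit_real -rmorphM. Qed.

(** The divided difference of phi with the sign changed, written as an integral: it
    is positive and extends to the diagonal, where it is - phi'. *)
Definition phi_slope z w := I (fun x => (z * w + x) * ((z ^+ 2 - x)^-1 * (w ^+ 2 - x)^-1)).

Let tame_slope z w : b < z -> b < w ->
  tame (fun x => (z * w + x) * ((z ^+ 2 - x)^-1 * (w ^+ 2 - x)^-1)).
Proof.
move=> bz bw; apply: tameM; first exact: (tameD (tame_cst _) tame_id).
by apply: tameM; exact: tame_gapV.
Qed.

Lemma edge_lt_gt0 z : b < z -> 0 < z.
Proof. exact: le_lt_trans (edge_ge0 mu). Qed.

Lemma phi_slope_ge z w : b < z -> b < w -> (z * w)^-1 <= phi_slope z w.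
Proof.
move=> bz bw; rewrite -[leLHS]I_cst; apply: I_le; [exact: tame_cst|exact: tame_slope|].
have z0 := edge_lt_gt0 bz; have w0 := edge_lt_gt0 bw.
move=> x Dx; have /andP[z1 z2] := gap_gt0 bz Dx; have /andP[w1 w2] := gap_gt0 bw Dx.
have x0 : 0 <= x by move: Dx; rewrite /= in_itv => /andP[].
have zx : 0 < z ^+ 2 - x by lra.
have wx : 0 < w ^+ 2 - x by lra.
have -> : (z * w)^-1 = (z * w) * ((z ^+ 2)^-1 * (w ^+ 2)^-1).
  by field; rewrite !gt_eqF.
apply: ler_pM; rewrite ?mulr_ge0 ?invr_ge0 ?sqr_ge0 ?(ltW z0) ?(ltW w0) //; first by lra.
by apply: ler_pM; rewrite ?invr_ge0 ?sqr_ge0 // lef_pV2 ?posrE ?exprn_gt0 //; lra.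
Qed.

Lemma phiR_diff z w : b < z -> b < w -> phiR mu z - phiR mu w = (w - z) * phi_slope z w.
Proof.
move=> bz bw; apply/eqP; rewrite subr_eq; apply/eqP; rewrite !phiRE //.
rewrite -I_Z; last exact: tame_slope.
rewrite -I_D; [|apply: tameM|apply: tameM];
  try solve [exact: tame_cst|exact: tame_gapV|exact: tame_slope].
apply: eq_Rintegral => x /set_mem Dx.
have /andP[z1 z2] := gap_gt0 bz Dx; have /andP[w1 w2] := gap_gt0 bw Dx.
by field; apply/andP; split; lra.
Qed.

Lemma phiR_bounds z : b < z -> z^-1 <= phiR mu z <= z / (z ^+ 2 - b ^+ 2).
Proof.
move=> bz; have z0 := edge_lt_gt0 bz; rewrite phiRE //.
have t : tame (fun x => z * (z ^+ 2 - x)^-1).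
  by apply: tameM; [exact: tame_cst | exact: tame_gapV].
have t1 k : tame (fun=> k) := tame_cst k.
apply/andP; split.
  rewrite -[leLHS]I_cst; apply: I_le => // x Dx.
  have /andP[z1 z2] := gap_gt0 bz Dx.
  have x0 : 0 <= x by move: Dx; rewrite /= in_itv => /andP[].
  have -> : z^-1 = z * (z ^+ 2)^-1 by field; rewrite gt_eqF.
  by rewrite ler_pM2l // lef_pV2 ?posrE ?exprn_gt0 //; lra.
rewrite -[leRHS]I_cst; apply: I_le => // x Dx.
have /andP[z1 z2] := gap_gt0 bz Dx.
by rewrite ler_pM2l // lef_pV2 ?posrE //; lra.
Qed.

(** Both bounds hold for phi and for 1/z, and phit is a convex combination of the
    two. *)
Lemma phitR_bounds z : b < z -> z^-1 <= phitR mu c z <= z / (z ^+ 2 - b ^+ 2).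
Proof.
move=> bz; have z0 := edge_lt_gt0 bz; rewrite phitRE.
have /andP[h1 h2] := phiR_bounds bz.
have h3 : z^-1 <= z / (z ^+ 2 - b ^+ 2) := le_trans h1 h2.
set s := z^-1 in h1 h3 *; set t := z / _ in h2 h3 *.
have /andP[c0 c1] := c_range.
have k1 : c * s <= c * phiR mu z by rewrite ler_pM2l.
have k2 : c * phiR mu z <= c * t by rewrite ler_pM2l.
have k3 : (1 - c) * s <= (1 - c) * t by rewrite ler_wpM2l // subr_ge0.
by apply/andP; split; lra.
Qed.

(** A quantitative strict monotonicity.  It is used in both directions: to invert d
    near the spike, and to keep d(z) theta^2 away from 1 for the other strengths. *)
Lemma dR_drop z w hi : b < z -> z <= w <= hi ->
  (w - z) / hi ^+ 3 <= dR mu c z - dR mu c w.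
Proof.
move=> bz /andP[zw whi]; have z0 := edge_lt_gt0 bz.
have bw := lt_le_trans bz zw; have w0 := edge_lt_gt0 bw.
have hi0 : 0 < hi by lra.
have /andP[p1 _] := phiR_bounds bz; have /andP[q1 _] := phitR_bounds bw.
have /andP[q2 _] := phitR_bounds bz.
have pd := phiR_diff bz bw; have pg := phi_slope_ge bz bw.
have qd : phitR mu c z - phitR mu c w = (w - z) * (c * phi_slope z w + (1 - c) / (z * w)).
  rewrite !phitRE (_ : c * phiR mu z = c * (phiR mu w + (w - z) * phi_slope z w)).
    by field; rewrite !gt_eqF.
  by rewrite -pd; ring.
have qg : (z * w)^-1 <= c * phi_slope z w + (1 - c) / (z * w).
    have /andP[c0 c1] := c_range; have : c * (z * w)^-1 <= c * phi_slope z w by rewrite ler_pM2l.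
    by lra.
have k1 : hi ^-1 <= z^-1 by rewrite lef_pV2 ?posrE //; lra.
have k2 : hi^-1 * hi^-1 <= (z * w)^-1.
  by rewrite invfM; apply: ler_pM; rewrite ?invr_ge0 ?lef_pV2 ?posrE //; lra.
have hV : 0 < hi^-1 by rewrite invr_gt0.
have -> : dR mu c z - dR mu c w = (w - z) *
    (phiR mu z * (c * phi_slope z w + (1 - c) / (z * w)) + phitR mu c w * phi_slope z w).
  by rewrite !dRE -(subrK (phitR mu c w) (phitR mu c z)) qd
    -(subrK (phiR mu w) (phiR mu z)) pd; ring.
rewrite ler_wpM2l ?subr_ge0 //.
have -> : (hi ^+ 3)^-1 = hi^-1 * (hi^-1 * hi^-1) by field; rewrite gt_eqF.
set T := c * _ + _ in qg *.
have a1 : hi^-1 * (hi^-1 * hi^-1) <= phiR mu z * T.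
  by apply: ler_pM; rewrite ?mulr_ge0 ?(ltW hV) //; lra.
have wV : 0 < w^-1 by rewrite invr_gt0.
have zwV : 0 < (z * w)^-1 by rewrite invr_gt0 mulr_gt0.
suff : 0 <= phitR mu c w * phi_slope z w by lra.
by rewrite mulr_ge0 //; lra.
Qed.

Lemma dR_anti z w : b < z -> z < w -> dR mu c w < dR mu c z.
Proof.
move=> bz zw; have := dR_drop bz (_ : z <= w <= w); rewrite lexx ltW // => /(_ isT).
have w0 : 0 < w by apply: lt_trans zw; exact: edge_lt_gt0.
have : 0 < (w - z) / w ^+ 3 by rewrite divr_gt0 ?exprn_gt0 ?subr_gt0.
by lra.
Qed.

End Transforms.

(** * Derivatives of the transforms *)

Section Derivatives.
Local Open Scope ring_scope.
Variables (R : realType).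

(** Taylor's bound at first order determines the derivative; this replaces
    differentiation under the integral sign. *)
Lemma is_derive_quadratic (f : R -> R) z l C r : 0 < r ->
  (forall w, `|w - z| < r -> `|f w - f z - (w - z) * l| <= C * (w - z) ^+ 2) ->
  is_derive z 1 f l.
Proof.
move=> r0 fq; have C0 : 0 <= C.
  have E : z + r / 2 - z = r / 2 by ring.
  have hr : `|z + r / 2 - z| < r by rewrite E ger0_norm; lra.
  have := le_trans (normr_ge0 _) (fq _ hr); rewrite E.
  have r2 : 0 < (r / 2) ^+ 2 by rewrite exprn_gt0 // divr_gt0.
  by move=> h; rewrite -(pmulr_lge0 _ r2).
suff cv : (fun h : R => h^-1 *: (f (h *: 1 + z) - f z)) @ 0^' --> l.
  by split; [apply: cvgP cv | apply: cvg_lim cv].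
apply/cvgrPdist_le => /= e e0; near=> h.
have h0 : h != 0 by near: h; exact: nbhs_dnbhs_neq.
have hn : 0 < `|h| by rewrite normr_gt0.
have hr : `|h| < r by near: h; apply: dnbhs0_lt.
have he : `|h| < e / (C + 1) by near: h; apply: dnbhs0_lt; rewrite divr_gt0 //; lra.
rewrite /GRing.scale /= mulr1 distrC.
have := fq (h + z); rewrite addrK => /(_ hr) k.
have -> : h^-1 * (f (h + z) - f z) - l = h^-1 * (f (h + z) - f z - h * l) by field.
rewrite normrM normfV mulrC ler_pdivrMr // (le_trans k) //.
rewrite -(real_normK (num_real h)) expr2 mulrA ler_pM2r //.
move: he; rewrite ltr_pdivlMr; last by lra.
by move=> he; nra.
Unshelve. all: by end_near.
Qed.

Variables (mu : probability R R) (c : R).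
Hypothesis mu_ge0 : mu `[0, +oo[%classic = 1%E.
Hypothesis mu_cpt : compact (msupport mu).
Hypothesis c_range : 0 < c <= 1.
Local Notation b := (edge mu).
Local Notation D := `[0, b ^+ 2]%classic.
Local Notation I f := (Rintegral mu D f).

(** The difference of the two integrands is (w - z) times a function that is bounded
    on D uniformly for w near z, namely for w >= (z + b) / 2. *)
Lemma phi_slope_lip z w : b < z -> `|w - z| < (z - b) / 2 ->
  `|phi_slope mu z z - phi_slope mu w z| <=
    (2 * z ^+ 3 + 4 * z * b ^+ 2) *
    ((z ^+ 2 - b ^+ 2)^-1 * ((z ^+ 2 - b ^+ 2)^-1 * (((z + b) / 2) ^+ 2 - b ^+ 2)^-1))
    * `|w - z|.
Proof.
rewrite ltr_norml => bz /andP[wl wu].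
have b0 := edge_ge0 mu; have z0 := edge_lt_gt0 bz.
have ba : b < (z + b) / 2 by lra.
have aw : (z + b) / 2 <= w by lra.
have bw : b < w by lra.
have w0 := edge_lt_gt0 bw.
pose k x := (z ^+ 2 * w + x * (2 * z + w)) *
  ((z ^+ 2 - x)^-1 * ((z ^+ 2 - x)^-1 * (w ^+ 2 - x)^-1)).
have tk : tame mu k.
  apply: tameM => //; last by do 2 (apply: tameM; [exact: tame_gapV|]); exact: tame_gapV.
  apply: tameD; first exact: tame_cst.
  by apply: tameM; [exact: tame_id|exact: tame_cst].
have -> : phi_slope mu z z - phi_slope mu w z = (w - z) * I k.
  rewrite -I_Z //; apply/eqP; rewrite subr_eq /phi_slope -I_D //; last 2 first.
  - by apply: tameM; [exact: tame_cst|].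
  - apply: tameM; last by apply: tameM; exact: tame_gapV.
    by apply: tameD; [exact: tame_cst | exact: tame_id].
  apply/eqP/eq_Rintegral => x /set_mem Dx; rewrite /k.
  have /andP[z1 z2] := gap_gt0 bz Dx; have /andP[w1 w2] := gap_gt0 bw Dx.
  by field; apply/andP; split; lra.
rewrite normrM mulrC ler_wpM2r //.
have M : forall x, D x -> 0 <= k x <= (2 * z ^+ 3 + 4 * z * b ^+ 2) *
    ((z ^+ 2 - b ^+ 2)^-1 * ((z ^+ 2 - b ^+ 2)^-1 * (((z + b) / 2) ^+ 2 - b ^+ 2)^-1)).
  move=> x Dx; have /andP[z1 z2] := gap_gt0 bz Dx; have /andP[w1 w2] := gap_gt0 bw Dx.
  have /andP[a1 a2] := gap_gt0 ba Dx.
  have /andP[x0 xb] : 0 <= x <= b ^+ 2 by move: Dx; rewrite /= in_itv.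
  have aw2 : ((z + b) / 2) ^+ 2 <= w ^+ 2 by rewrite ler_pXn2r ?nnegrE //; lra.
  rewrite /k; apply/andP; split.
    by rewrite mulr_ge0 ?addr_ge0 ?mulr_ge0 ?invr_ge0 ?sqr_ge0 //; lra.
  have n1 : z ^+ 2 * w <= 2 * z ^+ 3.
    by rewrite (exprSr z 2) mulrCA ler_pM2l ?exprn_gt0 //; lra.
  have n2 : x * (2 * z + w) <= 4 * z * b ^+ 2.
    by rewrite mulrC; apply: ler_pM => //; lra.
  apply: ler_pM; rewrite ?addr_ge0 ?mulr_ge0 ?invr_ge0 ?sqr_ge0 //; try lra.
  apply: ler_pM; rewrite ?mulr_ge0 ?invr_ge0 ?lef_pV2 ?posrE //; try lra.
  by apply: ler_pM; rewrite ?invr_ge0 ?lef_pV2 ?posrE //; try lra.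
rewrite ger0_norm.
  rewrite -[leRHS](I_cst mu_ge0 mu_cpt); apply: I_le => //; first exact: tame_cst.
  by move=> x /M/andP[].
rewrite -[leLHS](I_cst mu_ge0 mu_cpt); apply: I_le => //; first exact: tame_cst.
by move=> x /M/andP[].
Qed.

Lemma phiR_derive z : b < z -> is_derive z 1 (phiR mu) (- phi_slope mu z z).
Proof.
move=> bz; have [C hC] : exists C, forall w, `|w - z| < (z - b) / 2 ->
    `|phi_slope mu z z - phi_slope mu w z| <= C * `|w - z|.
  by eexists => w; exact: phi_slope_lip.
apply: (@is_derive_quadratic _ _ _ C ((z - b) / 2)); first lra.
move=> w wz; have bw : b < w by move: wz; rewrite ltr_norml => /andP[]; lra.
rewrite phiR_diff // (_ : _ - _ = (w - z) * (phi_slope mu z z - phi_slope mu w z)); last by ring.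
rewrite normrM -(real_normK (num_real (w - z))) expr2 mulrA [leRHS]mulrC.
by rewrite ler_wpM2l // hC.
Qed.

Definition phit_slope z := c * phi_slope mu z z + (1 - c) / z ^+ 2.

Lemma phitR_derive z : b < z -> is_derive z 1 (phitR mu c) (- phit_slope z).
Proof.
move=> bz; have z0 : z != 0 by rewrite gt_eqF // (edge_lt_gt0 bz).
have -> : phitR mu c = c *: phiR mu + (1 - c) *: (fun x => x^-1).
  by apply/funext => x; rewrite phitRE.
have h1 := phiR_derive bz.
have h2 : is_derive z 1 (fun x : R => x^-1) (- z ^- 2).
  have := is_deriveV z0 (is_derive_id z 1).
  by rewrite /GRing.scale /= mulr1.
have h3 := is_deriveD (is_deriveZ c h1) (is_deriveZ (1 - c) h2).
apply: (is_derive_eq h3).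
by rewrite /phit_slope /GRing.scale /=; field.
Qed.

Lemma dR_derive z : b < z ->
  is_derive z 1 (dR mu c) (- (phi_slope mu z z * phitR mu c z + phit_slope z * phiR mu z)).
Proof.
move=> bz; have h1 := phiR_derive bz; have h2 := phitR_derive bz.
have -> : dR mu c = phiR mu * phitR mu c by apply/funext => x; rewrite dRE.
apply: is_derive_eq; rewrite /GRing.scale /=; ring.
Qed.
End Derivatives.

(** * Spike locations *)

Section Location.
Local Open Scope ring_scope.
Variables (R : realType) (mu : probability R R) (c : R).
Hypothesis mu_ge0 : mu `[0, +oo[%classic = 1%E.
Hypothesis mu_cpt : compact (msupport mu).
Hypothesis c_range : 0 < c <= 1.
Hypothesis edge_cond : edge_condition mu c.
Local Notation b := (edge mu).
Local Notation ths := (theta_star mu c).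

Lemma dR_continuous z : b < z -> {for z, continuous (dR mu c)}.
Proof.
move=> bz; have [h _] := dR_derive c mu_ge0 mu_cpt bz.
exact/differentiable_continuous/derivable1_diffP.
Qed.

Lemma dR_lt_edge z : b < z -> dR mu c z < d_edge mu c.
Proof.
move=> bz; have bm : b < (b + z) / 2 by lra.
have mz : (b + z) / 2 < z by lra.
apply: lt_le_trans (dR_anti mu_ge0 mu_cpt c_range bm mz) _.
apply: limr_ge; first exact: edge_cond.1.
near=> y; apply/ltW/dR_anti => //.
Unshelve. all: by end_near.
Qed.

Lemma theta_star_gt0 : 0 < ths.
Proof. by rewrite invr_gt0 sqrtr_gt0 edge_cond.2. Qed.

Lemma theta_starV2 : d_edge mu c = ths ^- 2.
Proof. by rewrite exprVn invrK sqr_sqrtr // ltW // edge_cond.2. Qed.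

Lemma dR_gt0 z : b < z -> 0 < dR mu c z.
Proof.
move=> bz; have z0 : 0 < z^-1 by rewrite invr_gt0 (edge_lt_gt0 bz).
rewrite dRE; have /andP[h1 _] := phiR_bounds mu_ge0 mu_cpt bz.
have /andP[h2 _] := phitR_bounds mu_ge0 mu_cpt c_range bz.
by rewrite mulr_gt0 //; lra.
Qed.

(** The intermediate value theorem: d exceeds theta^-2 near the edge because
    theta_star^-2 is its limit there, and far away both of its factors are at most
    z / (z^2 - b^2), hence at most 1 / theta. *)
Lemma rhoP th : ths < th -> b < rho mu c th /\ dR mu c (rho mu c th) = th ^- 2.
Proof.
move=> sth; rewrite /rho sth; have s0 := theta_star_gt0; have b0 := edge_ge0 mu.
have th0 : 0 < th by exact: lt_trans sth.
apply: (@xgetPex _ _ [set z | b < z /\ dR mu c z = th ^- 2]).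
have thd : th ^- 2 < d_edge mu c.
  by rewrite theta_starV2 ltf_pV2 ?posrE ?exprn_gt0 // ltr_pXn2r ?nnegrE // ltW.
have [z1 [bz1 dz1]] : exists z1, b < z1 /\ th ^- 2 < dR mu c z1.
  have F : \forall z \near b^'+, b < z /\ th ^- 2 < dR mu c z.
    near=> z; split => //; near: z.
    exact: (cvgr_gt _ edge_cond.1 _ thd).
  exact: (@filter_ex _ (b^'+) _ _ F).
(* far enough for z2 / (z2 ^+ 2 - b ^+ 2) <= th^-1 *)
pose z2 := 2 * th + 2 * b + z1.
have bz2 : b < z2 by rewrite /z2; lra.
have z12 : z1 <= z2 by rewrite /z2; lra.
have dz2 : dR mu c z2 <= th ^- 2.
  have /andP[p0 p1] := phiR_bounds mu_ge0 mu_cpt bz2.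
  have /andP[q0 q1] := phitR_bounds mu_ge0 mu_cpt c_range bz2.
  have z20 : 0 < z2 by rewrite /z2; lra.
  have zV : 0 < z2^-1 by rewrite invr_gt0.
  have g0 : 0 < z2 ^+ 2 - b ^+ 2.
    by rewrite subr_gt0 ltr_pXn2r ?nnegrE //; lra.
  have h : z2 / (z2 ^+ 2 - b ^+ 2) <= th^-1.
    rewrite ler_pdivrMr // ler_pdivlMl //.
    by rewrite /z2; nra.
  rewrite dRE expr2 invfM; apply: ler_pM; lra.
have [||z zJ <-] := @IVT R (dR mu c) z1 z2 (th ^- 2) z12.
- apply: continuous_in_subspaceT => z /set_mem; rewrite /= in_itv /= => /andP[z1z _].
  by apply: dR_continuous; lra.
- by rewrite ge_min dz2 orbT le_max (ltW dz1).
exists z; split => //; move: zJ; rewrite in_itv /= => /andP[h _]; lra.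
Unshelve. all: by end_near.
Qed.

(** The 2 x 2 block of a spike whose location is at distance delta from J is
    uniformly invertible on J.  Below theta_star, d(z) theta^2 is at most
    d(a1) theta_star^2 < 1.  Above, 1 = d(rho) theta^2 and [dR_drop] bounds
    |d(rho) - d(z)| below; the factor 1 + theta^2 makes the bound useful for small
    and for unbounded theta at the same time. *)
Lemma detuned (a1 a2 delta : R) : b < a1 <= a2 -> 0 < delta ->
  exists2 c0, 0 < c0 & forall th z, 0 < th -> a1 <= z <= a2 ->
    delta <= `|rho mu c th - a1| -> delta <= `|rho mu c th - a2| ->
    ~~ (a1 <= rho mu c th <= a2) ->
    c0 * (1 + th ^+ 2) <= `|1 - dR mu c z * th ^+ 2|.
Proof.
move=> /andP[ba1 a12] d0; have s0 := theta_star_gt0; have b0 := edge_ge0 mu.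
have [S SE] : exists S, S = ths ^+ 2 by eexists.
have S0 : 0 < S by rewrite SE exprn_gt0.
have S1 : 0 < 1 + S by rewrite addr_gt0.
pose q := dR mu c a1 * S.
have q1 : q < 1.
  by rewrite /q -ltr_pdivlMr // mul1r SE -theta_starV2 dR_lt_edge.
pose c1 := delta / (a2 + delta) ^+ 3.
have c10 : 0 < c1 by rewrite divr_gt0 // exprn_gt0 //; lra.
have anti z w : b < z -> z <= w -> dR mu c w <= dR mu c z.
  move=> bz; rewrite le_eqVlt => /predU1P[->//|zw].
  exact/ltW/dR_anti.
exists (Num.min ((1 - q) / (1 + S)) (c1 * S / (1 + S))).
  by rewrite lt_min; apply/andP; split;
    [apply: divr_gt0; [rewrite subr_gt0|] | apply: divr_gt0; [exact: mulr_gt0|]];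
    rewrite ?addr_gt0.
move=> th z th0 /andP[a1z za2] r1 r2 rJ.
have T0 : 0 < 1 + th ^+ 2 by have := sqr_ge0 th; lra.
have bz : b < z by lra.
have [sth|ths_le] := ltP ths th.
  have [br dr] := rhoP sth; set r := rho _ _ _ in r1 r2 rJ br dr.
  have ST : S <= th ^+ 2 by rewrite SE ler_pXn2r ?nnegrE ?ltW.
  apply: (@le_trans _ _ (c1 * S / (1 + S) * (1 + th ^+ 2))).
    by rewrite ler_pM2r // ge_min lexx orbT.
  apply: (@le_trans _ _ (c1 * th ^+ 2)).
    rewrite (_ : c1 * S / _ * _ = c1 * (S * (1 + th ^+ 2) / (1 + S))); last by ring.
    by rewrite ler_pM2l // ler_pdivrMr //; nra.
  have -> : 1 - dR mu c z * th ^+ 2 = (dR mu c r - dR mu c z) * th ^+ 2.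
    by rewrite dr; field; rewrite gt_eqF.
  rewrite normrM (ger0_norm (sqr_ge0 _)) ler_pM2r ?exprn_gt0 //.
  move: rJ; rewrite negb_and -!ltNge => /orP[ra1|a2r].
    have rd : delta <= a1 - r by move: r1; rewrite distrC ger0_norm //; lra.
    apply: le_trans (ler_norm _); have := dR_drop mu_ge0 mu_cpt c_range br (_ : r <= z <= a2 + delta).
    move=> /(_ ltac:(apply/andP; split; lra)); apply: le_trans.
    have p0 : 0 < a2 + delta by lra.
    by rewrite /c1 ler_pM2r ?invr_gt0 ?exprn_gt0 //; lra.
  have rd : delta <= r - a2 by move: r2; rewrite ger0_norm //; lra.
  rewrite distrC; apply: le_trans (ler_norm _).
  have ba2 : b < a2 by lra.
  have bad : b < a2 + delta by lra.
  have := dR_drop mu_ge0 mu_cpt c_range ba2 (_ : a2 <= a2 + delta <= a2 + delta).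
  move=> /(_ ltac:(apply/andP; split; lra)).
  rewrite addrAC subrr add0r -/c1 => h.
  have adr : a2 + delta <= r by lra.
  apply: (le_trans h); apply: lerB; [exact: anti|exact: anti].
have TS : th ^+ 2 <= S by rewrite SE ler_pXn2r ?nnegrE //; exact: ltW.
apply: (@le_trans _ _ ((1 - q) / (1 + S) * (1 + th ^+ 2))).
  by rewrite ler_pM2r // ge_min lexx.
apply: (@le_trans _ _ (1 - q)).
  rewrite (_ : (1 - q) / _ * _ = (1 - q) * (1 + th ^+ 2) / (1 + S)); last by ring.
  by rewrite ler_pdivrMr // ler_pM2l ?subr_gt0 // lerD2l.
apply: le_trans (ler_norm _); rewrite lerD2l lerN2 /q.
have := anti a1 z ba1 a1z; have := dR_gt0 bz; have := sqr_ge0 th.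
by move=> h1 h2 h3; apply: ler_pM => //; lra.
Qed.

End Location.

(** * The limit of the spike coordinates *)

Section ScalarLimit.
Local Open Scope ring_scope.
Variable R : realType.
Local Notation C := R[i].
Local Notation normc := (@Normc.normc R).

(** What remains of two singular pairs once everything but the spike is eliminated:
    the error of the local law, the strength of the spike, and for each pair its
    singular value and its coordinates along the left and right spike directions;
    [rp_inner] is the inner product of the two linearized singular vectors. *)
Record reduced_pair := ReducedPair {
  rp_eta : R; rp_theta : R; rp_s1 : R; rp_s2 : R;
  rp_a1 : C; rp_b1 : C; rp_a2 : C; rp_b2 : C; rp_inner : C }.

Variables (f g : R -> R) (rho th lo hi Y Fb gap kap A A' : R).
Local Notation d := (fun z => f z * g z).

(** The two equations of the spike block up to the error, and a lower bound that
    expresses that the spike directions carry the mass of the vector. *)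
Definition spike_relation e t s (a b : C) :=
  [/\ lo <= s <= hi, normc a <= 1, normc b <= 1 &
    [/\ normc (a - (f s * t)%:C * b) <= Y * e,
      normc (b - (g s * t)%:C * a) <= Y * e &
      gap - Y * e <= t ^+ 2 * (normc a ^+ 2 + normc b ^+ 2)]].

(** The last clause is the resolvent identity with step h = sqrt eta. *)
Definition reduced_ok (o : reduced_pair) := [/\ 0 < rp_eta o < 1, 0 < rp_theta o,
  spike_relation (rp_eta o) (rp_theta o) (rp_s1 o) (rp_a1 o) (rp_b1 o),
  spike_relation (rp_eta o) (rp_theta o) (rp_s2 o) (rp_a2 o) (rp_b2 o) &
  let h := Num.sqrt (rp_eta o) in
  normc (rp_inner o - (((f rho - f (rho + h)) / h * rp_theta o ^+ 2)%:C * ((rp_b1 o)^* * rp_b2 o) +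
                 ((g rho - g (rho + h)) / h * rp_theta o ^+ 2)%:C * ((rp_a1 o)^* * rp_a2 o)))
   <= Y * (`|rp_s1 o - rho| + `|rp_s2 o - rho| + h + rp_eta o)].

Hypotheses (Y0 : 0 < Y) (gap0 : 0 < gap) (kap0 : 0 < kap).
Hypothesis fb : forall z, lo <= z <= hi -> 0 <= f z <= Fb.
Hypothesis gb : forall z, lo <= z <= hi -> 0 <= g z <= Fb.
Hypothesis d_lip : forall z, lo <= z <= hi -> kap * `|z - rho| <= `|d z - d rho|.
Hypothesis d_rho : d rho * th ^+ 2 = 1.
Hypothesis f_derive : is_derive rho 1 f (- A).
Hypothesis g_derive : is_derive rho 1 g (- A').

(** Convergence along this filter is convergence uniform over all matrices, whatever
    their dimensions, as the error and the deviation of the strength tend to 0. *)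
Definition spike_filter : set_system reduced_pair :=
  filter_from [set e : R | 0 < e]
    (fun e => [set o | [/\ reduced_ok o, rp_eta o < e & `|rp_theta o - th| < e]]).

Local Notation F := spike_filter.

Global Instance spike_filter_filter : Filter F.
Proof.
apply: filter_from_filter; first by exists 1 => /=.
move=> i j /= i0 j0; exists (Num.min i j); first by rewrite /= lt_min i0.
by move=> o [ok]; rewrite !lt_min => /andP[? ?] /andP[? ?]; split.
Qed.

Lemma near_ok : \forall o \near F, reduced_ok o.
Proof. by exists 1 => //= o []. Qed.

Lemma cvg_rp_eta : rp_eta @ F --> (0 : R).
Proof.
apply/cvgrPdist_lt => e e0; exists e => //= o [[/andP[h _] _ _ _ _] he _].
by rewrite sub0r normrN gtr0_norm.
Qed.

Lemma cvg_rp_theta : rp_theta @ F --> th.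
Proof. by apply/cvgrPdist_lt => e e0; exists e => //= o [_ _ h]; rewrite distrC. Qed.

Lemma cvg_sqrt_eta : (fun o => Num.sqrt (rp_eta o)) @ F --> (0 : R).
Proof.
rewrite -[X in _ --> X](sqrtr0 R).
exact: (continuous_cvg _ (@sqrt_continuous R 0) cvg_rp_eta).
Qed.

(** Eliminating b from the two equations leaves (1 - d(s) t^2) a = O(eta), and the
    same for b.  As a and b are not both small, d(s) t^2 tends to 1, and
    |d(s) - d(rho)| controls |s - rho|. *)
Lemma spike_location s (a b : reduced_pair -> C) :
  (forall o, reduced_ok o -> spike_relation (rp_eta o) (rp_theta o) (s o) (a o) (b o)) ->
  s @ F --> rho.
Proof.
move=> sp.
pose err o := (2 / kap / gap) * (2 * Y * rp_eta o * (1 + Fb * rp_theta o)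
  + 2 * `|1 - d rho * rp_theta o ^+ 2|).
have err0 : err @ F --> (0 : R).
  rewrite (_ : 0 = (2 / kap / gap) * (2 * Y * 0 * (1 + Fb * th) + 2 * `|1 - d rho * th ^+ 2|)); last first.
    by rewrite d_rho subrr normr0 !mulr0 mul0r addr0 mulr0.
  apply: cvgMl_tmp; apply: cvgD.
    apply: cvgM; first by apply: cvgMl_tmp; exact: cvg_rp_eta.
    by apply: cvgD; [exact: cvg_cst | apply: cvgMl_tmp; exact: cvg_rp_theta].
  apply: cvgMl_tmp; apply: cvg_norm; apply: cvgB; first exact: cvg_cst.
  by apply: cvgMl_tmp; rewrite expr2; under eq_fun do rewrite expr2; apply: cvgM; exact: cvg_rp_theta.
apply/cvgrPdist_le => e e0.
have small : \forall o \near F, rp_eta o < gap / (2 * Y).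
  apply: (cvgr_lt _ cvg_rp_eta); rewrite divr_gt0 ?mulr_gt0 //.
near=> o.
have ok : reduced_ok o by near: o; exact: near_ok.
have eo : rp_eta o < gap / (2 * Y) by near: o.
have ee : err o <= e.
  near: o; exact: (cvgr_le _ err0 e e0).
rewrite distrC (le_trans _ ee) //.
have [/andP[eta0 _] t0 _ _ _] := ok.
have [sJ a1 b1 [ra rb lb]] := sp o ok.
have /andP[f0 f1] := fb sJ; have /andP[g0 g1] := gb sJ.
have dl := d_lip sJ.
have gY : Y * rp_eta o <= gap / 2.
  by move: eo; rewrite ltr_pdivlMr ?mulr_gt0 //; lra.
have ea : normc (a o) * `|1 - d (s o) * rp_theta o ^+ 2| <= Y * rp_eta o * (1 + Fb * rp_theta o).
  rewrite -normc_real -Normc.normcM.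
  have -> : a o * (1 - d (s o) * rp_theta o ^+ 2)%:C = (a o - (f (s o) * rp_theta o)%:C * b o)
      + (f (s o) * rp_theta o)%:C * (b o - (g (s o) * rp_theta o)%:C * a o).
    by rewrite !(rmorphB, rmorphM, rmorphXn, rmorph1) /=; ring.
  rewrite (le_trans (normcD _ _)) // [leRHS]mulrDr mulr1 lerD //.
  rewrite Normc.normcM normc_real ger0_norm ?mulr_ge0 ?(ltW t0) // mulrC.
  by apply: ler_pM => //; [exact: normc_ge0 | rewrite mulr_ge0 // ltW | rewrite ler_wpM2r // ltW].
have eb : normc (b o) * `|1 - d (s o) * rp_theta o ^+ 2| <= Y * rp_eta o * (1 + Fb * rp_theta o).
  rewrite -normc_real -Normc.normcM.
  have -> : b o * (1 - d (s o) * rp_theta o ^+ 2)%:C = (b o - (g (s o) * rp_theta o)%:C * a o)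
      + (g (s o) * rp_theta o)%:C * (a o - (f (s o) * rp_theta o)%:C * b o).
    by rewrite !(rmorphB, rmorphM, rmorphXn, rmorph1) /=; ring.
  rewrite (le_trans (normcD _ _)) // [leRHS]mulrDr mulr1 lerD //.
  rewrite Normc.normcM normc_real ger0_norm ?mulr_ge0 ?(ltW t0) // mulrC.
  by apply: ler_pM => //; [exact: normc_ge0 | rewrite mulr_ge0 // ltW | rewrite ler_wpM2r // ltW].
have n1 := normc_ge0 (a o); have n2 := normc_ge0 (b o).
set N := normc (a o) + normc (b o).
have N2 : 0 <= N <= 2 by apply/andP; rewrite /N; split; lra.
have NN : normc (a o) ^+ 2 + normc (b o) ^+ 2 <= N.
  by rewrite /N !expr2 lerD // ler_piMl.
have tN : gap / 2 <= rp_theta o ^+ 2 * N.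
  have : rp_theta o ^+ 2 * (normc (a o) ^+ 2 + normc (b o) ^+ 2) <= rp_theta o ^+ 2 * N.
    by rewrite ler_pM2l ?exprn_gt0.
  by lra.
have key : kap * `|s o - rho| * rp_theta o ^+ 2 <=
    `|1 - d (s o) * rp_theta o ^+ 2| + `|1 - d rho * rp_theta o ^+ 2|.
  apply: (@le_trans _ _ (`|d (s o) - d rho| * rp_theta o ^+ 2)).
    by rewrite ler_pM2r ?exprn_gt0.
  rewrite -[rp_theta o ^+ 2 in leLHS]ger0_norm ?sqr_ge0 // -normrM.
  rewrite (_ : (_ - _) * _ = (1 - d rho * rp_theta o ^+ 2) - (1 - d (s o) * rp_theta o ^+ 2)); last by ring.
  by rewrite [leRHS]addrC; exact: ler_normB.
have kN : (kap * `|s o - rho|) * (gap / 2) <=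
    2 * Y * rp_eta o * (1 + Fb * rp_theta o) + 2 * `|1 - d rho * rp_theta o ^+ 2|.
  apply: (@le_trans _ _ (kap * `|s o - rho| * (rp_theta o ^+ 2 * N))).
    by rewrite ler_wpM2l // mulr_ge0 // ltW.
  rewrite mulrA; apply: (@le_trans _ _ ((`|1 - d (s o) * rp_theta o ^+ 2| + `|1 - d rho * rp_theta o ^+ 2|) * N)).
    by case/andP: N2 => N0 _; rewrite ler_wpM2r.
  rewrite mulrDl lerD //.
    by rewrite /N mulrDr ![`|_| * _]mulrC; lra.
  by case/andP: N2 => _ N2; rewrite mulrC ler_wpM2r.
rewrite /err (_ : `|_| = (2 / kap / gap) * (kap * `|s o - rho| * (gap / 2))).
  by rewrite ler_wpM2l // !divr_ge0 // ltW.
by field; rewrite !gt_eqF.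
Unshelve. all: by end_near.
Qed.

(** The step sqrt eta is positive, so it tends to 0 without meeting 0. *)
Lemma quotient_cvg (u : R -> R) (l : R) : is_derive rho 1 u (- l) ->
  (fun o => (u rho - u (rho + Num.sqrt (rp_eta o))) / Num.sqrt (rp_eta o)) @ F --> l.
Proof.
move=> [du ul]; rewrite -(opprK l) -ul.
have hF : (fun o => Num.sqrt (rp_eta o)) @ F --> (0 : R)^'.
  move=> S hS; have hS' := cvg_sqrt_eta hS.
  change (\forall o \near F, S (Num.sqrt (rp_eta o))).
  near=> o; have [/andP[e0 _] _ _ _ _] : reduced_ok o by near: o; exact: near_ok.
  have : Num.sqrt (rp_eta o) != 0 -> S (Num.sqrt (rp_eta o)) by near: o; exact: hS'.
  by apply; rewrite gt_eqF // sqrtr_gt0.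
pose q o := (Num.sqrt (rp_eta o))^-1 *: (u (Num.sqrt (rp_eta o) *: 1 + rho) - u rho).
have h : q @ F --> 'D_1 u rho by exact: (cvg_comp _ _ hF du).
suff -> : (fun o => (u rho - u (rho + Num.sqrt (rp_eta o))) / Num.sqrt (rp_eta o)) = - q.
  exact: cvgN h.
by apply/funext => o; rewrite fctE /q /GRing.scale /= mulr1 [rho + _]addrC; ring.
Unshelve. all: by end_near.
Qed.

Local Notation D0 := (A * th ^+ 2 + A' * th ^+ 4 * f rho ^+ 2).

Lemma cvg_expn (q : reduced_pair -> R) (l : R) n : q @ F --> l -> (fun o => q o ^+ n) @ F --> l ^+ n.
Proof. by move=> h; apply: (continuous_cvg _ (@exprn_continuous R n l) h). Qed.

Lemma continuous_rho (u : R -> R) l : is_derive rho 1 u l -> {for rho, continuous u}.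
Proof. by move=> [h _]; exact/differentiable_continuous/derivable1_diffP. Qed.

Lemma s1_cvg : rp_s1 @ F --> rho.
Proof. by apply: (@spike_location rp_s1 rp_a1 rp_b1) => o []. Qed.

Lemma s2_cvg : rp_s2 @ F --> rho.
Proof. by apply: (@spike_location rp_s2 rp_a2 rp_b2) => o []. Qed.

(** Replace a by f(s) t b in the two-pair identity, then pass to the limit in the
    coefficients. *)
Lemma inner_cvg :
  (fun o => normc (rp_inner o - (rp_b1 o)^* * rp_b2 o * D0%:C)) @ F --> (0 : R).
Proof.
pose h o := Num.sqrt (rp_eta o).
pose q1 o := (f rho - f (rho + h o)) / h o.
pose q2 o := (g rho - g (rho + h o)) / h o.
pose bound o := Y * (`|rp_s1 o - rho| + `|rp_s2 o - rho| + h o + rp_eta o) +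
  `|q1 o * rp_theta o ^+ 2 + q2 o * rp_theta o ^+ 4 * (f (rp_s1 o) * f (rp_s2 o)) - D0| +
  `|q2 o * rp_theta o ^+ 2| * (Y * rp_eta o * (1 + Fb * rp_theta o)).
have q1A : q1 @ F --> A by exact: quotient_cvg f_derive.
have q2A : q2 @ F --> A' by exact: quotient_cvg g_derive.
have tc := cvg_rp_theta; have ec := cvg_rp_eta; have hc : h @ F --> (0 : R) := cvg_sqrt_eta.
have c1 := s1_cvg; have c2 := s2_cvg.
have fc := continuous_rho f_derive.
have f1 : (fun o => f (rp_s1 o)) @ F --> f rho by exact: (continuous_cvg _ fc c1).
have f2 : (fun o => f (rp_s2 o)) @ F --> f rho by exact: (continuous_cvg _ fc c2).
have b0 : bound @ F --> (0 : R).
  have -> : 0 = Y * (`|rho - rho| + `|rho - rho| + 0 + 0) +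
    `|A * th ^+ 2 + A' * th ^+ 4 * (f rho * f rho) - D0| +
    `|A' * th ^+ 2| * (Y * 0 * (1 + Fb * th)).
    by rewrite expr2 !subrr normr0; ring.
  apply: cvgD; first apply: cvgD.
  - apply: cvgMl_tmp; apply: cvgD => //; apply: cvgD => //.
    by apply: cvgD; apply: cvg_norm; apply: cvgB => //; exact: cvg_cst.
  - apply: cvg_norm; apply: cvgB; last exact: cvg_cst.
    apply: cvgD; first by apply: cvgM => //; exact: cvg_expn.
    by apply: cvgM; [apply: cvgM => //; exact: cvg_expn | exact: (cvgM f1 f2)].
  - apply: cvgM; first by apply: cvg_norm; apply: cvgM => //; exact: cvg_expn.
    apply: cvgM; first exact: cvgMl_tmp.
    by apply: cvgD; [exact: cvg_cst|exact: cvgMl_tmp].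
apply: (squeeze_cvgr _ (cvg_cst 0) b0); near=> o; rewrite normc_ge0 /=.
have ok : reduced_ok o by near: o; exact: near_ok.
have [/andP[e0 _] t0 [s1J a1 b1 [ra1 rb1 _]] [s2J a2 b2 [ra2 rb2 _]] ipb] := ok.
have /andP[f10 f1b] := fb s1J; have /andP[f20 f2b] := fb s2J.
have -> : rp_inner o - (rp_b1 o)^* * rp_b2 o * D0%:C =
  (rp_inner o - ((q1 o * rp_theta o ^+ 2)%:C * ((rp_b1 o)^* * rp_b2 o) +
           (q2 o * rp_theta o ^+ 2)%:C * ((rp_a1 o)^* * rp_a2 o)))
  + (rp_b1 o)^* * rp_b2 o * (q1 o * rp_theta o ^+ 2 + q2 o * rp_theta o ^+ 4 * (f (rp_s1 o) * f (rp_s2 o)) - D0)%:C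
  + (q2 o * rp_theta o ^+ 2)%:C * ((rp_a1 o - (f (rp_s1 o) * rp_theta o)%:C * rp_b1 o)^* * rp_a2 o
      + (f (rp_s1 o) * rp_theta o)%:C * (rp_b1 o)^* * (rp_a2 o - (f (rp_s2 o) * rp_theta o)%:C * rp_b2 o)).
  have -> : (rp_a1 o - (f (rp_s1 o) * rp_theta o)%:C * rp_b1 o)^* =
      (rp_a1 o)^* - (f (rp_s1 o) * rp_theta o)%:C * (rp_b1 o)^*.
    by rewrite conjD conjN conjM conj_real.
  by rewrite !(rmorphB, rmorphD, rmorphM, rmorphXn) /=; ring.
rewrite /bound (le_trans (normcD _ _)) //; apply: lerD.
  rewrite (le_trans (normcD _ _)) //; apply: lerD => //.
  rewrite Normc.normcM normc_real ler_piMl // Normc.normcM normc_conj.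
  by rewrite -[leRHS]mulr1; apply: ler_pM; rewrite ?normc_ge0.
rewrite Normc.normcM normc_real ler_wpM2l //.
rewrite (le_trans (normcD _ _)) // [leRHS]mulrDr mulr1 lerD //.
  rewrite Normc.normcM normc_conj -[leRHS]mulr1.
  by apply: ler_pM; rewrite ?normc_ge0.
rewrite !Normc.normcM normc_conj normc_real ger0_norm ?mulr_ge0 ?(ltW t0) //.
rewrite mulrC; apply: ler_pM => //; rewrite ?mulr_ge0 ?normc_ge0 ?(ltW t0) //.
rewrite -[leRHS]mulr1; apply: ler_pM => //; rewrite ?mulr_ge0 ?normc_ge0 ?(ltW t0) //.
by rewrite ler_pM2r.
Unshelve. all: by end_near.
Qed.

Hypothesis D0_gt0 : 0 < D0.

(** A singular pair compared with itself: x = (u, v) with u and v of norm 1 has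
    squared norm 2. *)
Definition same_pair : set reduced_pair :=
  [set o | [/\ rp_a2 o = rp_a1 o, rp_b2 o = rp_b1 o & rp_inner o = 2]].

Local Notation F1 := (within same_pair F).

Lemma cvg_within_same (q : reduced_pair -> R) (l : R) : q @ F --> l -> q @ F1 --> l.
Proof. by move=> h S /h; apply: (@filterS _ F) => o qo _. Qed.

Lemma near_same : \forall o \near F1, reduced_ok o /\ same_pair o.
Proof.
rewrite near_withinE; near=> o => so; split => //; near: o; exact: near_ok.
Unshelve. all: by end_near.
Qed.

Lemma right_cvg : (fun o => normc (rp_b1 o) ^+ 2) @ F1 --> 2 / D0.
Proof.
have h := cvg_within_same inner_cvg.
have h0 : (fun o => D0^-1 * normc (rp_inner o - (rp_b1 o)^* * rp_b2 o * D0%:C)) @ F1 --> (0 : R).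
  by rewrite -(mulr0 D0^-1); apply: cvgMl_tmp.
apply/cvgrPdist_le => e e0; near=> o.
have [_ [_ b2 i2]] : reduced_ok o /\ same_pair o by near: o; exact: near_same.
apply: (@le_trans _ _ (D0^-1 * normc (rp_inner o - (rp_b1 o)^* * rp_b2 o * D0%:C))); last first.
  by near: o; exact: (cvgr_le _ h0 e e0).
rewrite i2 b2 mulc_conj.
have -> : 2 - (normc (rp_b1 o) ^+ 2)%:C * D0%:C = (2 - normc (rp_b1 o) ^+ 2 * D0)%:C.
  by rewrite [RHS]rmorphB /= [X in _ = _ - X]rmorphM /= rmorph_nat.
rewrite (_ : 2 / D0 - _ = D0^-1 * (2 - normc (rp_b1 o) ^+ 2 * D0)).
  by rewrite normrM ger0_norm ?invr_ge0 ?(ltW D0_gt0) // normc_real.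
by field; rewrite gt_eqF.
Unshelve. all: by end_near.
Qed.

Lemma eta_tk_cvg (u : reduced_pair -> R) :
  (forall o, reduced_ok o -> 0 <= u o <= Y * rp_eta o * (1 + Fb * rp_theta o)) -> u @ F1 --> (0 : R).
Proof.
move=> hu; apply: cvg_within_same.
have b0 : (fun o => Y * rp_eta o * (1 + Fb * rp_theta o)) @ F --> (0 : R).
  have -> : 0 = Y * 0 * (1 + Fb * th) by rewrite mulr0 mul0r.
  apply: cvgM; first by apply: cvgMl_tmp; exact: cvg_rp_eta.
  by apply: cvgD; [exact: cvg_cst|apply: cvgMl_tmp; exact: cvg_rp_theta].
apply: (squeeze_cvgr _ (cvg_cst 0) b0); near=> o; apply: hu.
by near: o; exact: near_ok.
Unshelve. all: by end_near.
Qed.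

Let slope_cvg n : (fun o => (f (rp_s1 o) * rp_theta o) ^+ n * normc (rp_b1 o) ^+ 2) @ F1 -->
  (f rho * th) ^+ n * (2 / D0).
Proof.
have h : (fun o => (f (rp_s1 o) * rp_theta o) ^+ n) @ F --> (f rho * th) ^+ n.
  apply: cvg_expn; apply: cvgM; last exact: cvg_rp_theta.
  exact: (continuous_cvg _ (continuous_rho f_derive) s1_cvg).
exact: (cvgM (cvg_within_same h) right_cvg).
Qed.

Lemma left_cvg : (fun o => normc (rp_a1 o) ^+ 2) @ F1 --> (f rho * th) ^+ 2 * (2 / D0).
Proof.
have sc := @slope_cvg 2.
have k0 : (fun o => `|normc (rp_a1 o) ^+ 2 - (f (rp_s1 o) * rp_theta o) ^+ 2 * normc (rp_b1 o) ^+ 2|) @ F1 --> (0 : R).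
  apply: eta_tk_cvg => o [/andP[e0 _] t0 [sJ a1 b1 [ra _ _]] _ _]; rewrite normr_ge0 /=.
  have /andP[f0 fB] := fb sJ.
  have ft0 : 0 <= f (rp_s1 o) * rp_theta o by rewrite mulr_ge0 // ltW.
  rewrite -exprMn subr_sqr normrM; apply: ler_pM => //.
    apply: le_trans ra; rewrite ler_norml; apply/andP; split.
      have := normcB (rp_a1 o) (rp_a1 o - (f (rp_s1 o) * rp_theta o)%:C * rp_b1 o).
      rewrite opprB addrC subrK Normc.normcM normc_real ger0_norm //; lra.
    have := normcD (rp_a1 o - (f (rp_s1 o) * rp_theta o)%:C * rp_b1 o) ((f (rp_s1 o) * rp_theta o)%:C * rp_b1 o).
    by rewrite subrK Normc.normcM normc_real ger0_norm //; lra.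
  rewrite ger0_norm ?addr_ge0 ?mulr_ge0 ?normc_ge0 ?(ltW t0) // lerD //.
  by rewrite -[leRHS]mulr1; apply: ler_pM; rewrite ?normc_ge0 // ler_pM2r.
apply/cvgrPdist_le => e e0; have e2 : 0 < e / 2 by lra.
near=> o.
have h1 : `|(f rho * th) ^+ 2 * (2 / D0) - (f (rp_s1 o) * rp_theta o) ^+ 2 * normc (rp_b1 o) ^+ 2| <= e / 2.
  by near: o; move/cvgrPdist_le: sc; apply.
have h2 : `|normc (rp_a1 o) ^+ 2 - (f (rp_s1 o) * rp_theta o) ^+ 2 * normc (rp_b1 o) ^+ 2| <= e / 2.
  by near: o; exact: (cvgr_le _ k0 _ e2).
by move: h1 h2; rewrite !ler_norml => /andP[? ?] /andP[? ?]; apply/andP; split; lra.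
Unshelve. all: by end_near.
Qed.

Lemma mixed_cvg :
  (fun o => normc (rp_a1 o * (rp_b1 o)^* - (f rho * th * (2 / D0))%:C)) @ F1 --> (0 : R).
Proof.
have sc := @slope_cvg 1.
have k0 : (fun o => normc (rp_a1 o - (f (rp_s1 o) * rp_theta o)%:C * rp_b1 o)) @ F1 --> (0 : R).
  apply: eta_tk_cvg => o [/andP[e0 _] t0 [sJ a1 b1 [ra _ _]] _ _]; rewrite normc_ge0 /=.
  have /andP[f0 fB] := fb sJ; have B0 := le_trans f0 fB.
  rewrite (le_trans ra) // -[leLHS]mulr1 ler_wpM2l ?mulr_ge0 ?(ltW Y0) ?(ltW e0) //.
  by rewrite lerDl mulr_ge0 // ltW.
have b0 : (fun o => normc (rp_a1 o - (f (rp_s1 o) * rp_theta o)%:C * rp_b1 o)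
    + `|(f (rp_s1 o) * rp_theta o) ^+ 1 * normc (rp_b1 o) ^+ 2 - (f rho * th) ^+ 1 * (2 / D0)|) @ F1 --> (0 : R).
  have -> : 0 = 0 + `|(f rho * th) ^+ 1 * (2 / D0) - (f rho * th) ^+ 1 * (2 / D0)|.
    by rewrite subrr normr0 addr0.
  by apply: cvgD => //; apply: cvg_norm; apply: cvgB => //; exact: cvg_cst.
apply: (squeeze_cvgr _ (cvg_cst 0) b0); near=> o; rewrite normc_ge0 /=.
have [ok _] : reduced_ok o /\ same_pair o by near: o; exact: near_same.
have [_ _ [_ _ b1 _] _ _] := ok.
have -> : rp_a1 o * (rp_b1 o)^* - (f rho * th * (2 / D0))%:C =
   (rp_a1 o - (f (rp_s1 o) * rp_theta o)%:C * rp_b1 o) * (rp_b1 o)^* +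
   ((f (rp_s1 o) * rp_theta o) ^+ 1 * normc (rp_b1 o) ^+ 2 - (f rho * th) ^+ 1 * (2 / D0))%:C.
  rewrite [X in _ = _ + X]rmorphB /= [X in _ = _ + (X - _)]rmorphM /= !expr1.
  by rewrite -mulc_conj; ring.
rewrite (le_trans (normcD _ _)) // normc_real lerD2r Normc.normcM normc_conj.
by rewrite ler_piMr ?normc_ge0.
Unshelve. all: by end_near.
Qed.

(** The form in which the limits apply to a given pair of matrices. *)
Lemma reduced_limits e : 0 < e -> exists2 d, 0 < d & forall o, reduced_ok o ->
  rp_eta o < d -> `|rp_theta o - th| < d ->
  normc (rp_inner o - (rp_b1 o)^* * rp_b2 o * D0%:C) < e /\
  (same_pair o ->
   [/\ `|normc (rp_b1 o) ^+ 2 - 2 / D0| < e,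
       `|normc (rp_a1 o) ^+ 2 - (f rho * th) ^+ 2 * (2 / D0)| < e &
       normc (rp_a1 o * (rp_b1 o)^* - (f rho * th * (2 / D0))%:C) < e]).
Proof.
move=> e0.
have n1 := cvgr_lt _ inner_cvg e e0.
have := right_cvg; move/cvgrPdist_lt => /(_ _ e0); rewrite near_withinE => n2.
have := left_cvg; move/cvgrPdist_lt => /(_ _ e0); rewrite near_withinE => n3.
have := cvgr_lt _ mixed_cvg e e0; rewrite near_withinE => n4.
have [d d0 H] : \forall o \near F,
  normc (rp_inner o - (rp_b1 o)^* * rp_b2 o * D0%:C) < e /\
  (same_pair o ->
   [/\ `|normc (rp_b1 o) ^+ 2 - 2 / D0| < e,
       `|normc (rp_a1 o) ^+ 2 - (f rho * th) ^+ 2 * (2 / D0)| < e &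
       normc (rp_a1 o * (rp_b1 o)^* - (f rho * th * (2 / D0))%:C) < e]).
  near=> o.
  have m1 : normc (rp_inner o - (rp_b1 o)^* * rp_b2 o * D0%:C) < e by near: o; exact: n1.
  have m2 : same_pair o -> `|2 / D0 - normc (rp_b1 o) ^+ 2| < e by near: o; exact: n2.
  have m3 : same_pair o -> `|(f rho * th) ^+ 2 * (2 / D0) - normc (rp_a1 o) ^+ 2| < e.
    by near: o; exact: n3.
  have m4 : same_pair o -> normc (rp_a1 o * (rp_b1 o)^* - (f rho * th * (2 / D0))%:C) < e.
    by near: o; exact: n4.
  split=> // so; split; last exact: m4.
    by rewrite distrC; exact: m2.
  by rewrite distrC; exact: m3.
by exists d => // o ok h1 h2; exact: H.
Unshelve. all: by end_near.
Qed.

End ScalarLimit.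

(** * Inverting the block of one spike *)

Section SpikeBlock.
Local Open Scope ring_scope.
Variable R : realType.
Local Notation C := R[i].
Local Notation normc := (@Normc.normc R).

(** Removing the spike coordinate turns bounds on the other coordinates into a bound
    on a vector. *)
Definition erase r (k : 'I_r) (p : 'cV[C]_r) : 'cV[C]_r :=
  \col_l (if l == k then 0 else p l 0).

Lemma inner_erase r (k : 'I_r) (p q : 'cV[C]_r) :
  inner p q = (p k 0)^* * q k 0 + inner (erase k p) (erase k q).
Proof.
rewrite !innerE (bigD1 k) //=; congr (_ + _).
rewrite [RHS](bigD1 k) //= !mxE eqxx mulr0 add0r.
by apply: eq_bigr => l /negbTE lk; rewrite !mxE lk.
Qed.

Lemma enorm_erase r (k : 'I_r) (p : 'cV[C]_r) :
  enorm p ^+ 2 = normc (p k 0) ^+ 2 + enorm (erase k p) ^+ 2.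
Proof.
apply: (@complexI R); rewrite -inner_enorm (inner_erase k) inner_enorm mulc_conj.
by rewrite [RHS]rmorphD.
Qed.

(** Elimination gives a (1 - f g t^2) = d1 + f t d2.  Comparing with c0 (1 + t^2)
    bounds a, and also t a because t and t^2 are at most 1 + t^2; hence the constant
    is the same for weak and for strong spikes. *)
Lemma block_inverse (t f g Fb c0 : R) (a b d1 d2 : C) : 0 < t -> 0 <= f <= Fb ->
  0 <= g <= Fb -> 0 < c0 -> c0 * (1 + t ^+ 2) <= `|1 - f * g * t ^+ 2| ->
  a - f%:C * (t%:C * b) = d1 -> b - g%:C * (t%:C * a) = d2 ->
  normc a <= (1 + Fb) / c0 * (normc d1 + normc d2) /\
  normc (t%:C * a) <= (1 + Fb) / c0 * (normc d1 + normc d2).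
Proof.
move=> t0 /andP[f0 fF] /andP[g0 gF] c00 hc e1 e2.
have F0 : 0 <= Fb by lra.
have ea : a * (1 - f * g * t ^+ 2)%:C = d1 + (f * t)%:C * d2.
  by rewrite -e1 -e2 !(rmorphB, rmorphM, rmorphXn, rmorph1) /=; ring.
have n1 := normc_ge0 d1; have n2 := normc_ge0 d2; have na := normc_ge0 a.
have key : normc a * (c0 * (1 + t ^+ 2)) <= (1 + Fb) * (normc d1 + t * normc d2).
  apply: (@le_trans _ _ (normc a * `|1 - f * g * t ^+ 2|)); first by rewrite ler_wpM2l.
  rewrite -normc_real -Normc.normcM ea (le_trans (normcD _ _)) //.
  rewrite Normc.normcM normc_real ger0_norm ?mulr_ge0 ?(ltW t0) //.
  have h1 : f * t * normc d2 <= Fb * (t * normc d2).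
    by rewrite -mulrA ler_wpM2r // mulr_ge0 // ltW.
  have h2 : 0 <= t * normc d2 by rewrite mulr_ge0 // ltW.
  have h3 : 0 <= Fb * normc d1 by rewrite mulr_ge0.
  by lra.
have T0 : 0 < 1 + t ^+ 2 by have := sqr_ge0 t; lra.
have G : forall w, 0 <= w -> w <= 1 + t ^+ 2 -> w * t <= 1 + t ^+ 2 ->
    w * normc a <= (1 + Fb) / c0 * (normc d1 + normc d2).
  move=> w w0 w1 wt.
  rewrite -(ler_pM2r (mulr_gt0 c00 T0)).
  apply: (@le_trans _ _ (w * ((1 + Fb) * (normc d1 + t * normc d2)))).
    by rewrite -mulrA ler_wpM2l.
  have -> : (1 + Fb) / c0 * (normc d1 + normc d2) * (c0 * (1 + t ^+ 2)) =
      (1 + Fb) * ((1 + t ^+ 2) * normc d1 + (1 + t ^+ 2) * normc d2).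
    by field; rewrite gt_eqF.
  rewrite mulrCA ler_wpM2l ?addr_ge0 // mulrDr lerD //; first by rewrite ler_wpM2r.
  by rewrite mulrA ler_wpM2r.
split; first by have := G 1; rewrite !mul1r; apply => //; nra.
rewrite Normc.normcM normc_real gtr0_norm //; apply: G; first exact: ltW.
  by nra.
by nra.
Qed.

Lemma absorb_errors (x y e1 e2 q E m : R) : m <= (x + e1) + (y + e2) ->
  e1 <= q -> e2 <= q -> 2 * q <= E -> m - E <= y + x.
Proof. by lra. Qed.

Lemma norm_diff_le (x y F : R) : 0 <= x <= F -> 0 <= y <= F -> `|x - y| <= 2 * F.
Proof. by move=> /andP[? ?] /andP[? ?]; rewrite ler_norml; apply/andP; split; lra. Qed.

End SpikeBlock.

(** * Deterministic estimates for one signal-plus-noise matrix *)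

Section Config.
Local Open Scope ring_scope.
Variable R : realType.
Local Notation C := R[i].
Local Notation normc := (@Normc.normc R).

(** [f] and [g] stand for phi and phit, [B] bounds X, the local law with error [e]
    holds on the segment from [lo] to [hi], and the interval J = [a1, a2] in it
    avoids the locations of all strengths but [th k]. *)
Variables (n m r : nat) (X : 'M[C]_(n, m)) (U : 'M[C]_(n, r)) (V : 'M[C]_(m, r)).
Variables (th : 'I_r -> R) (k : 'I_r) (f g : R -> R) (B lo hi a1 a2 c0 Fb e : R).
Local Notation Th := (Theta_mx th).
Local Notation W := (X + U *m Th *m V^t*).
Local Notation K := ((1 + Fb) / c0).
Local Notation gap := (lo - B).

Definition scalar_blocks (s t : R) : 'M[C]_(r + r) := block_mx s%:C%:M 0 0 t%:C%:M.

Hypotheses (UU : U^t* *m U = 1%:M) (VV : V^t* *m V = 1%:M).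
Hypothesis th_gt0 : forall l, 0 < th l.
Hypotheses (B0 : 0 <= B) (XB : forall v, enorm (X *m v) <= B * enorm v).
Hypotheses (Blo : B < lo) (lo1 : lo <= a1) (a2hi : a2 <= hi) (e0 : 0 <= e) (c00 : 0 < c0).
Hypothesis fb : forall z, lo <= z <= hi -> 0 <= f z <= Fb.
Hypothesis gb : forall z, lo <= z <= hi -> 0 <= g z <= Fb.
Hypothesis law : forall z, lo <= z <= hi -> forall y,
  enorm ((G_mx X U V z%:C - scalar_blocks (f z) (g z)) *m y) <= e * enorm y.
Hypothesis off : forall l z, l != k -> a1 <= z <= a2 ->
  c0 * (1 + th l ^+ 2) <= `|1 - f z * g z * th l ^+ 2|.

Lemma J_lohi (z : R) : a1 <= z <= a2 -> lo <= z <= hi.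
Proof. by move=> /andP[h1 h2]; rewrite (le_trans lo1 h1) (le_trans h2 a2hi). Qed.

Lemma Theta_entry (p : 'cV[C]_r) l : (Th *m p) l 0 = (th l)%:C * p l 0.
Proof. by rewrite /Theta_mx mul_diag_mx !mxE. Qed.

Lemma residual_entry (p b : 'cV[C]_r) l :
  (p - Th *m b) l 0 = p l 0 - (th l)%:C * b l 0.
Proof. by rewrite [LHS]mxE [X in _ + X]mxE Theta_entry. Qed.

Lemma scaled_entry (b q : 'cV[C]_r) (s : C) l : (b - s *: q) l 0 = b l 0 - s * q l 0.
Proof. by rewrite !mxE. Qed.

Lemma Theta_herm : Th^t* = Th.
Proof.
rewrite /Theta_mx tr_diag_mx map_diag_mx; congr diag_mx.
by apply/rowP => l; rewrite !mxE; exact: conj_real.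
Qed.

Lemma W_adj : W^t* = X^t* + V *m Th *m U^t*.
Proof.
by rewrite raddfD /= map_mxD !trmx_mul !map_mxM trmxCK Theta_herm !mulmxA.
Qed.

(** The residual of x for the perturbed matrix lies in the range of E, and is read
    off from the source y and from the overlaps E^t* x. *)
Lemma W_equation z (u : 'cV_n) (v : 'cV_m) p q :
  (z%:C%:M - linearization X) *m col_mx u v = E_mx U V *m col_mx p q ->
  (z%:C%:M - linearization W) *m col_mx u v =
  E_mx U V *m col_mx (p - Th *m (V^t* *m v)) (q - Th *m (U^t* *m u)).
Proof.
move=> h; have -> : col_mx (p - Th *m (V^t* *m v)) (q - Th *m (U^t* *m u)) =
    col_mx p q - col_mx (Th *m (V^t* *m v)) (Th *m (U^t* *m u)).
  by rewrite opp_col_mx add_col_mx.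
rewrite mulmxBr -h !mulmxBl -addrA; congr (_ + _).
rewrite !mul_linearization /E_mx mul_block_col !mul0mx addr0 add0r W_adj.
rewrite !mulmxDl !opp_col_mx add_col_mx -!mulmxA.
by congr col_mx; rewrite opprD.
Qed.

Lemma defect z p q a b : lo <= z <= hi ->
  G_mx X U V z%:C *m col_mx p q = col_mx a b ->
  enorm (col_mx (a - (f z)%:C *: p) (b - (g z)%:C *: q)) <= e * enorm (col_mx p q).
Proof.
move=> zJ Gy; apply: le_trans (law zJ (col_mx p q)).
rewrite mulmxBl Gy /scalar_blocks mul_block_col !mul0mx addr0 add0r !mul_scalar_mx.
by rewrite opp_col_mx add_col_mx.
Qed.

(** The l-th coordinates of a source (p, q) agree with those that the perturbation
    generates from the overlaps (a, b). *)
Definition balanced l (p q a b : 'cV[C]_r) :=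
  p l 0 = (th l)%:C * b l 0 /\ q l 0 = (th l)%:C * a l 0.

Section OffSpike.
Variables (z : R) (p q a b : 'cV[C]_r).
Hypothesis zJ : a1 <= z <= a2.
Hypothesis Gy : G_mx X U V z%:C *m col_mx p q = col_mx a b.
Local Notation y := (col_mx p q).
Hypothesis bal : forall l, l != k -> balanced l p q a b.
Let d1 := a - (f z)%:C *: p.
Let d2 := b - (g z)%:C *: q.

Lemma off_spike_entry l : l != k ->
  [/\ normc (a l 0) <= K * (normc (d1 l 0) + normc (d2 l 0)),
      normc (b l 0) <= K * (normc (d1 l 0) + normc (d2 l 0)),
      normc (p l 0) <= K * (normc (d1 l 0) + normc (d2 l 0)) &
      normc (q l 0) <= K * (normc (d1 l 0) + normc (d2 l 0))].
Proof.
move=> lk; have [pE qE] := bal lk.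
have zz := J_lohi zJ.
have e1 : a l 0 - (f z)%:C * ((th l)%:C * b l 0) = d1 l 0 by rewrite !mxE pE.
have e2 : b l 0 - (g z)%:C * ((th l)%:C * a l 0) = d2 l 0 by rewrite !mxE qE.
have [h1 h2] := block_inverse (th_gt0 l) (fb zz) (gb zz) c00 (off lk zJ) e1 e2.
have off' : c0 * (1 + th l ^+ 2) <= `|1 - g z * f z * th l ^+ 2|.
  by rewrite [g z * _]mulrC off.
have [h3 h4] := block_inverse (th_gt0 l) (gb zz) (fb zz) c00 off' e2 e1.
by rewrite pE qE ![normc (d1 l 0) + _]addrC; split => //; rewrite addrC.
Qed.

Lemma defect_entry l : normc (d1 l 0) + normc (d2 l 0) <= 2 * (e * enorm y).
Proof.
have h := defect (J_lohi zJ) Gy.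
have := normc_entry (col_mx d1 d2) (lshift r l); rewrite col_mxEu.
have := normc_entry (col_mx d1 d2) (rshift r l); rewrite col_mxEd.
by move: h; rewrite -/d1 -/d2; lra.
Qed.

Lemma K_ge0 : 0 <= K.
Proof.
have /andP[h1 h2] := fb (J_lohi zJ); apply: divr_ge0; last exact: ltW.
by apply: addr_ge0 => //; exact: le_trans h2.
Qed.

Let erase_le (x : 'cV[C]_r) :
  (forall l, l != k -> normc (x l 0) <= K * (normc (d1 l 0) + normc (d2 l 0))) ->
  enorm (erase k x) <= 2 * K * (e * enorm y).
Proof.
move=> hx; have K0 := K_ge0; have h := defect (J_lohi zJ) Gy.
have ey : 0 <= e * enorm y by rewrite mulr_ge0 ?enorm_ge0.
have Key : 0 <= 2 * K * (e * enorm y) by apply: mulr_ge0 => //; exact: mulr_ge0.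
rewrite -(@ler_pXn2r _ 2) ?nnegrE ?enorm_ge0 //.
apply: (@le_trans _ _ (2 * K ^+ 2 * enorm (col_mx d1 d2) ^+ 2)).
  rewrite enorm_col_mx !enorm_sqr -big_split mulr_sumr; apply: ler_sum => l _.
  rewrite mxE; case: ifPn => [_|lk].
    rewrite Normc.normc0 expr0n /=; apply: mulr_ge0; last by apply: addr_ge0; exact: sqr_ge0.
    by apply: mulr_ge0 => //; exact: sqr_ge0.
  apply: (@le_trans _ _ ((K * (normc (d1 l 0) + normc (d2 l 0))) ^+ 2)).
    apply: lerXn2r; last exact: hx; rewrite nnegrE ?normc_ge0 //.
    by apply: mulr_ge0 => //; apply: addr_ge0; exact: normc_ge0.
  rewrite exprMn [2 * _]mulrC -[leRHS]mulrA; apply: ler_wpM2l => /=; first exact: sqr_ge0.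
  by have := sqr_ge0 (normc (d1 l 0) - normc (d2 l 0)); nra.
have : enorm (col_mx d1 d2) ^+ 2 <= (e * enorm y) ^+ 2.
  by rewrite ler_pXn2r ?nnegrE ?enorm_ge0.
have : 0 <= K ^+ 2 by exact: sqr_ge0.
have : 0 <= (e * enorm y) ^+ 2 by exact: sqr_ge0.
rewrite !exprMn; set A := enorm (col_mx d1 d2) ^+ 2; set D := _ * _; set K2 := K ^+ 2.
by move=> D0 K20 AD; nra.
Qed.

(** These two bounds and [off_spike_overlap] serve both the singular pairs, balanced
    at every index, and the approximate eigenvector, balanced away from k only. *)
Lemma off_spike_p : enorm (erase k p) <= 2 * K * (e * enorm y).
Proof. by apply: erase_le => l /off_spike_entry[]. Qed.

Lemma off_spike_q : enorm (erase k q) <= 2 * K * (e * enorm y).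
Proof. by apply: erase_le => l /off_spike_entry[]. Qed.

Lemma off_spike_overlap l : l != k ->
  normc (a l 0) <= 2 * K * (e * enorm y) /\ normc (b l 0) <= 2 * K * (e * enorm y).
Proof.
move=> lk; have [h1 h2 _ _] := off_spike_entry lk.
have h : K * (normc (d1 l 0) + normc (d2 l 0)) <= K * (2 * (e * enorm y)).
  by rewrite ler_wpM2l ?K_ge0 // defect_entry.
by split; rewrite [2 * K]mulrC -mulrA; [exact: le_trans h | exact: le_trans h].
Qed.
End OffSpike.

Lemma E_mx_adj_col (u : 'cV[C]_n) (v : 'cV[C]_m) :
  (E_mx U V)^t* *m col_mx u v = col_mx (U^t* *m u) (V^t* *m v).
Proof. by rewrite E_mx_adj mul_block_col !mul0mx addr0 add0r. Qed.

Lemma enorm_E (y : 'cV[C]_(r + r)) : enorm (E_mx U V *m y) = enorm y.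
Proof. exact/enorm_isometry/E_mx_isometry. Qed.

(** For a vector x produced by a source y = (p, q): its overlaps are G(z) y, and its
    norm is comparable with that of y. *)
Lemma resolventK z (x : 'cV[C]_(n + m)) p q : B < z ->
  (z%:C%:M - linearization X) *m x = E_mx U V *m col_mx p q ->
  [/\ G_mx X U V z%:C *m col_mx p q = (E_mx U V)^t* *m x,
     (z - B) * enorm x <= enorm (col_mx p q) &
     enorm (col_mx p q) <= (z + B) * enorm x].
Proof.
move=> Bz xy; have z0 : 0 <= z by rewrite ltW // (le_lt_trans B0).
split; first by apply: G_mxP xy; exact: resolvent_unit Bz.
  by rewrite -enorm_E -xy; exact: resolvent_ge.
by rewrite -enorm_E -xy; exact: resolvent_le.
Qed.

Lemma singular_pair_block s (u : 'cV_n) (v : 'cV_m) :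
  W *m v = s%:C *: u -> W^t* *m u = s%:C *: v ->
  (s%:C%:M - linearization X) *m col_mx u v =
  E_mx U V *m col_mx (Th *m (V^t* *m v)) (Th *m (U^t* *m u)).
Proof.
move=> Wv Wu; rewrite mulmxBl mul_linearization mul_scalar_mx scale_col_mx.
rewrite -Wv -Wu /E_mx mul_block_col !mul0mx addr0 add0r W_adj !mulmxDl.
rewrite opp_col_mx add_col_mx -!mulmxA.
by congr col_mx; rewrite addrC addKr.
Qed.

Section Existence.
Variable z : R.
Hypothesis zJ : a1 <= z <= a2.
Hypothesis resonance : f z * g z * th k ^+ 2 = 1.
Hypothesis small : 4 * K * e < 1.

Let Pd : 'M[C]_r := diag_mx (\row_l (l == k)%:R).
Let Qd : 'M[C]_r := diag_mx (\row_l (l != k)%:R).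
Let Ti : 'M[C]_r := diag_mx (\row_l ((th l)^-1)%:C).
Let G := G_mx X U V z%:C.
(* prescribes the k-th coordinates of y and requires balance at the other ones *)
Let A : 'M[C]_(r + r) := block_mx Pd 0 0 Pd +
  block_mx Qd 0 0 Qd *m (block_mx Ti 0 0 Ti - block_mx 0 1%:M 1%:M 0 *m G).

Let A_col (p q a b : 'cV[C]_r) : G *m col_mx p q = col_mx a b ->
  A *m col_mx p q = col_mx (Pd *m p + Qd *m (Ti *m p - b)) (Pd *m q + Qd *m (Ti *m q - a)).
Proof.
move=> Gy; rewrite /A mulmxDl -mulmxA mulmxBl -mulmxA Gy.
rewrite !mul_block_col !mul0mx !mul1mx ?addr0 ?add0r opp_col_mx add_col_mx.
by rewrite mul_block_col !mul0mx ?addr0 ?add0r add_col_mx.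
Qed.

Let entry (p b : 'cV[C]_r) (l : 'I_r) : (Pd *m p + Qd *m (Ti *m p - b)) l 0 =
  (if l == k then p l 0 else (th l)^-1%:C * p l 0 - b l 0).
Proof.
rewrite mxE !mul_diag_mx !mxE; case: eqP => _; rewrite ?mul1r ?mul0r ?addr0 ?add0r //.
Qed.

Let G_split (p q : 'cV[C]_r) : exists a b : 'cV[C]_r, G *m col_mx p q = col_mx a b.
Proof. by exists (usubmx (G *m col_mx p q)), (dsubmx (G *m col_mx p q)); rewrite vsubmxK. Qed.

Let solved (p q a b w1 w2 : 'cV[C]_r) : G *m col_mx p q = col_mx a b ->
  A *m col_mx p q = col_mx w1 w2 -> (forall l, l != k -> w1 l 0 = 0 /\ w2 l 0 = 0) ->
  [/\ p k 0 = w1 k 0, q k 0 = w2 k 0 & forall l, l != k -> balanced l p q a b].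
Proof.
move=> Gy; rewrite (A_col Gy) => /eq_col_mx[e1 e2] w0.
split; first by rewrite -e1 entry eqxx.
  by rewrite -e2 entry eqxx.
move=> l lk; have [h1 h2] := w0 l lk.
have tn : (th l)%:C != 0 :> C by rewrite (inj_eq (@complexI R) _ 0) gt_eqF.
have tE : ((th l)^-1)%:C = (th l)%:C^-1 :> C by rewrite fmorphV.
split.
  move: h1; rewrite -e1 entry (negbTE lk) => /eqP; rewrite subr_eq0 => /eqP <-.
  by rewrite tE mulrA divff // mul1r.
move: h2; rewrite -e2 entry (negbTE lk) => /eqP; rewrite subr_eq0 => /eqP <-.
by rewrite tE mulrA divff // mul1r.
Qed.

Let A_unit : A \in unitmx.
Proof.
apply: unitmx_inj => y; rewrite -(vsubmxK y); set p := usubmx y; set q := dsubmx y.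
move=> Ay0; have [a [b Gy]] := G_split p q.
have Ay : A *m col_mx p q = col_mx 0 0 by rewrite Ay0 col_mx0.
have [|pk qk bal] := solved Gy Ay; first by move=> l _; rewrite !mxE.
have kp (x : 'cV[C]_r) : x k 0 = (0 : 'cV[C]_r) k 0 -> erase k x = x.
  by move=> xk; apply/colP => l; rewrite !mxE; case: eqP => // ->; rewrite xk mxE.
have hp := off_spike_p zJ Gy bal; have hq := off_spike_q zJ Gy bal.
rewrite kp // in hp; rewrite kp // in hq.
have hy : enorm (col_mx p q) <= enorm p + enorm q.
  rewrite -(@ler_pXn2r _ 2) ?nnegrE ?addr_ge0 ?enorm_ge0 // enorm_col_mx.
  by have := enorm_ge0 p; have := enorm_ge0 q; nra.
apply: enorm_eq0; apply/eqP; rewrite eq_le enorm_ge0 andbT leNgt; apply/negP => y0.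
have : 4 * K * e * enorm (col_mx p q) < 1 * enorm (col_mx p q) by rewrite ltr_pM2r.
have -> : 4 * K * e * enorm (col_mx p q) = 2 * K * (e * enorm (col_mx p q))
  + 2 * K * (e * enorm (col_mx p q)) by ring.
by lra.
Qed.

(** With y = (theta g, 1) at index k, the k-th block is exactly resonant for M, so
    the residual of x is theta_k times the k-th defect of the local law; at the other
    indices it vanishes by the choice of y.  Both are compared with |x| through
    |y| <= (z + B) |x|. *)
Lemma approximate_eigenvector : exists x : 'cV[C]_(n + m), x != 0 /\
  enorm ((z%:C%:M - linearization W) *m x) <= th k * e * (z + B) * enorm x.
Proof.
have zz := J_lohi zJ; have Bz : B < z by apply: lt_le_trans Blo _; case/andP: zz.
have z0 : 0 <= z by rewrite ltW // (le_lt_trans B0).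
pose w1 : 'cV[C]_r := \col_l (if l == k then (th k * g z)%:C else 0).
pose w2 : 'cV[C]_r := \col_l (if l == k then 1 else 0).
pose y := invmx A *m col_mx w1 w2; set p := usubmx y; set q := dsubmx y.
have yE : y = col_mx p q by rewrite vsubmxK.
have Ay : A *m col_mx p q = col_mx w1 w2 by rewrite -yE mulKVmx // A_unit.
have [a [b Gy]] := G_split p q.
have [|pw qw bal] := solved Gy Ay.
  by move=> l /negbTE lk; rewrite !mxE lk.
have pk : p k 0 = (th k * g z)%:C by rewrite pw mxE eqxx.
have qk : q k 0 = 1 by rewrite qw mxE eqxx.
have Xu : z%:C%:M - linearization X \in unitmx by exact: resolvent_unit Bz.
pose x := invmx (z%:C%:M - linearization X) *m (E_mx U V *m y).
have xE : (z%:C%:M - linearization X) *m x = E_mx U V *m col_mx p q.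
  by rewrite mulKVmx // yE.
have [Gx _ ley] := resolventK Bz xE.
rewrite -/G Gy -(vsubmxK x) E_mx_adj_col in Gx.
have [aE bE] := eq_col_mx Gx.
exists x; split.
  apply/eqP => x0; move: ley; rewrite x0 enorm0 mulr0 => y0.
  have := normc_entry (col_mx p q) (rshift r k); rewrite col_mxEd qk Normc.normc1.
  by move=> /le_trans/(_ y0); rewrite ler10.
rewrite -{1}(vsubmxK x) (@W_equation _ _ _ p q); last by rewrite vsubmxK.
rewrite -aE -bE enorm_E.
apply: (@le_trans _ _ (th k * (e * enorm (col_mx p q)))); last first.
  by rewrite -!mulrA ler_pM2l // ler_wpM2l.
have h := defect zz Gy.
have -> : col_mx (p - Th *m b) (q - Th *m a) =
    - (th k)%:C *: col_mx (\col_l (if l == k then (b - (g z)%:C *: q) l 0 else 0))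
                          (\col_l (if l == k then (a - (f z)%:C *: p) l 0 else 0)).
  have col_entry (w : 'cV[C]_r) s l : (s *: \col_j (if j == k then w j 0 else 0)) l 0 =
      s * (if l == k then w l 0 else 0) by rewrite !mxE.
  rewrite scale_col_mx; congr col_mx; apply/colP => l; rewrite residual_entry col_entry.
    case: eqP => [->|/eqP lk]; last by have [-> _] := bal l lk; rewrite mulr0 subrr.
    by rewrite scaled_entry pk qk rmorphM /=; ring.
  case: eqP => [->|/eqP lk]; last by have [_ ->] := bal l lk; rewrite mulr0 subrr.
  rewrite scaled_entry pk qk; have : (f z * g z * th k ^+ 2)%:C = 1 :> C by rewrite resonance.
  by rewrite !(rmorphM, rmorphXn) /= => res; rewrite -[X in X - _]res; ring.
rewrite enormZ normc_opp normc_real gtr0_norm // ler_pM2l //.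
apply: le_trans h; rewrite -(@ler_pXn2r _ 2) ?nnegrE ?enorm_ge0 //.
rewrite !enorm_col_mx addrC; apply: lerD; rewrite !enorm_sqr; apply: ler_sum => l _;
  rewrite [X in normc X ^+ 2 <= _]mxE; case: ifP => _ //;
  by rewrite Normc.normc0 expr0n /= sqr_ge0.
Qed.

End Existence.

(** (t - L) (x - x') = (t - s) x, and each resolvent costs a factor 1 / gap. *)
Lemma resolvent_shift s t x x' w : lo <= s -> lo <= t ->
  (s%:C%:M - linearization X) *m x = w -> (t%:C%:M - linearization X) *m x' = w ->
  enorm (x - x') <= `|s - t| / gap ^+ 2 * enorm w.
Proof.
move=> ls lt xw xw'; have gap0 : 0 < gap by rewrite subr_gt0.
have pos z : lo <= z -> 0 <= z by move=> lz; rewrite (le_trans _ lz) // ltW // (le_lt_trans B0).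
have low z (y : 'cV[C]_(n + m)) : lo <= z ->
    gap * enorm y <= enorm ((z%:C%:M - linearization X) *m y).
  move=> lz; apply: le_trans (resolvent_ge y B0 XB (pos _ lz)).
  by rewrite ler_wpM2r ?enorm_ge0 // lerD2r.
have E : (t%:C%:M - linearization X) *m (x - x') = (t - s)%:C *: x.
  rewrite mulmxBr xw' -xw -mulmxBl opprB addrA subrK.
  by rewrite rmorphB /= mulmxBl !mul_scalar_mx scalerBl.
have h1 := low t (x - x') lt; rewrite E enormZ normc_real in h1.
have h2 := low s x ls; rewrite xw in h2.
have nx : enorm x <= enorm w / gap by rewrite ler_pdivlMr // mulrC.
rewrite distrC (_ : _ / _ * _ = `|t - s| * (enorm w / gap) / gap); last by field; rewrite gt_eqF.
by rewrite ler_pdivlMr // mulrC (le_trans h1) // ler_wpM2l.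
Qed.

Lemma inner_scalar_blocks s t (p q p' q' : 'cV[C]_r) :
  inner (scalar_blocks s t *m col_mx p q) (col_mx p' q') = s%:C * inner p p' + t%:C * inner q q' /\
  inner (col_mx p' q') (scalar_blocks s t *m col_mx p q) = s%:C * inner p' p + t%:C * inner q' q.
Proof.
rewrite /scalar_blocks mul_block_col !mul0mx addr0 add0r !mul_scalar_mx !inner_col_mx.
by rewrite !innerZl !innerZr !conj_real.
Qed.

(** Replace x1 and x2 by the solutions z1 and z2 at rho and rho + h with the same
    sources.  The resolvent identity then expresses h <z1, z2> by G(rho) - G(rho + h),
    which the local law compares with the difference of the diagonal limits. *)
Lemma bilinear s1 s2 rho h (x1 x2 : 'cV[C]_(n + m)) p1 q1 p2 q2 :
  lo <= s1 -> lo <= s2 -> lo <= rho -> rho + h <= hi -> 0 < h ->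
  (s1%:C%:M - linearization X) *m x1 = E_mx U V *m col_mx p1 q1 ->
  (s2%:C%:M - linearization X) *m x2 = E_mx U V *m col_mx p2 q2 ->
  normc (inner x1 x2 - (((f rho - f (rho + h)) / h)%:C * inner p1 p2 +
                        ((g rho - g (rho + h)) / h)%:C * inner q1 q2)) <=
  ((`|s1 - rho| + `|s2 - rho| + h) / gap ^+ 3 + 2 * e / h) *
  (enorm (col_mx p1 q1) * enorm (col_mx p2 q2)).
Proof.
move=> ls1 ls2 lrho rhi h0 xy1 xy2; have gap0 : 0 < gap by rewrite subr_gt0.
set y1 := col_mx p1 q1 in xy1 *; set y2 := col_mx p2 q2 in xy2 *.
have zr : lo <= rho <= hi by apply/andP; split; lra.
have zrh : lo <= rho + h <= hi by apply/andP; split; lra.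
have Brho : B < rho by lra.
have Brh : B < rho + h by lra.
have U1 := resolvent_unit B0 XB Brho; have U2 := resolvent_unit B0 XB Brh.
pose z1 := invmx (rho%:C%:M - linearization X) *m (E_mx U V *m y1).
pose z2 := invmx ((rho + h)%:C%:M - linearization X) *m (E_mx U V *m y2).
have zy1 : (rho%:C%:M - linearization X) *m z1 = E_mx U V *m y1 by rewrite mulKVmx.
have zy2 : ((rho + h)%:C%:M - linearization X) *m z2 = E_mx U V *m y2 by rewrite mulKVmx.
have d1 : enorm (x1 - z1) <= `|s1 - rho| / gap ^+ 2 * enorm y1.
  by rewrite -enorm_E; apply: resolvent_shift zy1.
have d2 : enorm (x2 - z2) <= (`|s2 - rho| + h) / gap ^+ 2 * enorm y2.
  rewrite -(enorm_E y2); apply: le_trans (resolvent_shift _ _ xy2 zy2) _ => //; first by case/andP: zrh.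
  rewrite ler_wpM2r ?enorm_ge0 // ler_pM2r ?invr_gt0 ?exprn_gt0 // opprD addrA.
  by rewrite (le_trans (ler_normB _ _)) // (gtr0_norm h0).
have low z (x : 'cV[C]_(n + m)) y : lo <= z ->
    (z%:C%:M - linearization X) *m x = E_mx U V *m y -> enorm x <= gap^-1 * enorm y.
  move=> lz xy; rewrite ler_pdivlMl // -enorm_E -xy.
  have Bz : 0 <= z by rewrite (le_trans _ lz) // ltW // (le_lt_trans B0).
  apply: le_trans (resolvent_ge x B0 XB Bz).
  by rewrite ler_wpM2r ?enorm_ge0 // lerD2r.
have nx2 := low _ _ _ ls2 xy2; have nz1 := low _ _ _ lrho zy1.
have [G1 _ _] := resolventK Brho zy1; have [G2 _ _] := resolventK Brh zy2.
have resol : h%:C * inner z1 z2 =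
    inner (G_mx X U V rho%:C *m y1) y2 - inner y1 (G_mx X U V (rho + h)%:C *m y2).
  rewrite G1 G2 -inner_adj -inner_adjl -zy1 -zy2 !mulmxBl innerBl innerBr.
  rewrite !mul_scalar_mx innerZl innerZr conj_real (inner_adj (linearization X)).
  rewrite linearization_herm rmorphD /=.
  by move: (inner z1 z2) (inner (linearization X *m z1) z2) => i1 i2; ring.
set D1 := G_mx X U V rho%:C - scalar_blocks (f rho) (g rho).
set D2 := G_mx X U V (rho + h)%:C - scalar_blocks (f (rho + h)) (g (rho + h)).
have GE1 : G_mx X U V rho%:C *m y1 = scalar_blocks (f rho) (g rho) *m y1 + D1 *m y1.
  by rewrite -mulmxDl [scalar_blocks _ _ + _]addrC subrK.
have GE2 : G_mx X U V (rho + h)%:C *m y2 = scalar_blocks (f (rho + h)) (g (rho + h)) *m y2 + D2 *m y2.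
  by rewrite -mulmxDl [scalar_blocks _ _ + _]addrC subrK.
rewrite GE1 GE2 innerDl innerDr (inner_scalar_blocks _ _ p1 q1 p2 q2).1 (inner_scalar_blocks _ _ p2 q2 p1 q1).2 in resol.
have hC : h%:C != 0 :> C by rewrite (inj_eq (@complexI R) _ 0) gt_eqF.
have -> : inner x1 x2 - (((f rho - f (rho + h)) / h)%:C * inner p1 p2 +
                        ((g rho - g (rho + h)) / h)%:C * inner q1 q2) =
  (inner (x1 - z1) x2 + inner z1 (x2 - z2)) +
  h%:C^-1 * (inner (D1 *m y1) y2 - inner y1 (D2 *m y2)).
  have -> : inner (D1 *m y1) y2 - inner y1 (D2 *m y2) = h%:C * inner z1 z2 -
      ((f rho - f (rho + h))%:C * inner p1 p2 + (g rho - g (rho + h))%:C * inner q1 q2).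
    by rewrite resol !rmorphB /=; ring.
  rewrite innerBl innerBr !rmorphM !rmorphB !fmorphV /=.
  by field.
have n1 := enorm_ge0 y1; have n2 := enorm_ge0 y2.
set Y1 := enorm y1 in d1 nz1 n1 *; set Y2 := enorm y2 in d2 nx2 n2 *.
rewrite (le_trans (normcD _ _)) // [leRHS]mulrDl lerD //.
  rewrite (le_trans (normcD _ _)) //.
  have -> : (`|s1 - rho| + `|s2 - rho| + h) / gap ^+ 3 * (Y1 * Y2) =
    (`|s1 - rho| / gap ^+ 2 * Y1) * (gap^-1 * Y2) +
    (gap^-1 * Y1) * ((`|s2 - rho| + h) / gap ^+ 2 * Y2).
    by field; rewrite gt_eqF.
  by apply: lerD; apply: le_trans (normc_inner _ _) _; apply: ler_pM; rewrite ?enorm_ge0.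
rewrite Normc.normcM -fmorphV normc_real ger0_norm ?invr_ge0 ?(ltW h0) //.
have -> : 2 * e / h * (Y1 * Y2) = h^-1 * ((e * Y1) * Y2 + Y1 * (e * Y2)) by ring.
rewrite ler_wpM2l ?invr_ge0 ?(ltW h0) // (le_trans (normcB _ _)) // lerD //.
  by apply: le_trans (normc_inner _ _) _; rewrite ler_wpM2r // law.
by apply: le_trans (normc_inner _ _) _; rewrite ler_wpM2l // law.
Qed.

(** One constant for all the errors below; N bounds the norm of the source of a
    singular pair, [gap] comes from the resolvents, K from the inverse blocks. *)
Definition pair_const : R := let N := 2 * (hi + B) in
  N + 8 * K ^+ 2 * N ^+ 2 + N ^+ 2 / gap ^+ 3 + 2 * N ^+ 2 + 16 * Fb * K ^+ 2 * N ^+ 2.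

Hypothesis e_small : 0 < e < 1.

Section OnePair.
Variables (s : R) (u : 'cV[C]_n) (v : 'cV[C]_m).
Hypothesis sJ : a1 <= s <= a2.
Hypotheses (u1 : enorm u = 1) (v1 : enorm v = 1).
Hypotheses (Wv : W *m v = s%:C *: u) (Wu : W^t* *m u = s%:C *: v).
Local Notation a := (U^t* *m u).
Local Notation b := (V^t* *m v).
Local Notation p := (Th *m b).
Local Notation q := (Th *m a).

Lemma pair_balanced l : balanced l p q a b.
Proof. by split; rewrite Theta_entry. Qed.

Let sB : B < s. Proof. by case/andP: (J_lohi sJ) => h _; exact: lt_le_trans h. Qed.

Lemma pair_G : G_mx X U V s%:C *m col_mx p q = col_mx a b.
Proof.
have [h _ _] := resolventK sB (singular_pair_block Wv Wu).
by rewrite h E_mx_adj_col.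
Qed.

Let x2 : enorm (col_mx u v) ^+ 2 = 2.
Proof. by rewrite enorm_col_mx u1 v1; ring. Qed.

Lemma pair_source_le : enorm (col_mx p q) <= 2 * (hi + B).
Proof.
have [_ _ h] := resolventK sB (singular_pair_block Wv Wu).
apply: (le_trans h); have /andP[ls sh] := J_lohi sJ.
have x0 := enorm_ge0 (col_mx u v).
have x22 : enorm (col_mx u v) <= 2 by have := x2; nra.
rewrite mulrC; apply: ler_pM => //; last by rewrite lerD2r.
by rewrite addr_ge0 // (le_trans B0) // ltW.
Qed.

Lemma pair_source_ge : 2 * gap ^+ 2 <= enorm (col_mx p q) ^+ 2.
Proof.
have [_ h _] := resolventK sB (singular_pair_block Wv Wu).
have /andP[ls sh] := J_lohi sJ; have gap0 : 0 < gap by rewrite subr_gt0.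
rewrite -x2 mulrC -exprMn ler_pXn2r ?nnegrE ?mulr_ge0 ?enorm_ge0 ?(ltW gap0) //.
by apply: le_trans h; rewrite ler_wpM2r ?enorm_ge0 // lerD2r.
Qed.

Lemma pair_off_spike x : x = p \/ x = q -> enorm (erase k x) <= 2 * K * (e * (2 * (hi + B))).
Proof.
have h : 2 * K * (e * enorm (col_mx p q)) <= 2 * K * (e * (2 * (hi + B))).
  have K0 := K_ge0 sJ; apply: ler_wpM2l; first exact: mulr_ge0.
  by rewrite ler_wpM2l // pair_source_le.
have bal l : l != k -> balanced l p q a b by move=> _; exact: pair_balanced.
case=> ->; apply: le_trans h; [exact: (off_spike_p sJ pair_G bal)|exact: (off_spike_q sJ pair_G bal)].
Qed.

Lemma pair_overlap l : l != k ->
  normc (a l 0) <= 2 * K * (e * (2 * (hi + B))) /\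
  normc (b l 0) <= 2 * K * (e * (2 * (hi + B))).
Proof.
have h : 2 * K * (e * enorm (col_mx p q)) <= 2 * K * (e * (2 * (hi + B))).
  have K0 := K_ge0 sJ; apply: ler_wpM2l; first exact: mulr_ge0.
  by rewrite ler_wpM2l // pair_source_le.
have bal l' : l' != k -> balanced l' p q a b by move=> _; exact: pair_balanced.
move=> lk; have [h1 h2] := off_spike_overlap sJ pair_G bal lk.
by split; apply: le_trans h.
Qed.

(** Bessel's inequality. *)
Lemma coordinate_le1 d (Q : 'M[C]_(d, r)) (x : 'cV[C]_d) :
  Q^t* *m Q = 1%:M -> enorm x = 1 -> normc ((Q^t* *m x) k 0) <= 1.
Proof.
move=> QQ x1; apply: le_trans (normc_entry _ _) _.
have := @enorm_adj_le _ _ _ Q 1 x ler01; rewrite x1 mul1r; apply => w.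
by rewrite mul1r enorm_isometry.
Qed.

Lemma pair_const_ge : [/\ 2 * (hi + B) <= pair_const,
  8 * K ^+ 2 * (2 * (hi + B)) ^+ 2 <= pair_const &
  (2 * (hi + B)) ^+ 2 / gap ^+ 3 + 2 * (2 * (hi + B)) ^+ 2
   + 16 * Fb * K ^+ 2 * (2 * (hi + B)) ^+ 2 <= pair_const].
Proof.
have gap0 : 0 < gap by rewrite subr_gt0.
have N0 : 0 <= 2 * (hi + B).
  by apply: le_trans (enorm_ge0 _) pair_source_le.
have F0 : 0 <= Fb by have /andP[h1 h2] := fb (J_lohi sJ); exact: le_trans h2.
rewrite /pair_const; set N := 2 * (hi + B) in N0 *.
have t1 : 0 <= 8 * K ^+ 2 * N ^+ 2 by rewrite mulr_ge0 ?sqr_ge0 // mulr_ge0 ?sqr_ge0.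
have t2 : 0 <= N ^+ 2 / gap ^+ 3 by rewrite divr_ge0 ?sqr_ge0 // exprn_ge0 // ltW.
have t3 : 0 <= 2 * N ^+ 2 by rewrite mulr_ge0 ?sqr_ge0.
have t4 : 0 <= 16 * Fb * K ^+ 2 * N ^+ 2.
  by rewrite mulr_ge0 ?sqr_ge0 // mulr_ge0 ?sqr_ge0 // mulr_ge0.
by split; lra.
Qed.

Lemma pair_relation :
  spike_relation f g lo hi pair_const (2 * gap ^+ 2) e (th k) s (a k 0) (b k 0).
Proof.
have zz := J_lohi sJ; have /andP[e1 e2] := e_small.
have [c1 c2 _] := pair_const_ge; have yN := pair_source_le.
have hd := defect zz pair_G.
have eN : e * enorm (col_mx p q) <= pair_const * e.
  by rewrite mulrC ler_wpM2r // (le_trans yN).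
split => //; [exact: coordinate_le1 | exact: coordinate_le1 | split].
- apply: le_trans eN; apply: le_trans hd.
  have := normc_entry (col_mx (a - (f s)%:C *: p) (b - (g s)%:C *: q)) (lshift r k).
  by rewrite col_mxEu scaled_entry Theta_entry mulrA -rmorphM.
- apply: le_trans eN; apply: le_trans hd.
  have := normc_entry (col_mx (a - (f s)%:C *: p) (b - (g s)%:C *: q)) (rshift r k).
  by rewrite col_mxEd scaled_entry Theta_entry mulrA -rmorphM.
have t0 := pair_source_ge.
rewrite enorm_col_mx (enorm_erase k p) (enorm_erase k q) !Theta_entry in t0.
rewrite !Normc.normcM !normc_real (gtr0_norm (th_gt0 k)) !exprMn in t0.
have sq x : x = p \/ x = q -> enorm (erase k x) ^+ 2 <= 4 * K ^+ 2 * (2 * (hi + B)) ^+ 2 * e.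
  move=> px; apply: (@le_trans _ _ ((2 * K * (e * (2 * (hi + B)))) ^+ 2)).
    apply: lerXn2r; rewrite ?nnegrE ?enorm_ge0 ?pair_off_spike //.
    exact: le_trans (enorm_ge0 _) (pair_off_spike px).
  rewrite (_ : _ ^+ 2 = 4 * K ^+ 2 * (2 * (hi + B)) ^+ 2 * e * e); last by ring.
  by rewrite ler_piMr ?(ltW e2) // mulr_ge0 // mulr_ge0 ?sqr_ge0 // mulr_ge0 ?sqr_ge0.
have t1 := sq p (or_introl erefl); have t2 := sq q (or_intror erefl).
have t3 : 2 * (4 * K ^+ 2 * (2 * (hi + B)) ^+ 2 * e) <= pair_const * e.
  rewrite (_ : 2 * _ = 8 * K ^+ 2 * (2 * (hi + B)) ^+ 2 * e); last by ring.
  by rewrite ler_wpM2r.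
by rewrite mulrDr; exact: absorb_errors t0 t1 t2 t3.
Qed.

End OnePair.

(** The step h = sqrt e balances the two errors of [bilinear]: the shift of the
    spectral parameter costs h, and the local law costs e / h = h.  The off-spike
    part of the inner products is of order e^2, against a coefficient of order
    1 / h. *)
Lemma two_pairs rho s1 s2 u1 v1 u2 v2 : lo <= rho -> rho + 1 <= hi ->
  a1 <= s1 <= a2 -> a1 <= s2 <= a2 ->
  singular_pair ComplexScalars W s1 u1 v1 -> singular_pair ComplexScalars W s2 u2 v2 ->
  reduced_ok f g rho lo hi pair_const (2 * gap ^+ 2)
    (ReducedPair e (th k) s1 s2 ((U^t* *m u1) k 0) ((V^t* *m v1) k 0)
       ((U^t* *m u2) k 0) ((V^t* *m v2) k 0) (inner u1 u2 + inner v1 v2)).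
Proof.
move=> lrho rhi J1 J2 [_ [nu1 nv1] Wv1 Wu1] [_ [nu2 nv2] Wv2 Wu2].
have /andP[e1 e2] := e_small.
split => //=; try exact: pair_relation.
set h := Num.sqrt e.
have h0 : 0 < h by rewrite sqrtr_gt0.
have h1 : h <= 1 by rewrite -sqrtr1 ler_sqrt // ltW.
have hh : h * h = e by rewrite -expr2 sqr_sqrtr // ltW.
have B1 := singular_pair_block Wv1 Wu1; have B2 := singular_pair_block Wv2 Wu2.
have /andP[l1 _] := J_lohi J1; have /andP[l2 _] := J_lohi J2.
have rhi' : rho + h <= hi by apply: le_trans rhi; rewrite lerD2l.
have := bilinear l1 l2 lrho rhi' h0 B1 B2; rewrite inner_col_mx.
set A1 := (f rho - f (rho + h)) / h; set A2 := (g rho - g (rho + h)) / h.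
set p1 := Th *m (V^t* *m v1); set q1 := Th *m (U^t* *m u1).
set p2 := Th *m (V^t* *m v2); set q2 := Th *m (U^t* *m u2).
set N := 2 * (hi + B).
have y1 : enorm (col_mx p1 q1) <= N := pair_source_le J1 nu1 nv1 Wv1 Wu1.
have y2 : enorm (col_mx p2 q2) <= N := pair_source_le J2 nu2 nv2 Wv2 Wu2.
have k1 x : x = p1 \/ x = q1 -> enorm (erase k x) <= 2 * K * (e * N) by exact: pair_off_spike J1 nu1 nv1 Wv1 Wu1 x.
have k2 x : x = p2 \/ x = q2 -> enorm (erase k x) <= 2 * K * (e * N) by exact: pair_off_spike J2 nu2 nv2 Wv2 Wu2 x.
have N0 : 0 <= N by apply: le_trans (enorm_ge0 _) y1.
have gap0 : 0 < gap by rewrite subr_gt0.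
have zr : lo <= rho <= hi by rewrite lrho (le_trans _ rhi) // lerDl.
have zrh : lo <= rho + h <= hi by rewrite rhi' andbT (le_trans lrho) // lerDl ltW.
have F0 : 0 <= Fb by have /andP[t1 t2] := fb zr; exact: le_trans t2.
move=> bil.
have bil2 : ((`|s1 - rho| + `|s2 - rho| + h) / gap ^+ 3 + 2 * e / h) *
    (enorm (col_mx p1 q1) * enorm (col_mx p2 q2)) <=
    (N ^+ 2 / gap ^+ 3) * (`|s1 - rho| + `|s2 - rho| + h) + 2 * N ^+ 2 * h.
  have -> : (N ^+ 2 / gap ^+ 3) * (`|s1 - rho| + `|s2 - rho| + h) + 2 * N ^+ 2 * h =
     ((`|s1 - rho| + `|s2 - rho| + h) / gap ^+ 3 + 2 * e / h) * (N * N).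
    by rewrite -hh; field; rewrite !gt_eqF.
  have yy : enorm (col_mx p1 q1) * enorm (col_mx p2 q2) <= N * N.
    exact: (ler_pM (enorm_ge0 _) (enorm_ge0 _) y1 y2).
  have q0 : 0 <= (`|s1 - rho| + `|s2 - rho| + h) / gap ^+ 3 + 2 * e / h.
    apply: addr_ge0; apply: divr_ge0; rewrite ?exprn_ge0 ?(ltW gap0) ?(ltW h0) //.
      by rewrite !addr_ge0 // ltW.
    by rewrite mulr_ge0.
  exact: (ler_wpM2l q0 yy).
have quot (w : R -> R) : (forall z, lo <= z <= hi -> 0 <= w z <= Fb) ->
    `|(w rho - w (rho + h)) / h| * (2 * K * (e * N)) ^+ 2 <= 8 * Fb * K ^+ 2 * N ^+ 2 * e.
  move=> wb.
  have t : `|(w rho - w (rho + h)) / h| <= 2 * Fb / h.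
    rewrite normrM normfV (gtr0_norm h0) ler_pM2r ?invr_gt0 //.
    by apply: norm_diff_le; exact: wb.
  apply: (@le_trans _ _ (2 * Fb / h * (2 * K * (e * N)) ^+ 2)).
    by rewrite ler_wpM2r // sqr_ge0.
  have -> : 2 * Fb / h * (2 * K * (e * N)) ^+ 2 = 8 * Fb * K ^+ 2 * N ^+ 2 * e * h.
    by rewrite -!hh; field; rewrite !gt_eqF.
  have T0 : 0 <= 8 * Fb * K ^+ 2 * N ^+ 2 * e.
    by apply: mulr_ge0 => //; do 2 (apply: mulr_ge0; last exact: sqr_ge0); exact: mulr_ge0.
  by rewrite ler_piMr.
(* the off-spike part of the two inner products *)
have kk x1 x2 : (x1 = p1 \/ x1 = q1) -> (x2 = p2 \/ x2 = q2) ->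
    normc (inner (erase k x1) (erase k x2)) <= (2 * K * (e * N)) ^+ 2.
  move=> /k1 h3 /k2 h4; apply: le_trans (normc_inner _ _) _; rewrite expr2.
  by apply: ler_pM; rewrite ?enorm_ge0.
have main : inner u1 u2 + inner v1 v2 -
   ((A1 * th k ^+ 2)%:C * (((V^t* *m v1) k 0)^* * (V^t* *m v2) k 0) +
    (A2 * th k ^+ 2)%:C * (((U^t* *m u1) k 0)^* * (U^t* *m u2) k 0)) =
   (inner u1 u2 + inner v1 v2 - (A1%:C * inner p1 p2 + A2%:C * inner q1 q2)) +
   (A1%:C * inner (erase k p1) (erase k p2) + A2%:C * inner (erase k q1) (erase k q2)).
  rewrite (inner_erase k p1) (inner_erase k q1) !Theta_entry !conjM !conj_real.
  rewrite ![(_ * th k ^+ 2)%:C]rmorphM /= ![(th k ^+ 2)%:C]rmorphXn /=.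
  move: (inner (erase k p1) _) (inner (erase k q1) _) (inner u1 u2) (inner v1 v2) => i1 i2 i3 i4.
  move: ((V^t* *m v1) k 0)^* ((V^t* *m v2) k 0) ((U^t* *m u1) k 0)^* ((U^t* *m u2) k 0) => b1 b2 b3 b4.
  by ring.
have J := pair_const_ge J1 nu1 nv1 Wv1 Wu1; have [_ _ cst] := J.
set S := `|s1 - rho| + `|s2 - rho| + h + e.
suff H : normc ((inner u1 u2 + inner v1 v2 - (A1%:C * inner p1 p2 + A2%:C * inner q1 q2)) +
   (A1%:C * inner (erase k p1) (erase k p2) + A2%:C * inner (erase k q1) (erase k q2))) <= pair_const * S.
  by move: H; rewrite -main; exact.
apply: le_trans (normcD _ _) _.
apply: (@le_trans _ _ ((N ^+ 2 / gap ^+ 3) * (`|s1 - rho| + `|s2 - rho| + h) + 2 * N ^+ 2 * h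
    + 16 * Fb * K ^+ 2 * N ^+ 2 * e)).
  apply: lerD; first exact: le_trans bil2.
  apply: le_trans (normcD _ _) _; rewrite !Normc.normcM !normc_real.
  have -> : 16 * Fb * K ^+ 2 * N ^+ 2 * e = 8 * Fb * K ^+ 2 * N ^+ 2 * e + 8 * Fb * K ^+ 2 * N ^+ 2 * e by ring.
  apply: lerD.
    by apply: le_trans (quot f fb); rewrite ler_wpM2l // kk //; left.
  by apply: le_trans (quot g gb); rewrite ler_wpM2l // kk //; right.
have S0 : 0 <= S by rewrite /S !addr_ge0 // ltW.
apply: (@le_trans _ _ ((N ^+ 2 / gap ^+ 3 + 2 * N ^+ 2 + 16 * Fb * K ^+ 2 * N ^+ 2) * S)); last first.
  by rewrite ler_wpM2r.
rewrite [leRHS]mulrDl [X in _ <= X + _]mulrDl; apply: lerD; first apply: lerD.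
- apply: ler_wpM2l; first by rewrite divr_ge0 ?sqr_ge0 // exprn_ge0 // ltW.
  by rewrite /S lerDl ltW.
- apply: ler_wpM2l; first by rewrite mulr_ge0 ?sqr_ge0.
  by rewrite /S -addrA addrC -addrA lerDl !addr_ge0 // ltW.
- apply: ler_wpM2l; last by rewrite /S lerDr !addr_ge0 // ltW.
  by rewrite mulr_ge0 ?sqr_ge0 // mulr_ge0 ?sqr_ge0 // mulr_ge0.
Qed.

End Config.

(** * Events of probability tending to one *)

Section HighProbability.
Local Open Scope ring_scope.
Variables (R : realType) (d : nat -> measure_display)
  (Omega : forall n, measurableType (d n)) (Pr : forall n, probability (Omega n) R).

Lemma whp_mono (E E' : forall n, set (Omega n)) :
  (forall n, E n `<=` E' n) -> whp Pr E -> whp Pr E'.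
Proof.
move=> EE [A [mA cA]]; exists A; split=> // n; have [mAn AE] := mA n.
by split=> //; exact: subset_trans (EE n).
Qed.

(** Inclusion-exclusion: P(A and A') >= P(A) + P(A') - 1. *)
Lemma whp_and (E E' : forall n, set (Omega n)) :
  whp Pr E -> whp Pr E' -> whp Pr (fun n => E n `&` E' n).
Proof.
move=> [A [mA cA]] [A' [mA' cA']]; exists (fun n => A n `&` A' n); split.
  move=> n; have [mAn AE] := mA n; have [mAn' AE'] := mA' n.
  by split; [exact: measurableI | exact: setISS].
have fin n (B : set (Omega n)) : measurable B -> Pr n B \is a fin_num by exact: fin_num_measure.
have lower n : (Pr n (A n) + Pr n (A' n) - 1 <= Pr n (A n `&` A' n))%E.
  have [mAn _] := mA n; have [mAn' _] := mA' n.
  have h : (Pr n (A n) <= Pr n (A n `&` A' n) + Pr n (~` A' n))%E.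
    apply: (le_trans _ (measureU2 _ _ _)); last 2 first.
    - exact: measurableI.
    - exact: measurableC.
    apply: le_measure; rewrite ?inE //.
      by apply: measurableU; [exact: measurableI | exact: measurableC].
    by move=> w Aw; have [A'w|A'w] := pselect (A' n w); [left|right].
  rewrite probability_setC // in h.
  move: h (fin _ _ mAn) (fin _ _ mAn') (fin _ _ (measurableI _ _ mAn mAn')).
  case: (Pr n (A n)) => // p; case: (Pr n (A' n)) => // p'; case: (Pr n (_ `&` _)) => // q.
  by move=> + _ _ _; rewrite /= ?lee_fin; lra.
apply: (squeeze_cvge (f := fun n => (Pr n (A n) + Pr n (A' n) - 1)%E) (h := fun=> 1%E)).
- apply: nearW => n; rewrite lower /=; apply: probability_le1.
  by apply: measurableI; [case: (mA n)|case: (mA' n)].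
- have e1 : (1 + 1 - 1 = 1 :> \bar R)%E by congr (_%:E); lra.
  rewrite -[X in _ --> X]e1.
  apply: cvgeB => //; last exact: cvg_cst.
  by apply: cvgeD.
- exact: cvg_cst.
Qed.

Lemma whp_eventually (E E' : forall n, set (Omega n)) (T : nat -> Prop) :
  (\forall n \near \oo, T n) -> (forall n, T n -> E n `<=` E' n) ->
  whp Pr E -> whp Pr E'.
Proof.
move=> [N _ TN] EE [A [mA cA]].
(* the limit of the probabilities does not see the empty events before N *)
exists (fun n => if (N <= n)%N then A n else set0); split.
  move=> n; have [mAn AE] := mA n; case: ifP => // Nn; split => //.
  by apply: subset_trans AE _; apply: EE; exact: TN.
apply: cvg_trans cA; apply: near_eq_cvg; exists N => // n /= Nn.
by rewrite Nn.
Qed.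
End HighProbability.

(** * A single spike in the interval *)

Section SingleSpike.
Local Open Scope ring_scope.
Variables (R : realType) (mu : probability R R) (c : R).
Local Notation C := R[i].
Local Notation normc := (@Normc.normc R).
Hypothesis mu_ge0 : mu `[0, +oo[%classic = 1%E.
Hypothesis mu_cpt : compact (msupport mu).
Hypothesis c_range : 0 < c <= 1.
Hypothesis edge_cond : edge_condition mu c.
Local Notation b := (edge mu).
Variables (a1 a2 delta th B : R).
Local Notation rho0 := (rho mu c th).
Local Notation f := (phiR mu).
Local Notation g := (phitR mu c).
Definition spike_lo := Num.min a1 rho0.
Definition spike_hi := Num.max a2 rho0 + 1.
Local Notation lo := spike_lo.
Local Notation hi := spike_hi.
Hypothesis J_edge : b < a1 <= a2.
Hypothesis delta_gt0 : 0 < delta.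
Hypothesis th_super : theta_star mu c < th.
Hypotheses (bB : b < B) (Blo : B < lo).

Let Fb := hi / (lo ^+ 2 - b ^+ 2).
Let A := phi_slope mu rho0 rho0.
Let A' := phit_slope mu c rho0.
Let slope := A * g rho0 + A' * f rho0.
(* the limit of <x1, x2> / (b1_k^* b2_k); see [kappaRE] *)
Let D0 := A * th ^+ 2 + A' * th ^+ 4 * f rho0 ^+ 2.

Let rho0P := rhoP mu_ge0 mu_cpt c_range edge_cond th_super.
Let b0 : 0 <= b := edge_ge0 mu.
Let th0 : 0 < th. Proof. exact: lt_trans (theta_star_gt0 edge_cond) th_super. Qed.
Let lo_gt : b < lo. Proof. exact: lt_trans bB Blo. Qed.
Let lo_gt0 : 0 < lo. Proof. exact: le_lt_trans b0 lo_gt. Qed.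
Let lo_a1 : lo <= a1. Proof. by rewrite ge_min lexx. Qed.
Let lo_rho : lo <= rho0. Proof. by rewrite ge_min lexx orbT. Qed.
Let a2_hi : a2 <= hi. Proof. by rewrite (@le_trans _ _ (Num.max a2 rho0)) ?le_max ?lexx // lerDl. Qed.
Let rho_hi : rho0 + 1 <= hi. Proof. by rewrite lerD2r le_max lexx orbT. Qed.
Let lo_hi : lo <= hi.
Proof. by apply: le_trans lo_rho _; apply: le_trans rho_hi; rewrite lerDl. Qed.
Let hi_gt0 : 0 < hi. Proof. exact: lt_le_trans lo_gt0 lo_hi. Qed.
Let B_ge0 : 0 <= B. Proof. by rewrite (le_trans b0) // ltW. Qed.
Let gap2 : 0 < lo ^+ 2 - b ^+ 2.
Proof. by rewrite subr_gt0 ltr_pXn2r ?nnegrE // ltW. Qed.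
Let Fb_ge0 : 0 <= Fb. Proof. by rewrite divr_ge0 // ltW. Qed.

Let bound_Fb z : lo <= z <= hi -> z / (z ^+ 2 - b ^+ 2) <= Fb.
Proof.
move=> /andP[lz zh]; have z0 : 0 < z by exact: lt_le_trans lz.
have lz2 : lo ^+ 2 <= z ^+ 2 by rewrite ler_pXn2r ?nnegrE // ltW.
have q0 : 0 < z ^+ 2 - b ^+ 2 by apply: lt_le_trans gap2 _; rewrite lerD2r.
apply: ler_pM => //; [exact: ltW | by rewrite invr_ge0 ltW |].
by rewrite lef_pV2 ?posrE // lerD2r.
Qed.

Let in_off z : lo <= z <= hi -> b < z.
Proof. by case/andP=> lz _; exact: lt_le_trans lz. Qed.

Let f_gt0 z : b < z -> 0 < f z.
Proof.
move=> bz; have /andP[h _] := phiR_bounds mu_ge0 mu_cpt bz.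
by apply: lt_le_trans h; rewrite invr_gt0 (edge_lt_gt0 bz).
Qed.

Let g_gt0 z : b < z -> 0 < g z.
Proof.
move=> bz; have /andP[h _] := phitR_bounds mu_ge0 mu_cpt c_range bz.
by apply: lt_le_trans h; rewrite invr_gt0 (edge_lt_gt0 bz).
Qed.

Let fb z : lo <= z <= hi -> 0 <= f z <= Fb.
Proof.
move=> zJ; have bz := in_off zJ; rewrite (ltW (f_gt0 bz)) /=.
by have /andP[_ h] := phiR_bounds mu_ge0 mu_cpt bz; apply: le_trans h _; exact: bound_Fb.
Qed.

Let gb z : lo <= z <= hi -> 0 <= g z <= Fb.
Proof.
move=> zJ; have bz := in_off zJ; rewrite (ltW (g_gt0 bz)) /=.
by have /andP[_ h] := phitR_bounds mu_ge0 mu_cpt c_range bz; apply: le_trans h _; exact: bound_Fb.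
Qed.

Let A_gt0 : 0 < A.
Proof.
have r0 := edge_lt_gt0 rho0P.1.
by apply: lt_le_trans (phi_slope_ge mu_ge0 mu_cpt rho0P.1 rho0P.1); rewrite invr_gt0 mulr_gt0.
Qed.

Let A'_gt0 : 0 < A'.
Proof.
have r0 := edge_lt_gt0 rho0P.1; have /andP[c0 c1] := c_range.
by rewrite /A' /phit_slope ltr_wpDr ?mulr_gt0 // divr_ge0 ?sqr_ge0 // subr_ge0.
Qed.

Let D0_gt0 : 0 < D0.
Proof.
rewrite /D0 ltr_wpDr ?mulr_gt0 ?exprn_gt0 //.
by rewrite mulr_ge0 ?sqr_ge0 // mulr_ge0 ?exprn_ge0 // ltW.
Qed.

Let fg : f rho0 * g rho0 = th ^- 2. Proof. by rewrite -dRE rho0P.2. Qed.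

Let derive_dR : derive1 (dR mu c) rho0 = - slope.
Proof.
have [_ h] := dR_derive c mu_ge0 mu_cpt rho0P.1.
by rewrite derive1E h.
Qed.

Let slope_gt0 : 0 < slope.
Proof. by rewrite addr_gt0 // mulr_gt0 ?f_gt0 ?g_gt0 // rho0P.1. Qed.

Let kappaRE : kappaR mu c th = 2 / D0.
Proof.
have D0E : D0 * g rho0 = th ^+ 2 * slope.
  have h : f rho0 * g rho0 * th ^+ 2 = 1 by rewrite fg mulVf // gt_eqF // exprn_gt0.
  rewrite /D0 /slope; transitivity (th ^+ 2 * (A * g rho0 + A' * f rho0 * (f rho0 * g rho0 * th ^+ 2))).
    by ring.
  by rewrite h mulr1.
have g0 : g rho0 != 0 by rewrite gt_eqF // g_gt0 // rho0P.1.
rewrite /kappaR derive_dR (_ : 2 / D0 = 2 * g rho0 / (D0 * g rho0)); last first.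
  by field; rewrite g0 gt_eqF.
by rewrite D0E; field; rewrite !gt_eqF.
Qed.

Let kappaLE : kappaL mu c th = (f rho0 * th) ^+ 2 * (2 / D0).
Proof.
rewrite -kappaRE /kappaL /kappaR derive_dR.
have h : f rho0 * g rho0 * th ^+ 2 = 1 by rewrite fg mulVf // gt_eqF // exprn_gt0.
transitivity (2 * f rho0 * (f rho0 * g rho0 * th ^+ 2) / (th ^+ 2 * slope)).
  by rewrite h; field; rewrite !gt_eqF.
by field; rewrite !gt_eqF.
Qed.

Let kappaLRE : kappaLR mu c th = f rho0 * th * (2 / D0).
Proof.
rewrite -kappaRE /kappaLR /kappaR derive_dR.
have h : f rho0 * g rho0 * th ^+ 2 = 1 by rewrite fg mulVf // gt_eqF // exprn_gt0.
transitivity (2 * (f rho0 * g rho0 * th ^+ 2) / (th ^+ 3 * slope)).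
  by rewrite h; field; rewrite !gt_eqF.
by field; rewrite !gt_eqF.
Qed.

Let d_lip z : lo <= z <= hi ->
  (hi ^+ 3)^-1 * `|z - rho0| <= `|f z * g z - f rho0 * g rho0|.
Proof.
move=> zJ; have bz := in_off zJ; rewrite -!dRE mulrC.
have rh : rho0 <= hi by apply: le_trans rho_hi; rewrite lerDl.
have /andP[_ zh] := zJ.
have [rz|/ltW zr] := leP rho0 z.
  rewrite ger0_norm ?subr_ge0 // distrC; apply: le_trans (ler_norm _).
  by apply: (dR_drop mu_ge0 mu_cpt c_range rho0P.1); rewrite rz.
rewrite distrC ger0_norm ?subr_ge0 //; apply: le_trans (ler_norm _).
by apply: (dR_drop mu_ge0 mu_cpt c_range bz); rewrite zr.
Qed.

Lemma small_mul (M x e : R) : 0 <= M -> 0 <= x < e / (M + 1) -> M * x < e.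
Proof.
move=> M0 /andP[x0]; rewrite ltr_pdivlMr; last by lra.
by move=> h; nra.
Qed.

Lemma inner_col n r (Q : 'M[C]_(n, r)) (x : 'cV[C]_n) l :
  inner (col l Q) x = (Q^t* *m x) l 0.
Proof. by rewrite innerE mxE; apply: eq_bigr => j _; rewrite !mxE. Qed.

Definition local_law_at n m r (X : 'M[C]_(n, m)) (U : 'M[C]_(n, r)) (V : 'M[C]_(m, r)) e :=
  forall z, lo <= z <= hi ->
    opnorm (G_mx X U V z%:C - M_mx mu c r z%:C) <= e.

(** All constants depend on mu, c, J, theta and the separation alone, so that
    one threshold eta0 serves all dimensions, ranks and signals. *)
Lemma single_spike e : 0 < e -> exists2 eta0, 0 < eta0 &
  forall n m r (X : 'M[C]_(n, m)) (U : 'M[C]_(n, r)) (V : 'M[C]_(m, r))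
    (ths : 'I_r -> R) (k : 'I_r) (ev : R),
  U^t* *m U = 1%:M -> V^t* *m V = 1%:M -> (forall l, 0 < ths l) ->
  opnorm X <= B -> 0 < ev < eta0 -> local_law_at X U V ev ->
  (forall l, delta <= `|rho mu c (ths l) - a1| /\ delta <= `|rho mu c (ths l) - a2|) ->
  (forall l, (a1 <= rho mu c (ths l) <= a2) <-> l = k) ->
  `|ths k - th| < eta0 ->
  let W := X + U *m Theta_mx ths *m V^t* in
  sv_count W a1 a2 = 1%N /\
  forall s u v, a1 <= s <= a2 -> singular_pair ComplexScalars W s u v ->
  [/\ `|normc (inner (col k U) u) ^+ 2 - kappaL mu c th| < e,
      `|normc (inner (col k V) v) ^+ 2 - kappaR mu c th| < e,
      (forall l, l != k -> normc (inner (col l U) u) < e /\ normc (inner (col l V) v) < e) &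
      normc (inner (col k U) u * (inner (col k V) v)^* - (kappaLR mu c th)%:C) < e].
Proof.
move=> e0.
have [c0 c00 offc0] := detuned mu_ge0 mu_cpt c_range edge_cond J_edge delta_gt0.
pose K := (1 + Fb) / c0.
have K0 : 0 <= K by rewrite divr_ge0 ?addr_ge0 // ltW.
pose N := 2 * (hi + B).
have N0 : 0 < N by rewrite mulr_gt0 // ltr_wpDr.
have gap0 : 0 < lo - B by rewrite subr_gt0.
have Y0 : 0 < pair_const B lo hi c0 Fb.
  rewrite /pair_const -/K -/N -!addrA ltr_wpDr //.
  have NN : 0 <= N ^+ 2 by exact: sqr_ge0.
  have KK : 0 <= K ^+ 2 by exact: sqr_ge0.
  apply: addr_ge0; first by apply: mulr_ge0 => //; exact: mulr_ge0.
  apply: addr_ge0; first by apply: divr_ge0 => //; exact/exprn_ge0/ltW.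
  apply: addr_ge0; first exact: mulr_ge0.
  by do 2 (apply: mulr_ge0 => //); exact: mulr_ge0.
have kap0 : 0 < (hi ^+ 3)^-1 by rewrite invr_gt0 exprn_gt0.
have gap20 : 0 < 2 * (lo - B) ^+ 2 by rewrite mulr_gt0 ?exprn_gt0.
have drho : f rho0 * g rho0 * th ^+ 2 = 1 by rewrite fg mulVf // gt_eqF // exprn_gt0.
have kR0 : 0 < 2 / D0 by rewrite divr_gt0.
(* The last two bounds serve uniqueness: |b_k|^2 >= 1 / D0 for each of two pairs is
   incompatible with |b1_k| |b2_k| D0 < 1. *)
pose e1 := Num.min e (Num.min (2 / D0 / 2) 1).
have e10 : 0 < e1 by rewrite !lt_min e0 ltr01 divr_gt0.
have e1e : e1 <= e by rewrite ge_min lexx.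
have e1k : e1 <= 2 / D0 / 2 by rewrite !ge_min lexx orbT.
have e11 : e1 <= 1 by rewrite !ge_min lexx !orbT.
have [d d0 lim] := reduced_limits Y0 gap20 kap0 fb gb d_lip drho
  (phiR_derive mu_ge0 mu_cpt rho0P.1) (phitR_derive c mu_ge0 mu_cpt rho0P.1) D0_gt0 e10.
(* The bounds on the error that make, in this order, the off-spike overlaps small,
   the residual smaller than the separation, the linear system for the approximate
   eigenvector solvable, and the spike supercritical. *)
pose q1 := e / (2 * K * N + 1).
pose q2 := delta / ((th + 1) * (2 * hi) + 1).
pose q3 := 1 / (4 * K + 1).
pose q4 := th - theta_star mu c.
exists (Num.min d (Num.min 1 (Num.min q1 (Num.min q2 (Num.min q3 q4))))).
  have pos M x : 0 <= M -> 0 < x -> 0 < x / (M + 1).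
    by move=> M0 x0; rewrite divr_gt0 // ltr_wpDl.
  rewrite !lt_min d0 ltr01 subr_gt0 th_super !pos //; first exact: mulr_ge0.
    by apply: mulr_ge0; [rewrite addr_ge0 // ltW | rewrite mulr_ge0 // ltW].
  by apply: mulr_ge0 (ltW N0); exact: mulr_ge0.
move=> n m r X U V ths k ev UU VV ths0 XB /andP[ev0].
rewrite !lt_min => /and5P[evd ev1 evq1 evq2 /andP[evq3 _]] law sep loc.
move=> /and5P[thd th1 _ _ /andP[_ thq4]] W.
have ev_le := ltW ev0.
have XB' v : enorm (X *m v) <= B * enorm v.
  by apply: le_trans (opnorm_le _ _) _; rewrite ler_wpM2r ?enorm_ge0.
have law' z : lo <= z <= hi -> forall y,
    enorm ((G_mx X U V z%:C - scalar_blocks r (f z) (g z)) *m y) <= ev * enorm y.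
  move=> zJ y; have -> : scalar_blocks r (f z) (g z) = M_mx mu c r z%:C.
    by rewrite /scalar_blocks /M_mx phi_real phit_real.
  by apply: le_trans (opnorm_le _ _) _; rewrite ler_wpM2r ?enorm_ge0 // law.
have off l z : l != k -> a1 <= z <= a2 ->
    c0 * (1 + ths l ^+ 2) <= `|1 - f z * g z * ths l ^+ 2|.
  move=> lk zJ; rewrite -dRE; have [s1 s2] := sep l.
  by apply: offc0 => //; apply: contra lk => /loc ->.
have evs : 0 < ev < 1 by rewrite ev0.
have thk : theta_star mu c < ths k.
  by move: thq4; rewrite /q4 ltr_norml => /andP[h _]; lra.
have thk1 : ths k <= th + 1 by move: th1; rewrite ltr_norml => /andP[_ h]; lra.
have two s1 s2 u1 v1 u2 v2 J1 J2 P1 P2 :=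
  @two_pairs _ _ _ _ _ _ _ _ k _ _ _ _ _ _ _ _ _ _ UU VV ths0 B_ge0 XB' Blo lo_a1 a2_hi
    ev_le c00 fb gb law' off evs rho0 s1 s2 u1 v1 u2 v2 lo_rho rho_hi J1 J2 P1 P2.
have limits s1 s2 u1 v1 u2 v2 J1 J2 P1 P2 := lim _ (two s1 s2 u1 v1 u2 v2 J1 J2 P1 P2) evd thd.
have self s u v : a1 <= s <= a2 -> singular_pair ComplexScalars W s u v ->
  [/\ `|normc ((V^t* *m v) k 0) ^+ 2 - 2 / D0| < e1,
      `|normc ((U^t* *m u) k 0) ^+ 2 - (f rho0 * th) ^+ 2 * (2 / D0)| < e1 &
      normc ((U^t* *m u) k 0 * ((V^t* *m v) k 0)^* - (f rho0 * th * (2 / D0))%:C) < e1].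
  move=> sJ sp; have [_] := limits s s u v u v sJ sJ sp sp; apply.
  split=> //=; have [_ [u1 v1] _ _] := sp.
  by rewrite !inner_enorm u1 v1 expr1n rmorph1.
split; last first.
  move=> s u v sJ sp; have [h1 h2 h3] := self s u v sJ sp.
  rewrite !inner_col kappaLE kappaRE kappaLRE.
  split; [exact: lt_le_trans e1e|exact: lt_le_trans e1e| |exact: lt_le_trans e1e].
  move=> l lk; have [_ [u1 v1] Wv Wu] := sp.
  have [w1 w2] := pair_overlap UU VV ths0 B_ge0 XB' Blo lo_a1 a2_hi ev_le c00 fb gb law' off
    sJ u1 v1 Wv Wu lk.
  have small : 2 * K * N * ev < e.
    apply: small_mul; last by rewrite ev_le.
    by apply: mulr_ge0 (ltW N0); exact: mulr_ge0.
  have E : 2 * K * (ev * N) = 2 * K * N * ev by ring.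
  rewrite -E in small.
  by rewrite !inner_col; split; apply: le_lt_trans small.
have a10 : 0 < a1 by apply: lt_le_trans lo_a1.
apply/eqP; rewrite eqn_leq; apply/andP; split.
  apply: sv_count_le1 => // s1 s2 u1 v1 u2 v2 J1 J2 P1 P2 ou ov.
  have [r1 _ _] := self s1 u1 v1 J1 P1; have [r2 _ _] := self s2 u2 v2 J2 P2.
  have [h _] := limits s1 s2 u1 v1 u2 v2 J1 J2 P1 P2; move: h => /=.
  rewrite ou ov addr0 sub0r normc_opp !Normc.normcM normc_real normc_conj (gtr0_norm D0_gt0).
  move: r1 r2 => /ltr_normlP[r1 _] /ltr_normlP[r2 _].
  set n1 := normc _ in r1 *; set n2 := normc _ in r2 *.
  have n10 : 0 <= n1 := normc_ge0 _; have n20 : 0 <= n2 := normc_ge0 _.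
  have k1 : 2 / D0 / 2 <= n1 ^+ 2 by lra.
  have k2 : 2 / D0 / 2 <= n2 ^+ 2 by lra.
  move=> /lt_le_trans/(_ e11); apply/negP; rewrite -leNgt.
  rewrite -(@ler_pXn2r _ 2) ?nnegrE ?mulr_ge0 ?(ltW D0_gt0) // expr1n !exprMn.
  have -> : 1 = (2 / D0 / 2) * (2 / D0 / 2) * D0 ^+ 2 :> R by field; rewrite gt_eqF.
  rewrite ler_pM2r ?exprn_gt0 //; by apply: ler_pM => //; apply: divr_ge0 => //; exact: ltW.
set z := rho mu c (ths k).
have zJ : a1 <= z <= a2 by apply/loc.
have [bz dz] := rhoP mu_ge0 mu_cpt c_range edge_cond thk.
have reson : f z * g z * ths k ^+ 2 = 1.
  by rewrite -dRE dz mulVf // gt_eqF // exprn_gt0.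
have small4 : 4 * K * ev < 1.
  by apply: small_mul; [exact: mulr_ge0 | rewrite ev_le].
have [x [x0 xe]] := approximate_eigenvector UU VV ths0 B_ge0 XB' Blo lo_a1 a2_hi ev_le c00
  fb gb law' off zJ reson small4.
have Bhi : B <= hi by rewrite ltW // (lt_le_trans Blo).
have err : ths k * ev * (z + B) <= delta.
  have sm : (th + 1) * (2 * hi) * ev < delta.
    apply: small_mul; last by rewrite ev_le.
    by apply: mulr_ge0; [rewrite addr_ge0 // ltW | rewrite mulr_ge0 // ltW].
  apply: le_trans (ltW sm); rewrite mulrAC ler_pM2r //.
  have /andP[_ zh] := zJ; apply: ler_pM => //; first exact: ltW.
    by rewrite addr_ge0 // (le_trans b0) // ltW.
  by rewrite mulr_natl mulr2n lerD // (le_trans zh).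
have [d1 d2] := sep k; rewrite -/z in d1 d2.
have /andP[za1 za2] := zJ.
rewrite ger0_norm ?subr_ge0 // in d1; rewrite distrC ger0_norm ?subr_ge0 // in d2.
apply: (@sv_count_near _ _ _ W a1 a2 z delta x a10 _ _ x0); [lra|lra|].
by apply: le_trans xe _; rewrite ler_wpM2r ?enorm_ge0.
Qed.

End SingleSpike.

(** * Real segments in the complex plane *)

Section Segment.
Local Open Scope ring_scope.
Variable R : realType.

Definition complex_segment (lo hi : R) : set (R[i])^o :=
  (fun z : R => z%:C : (R[i])^o) @` `[lo, hi]%classic.

Lemma complex_segment_compact lo hi : compact (complex_segment lo hi).
Proof.
apply: continuous_compact; last exact: segment_compact.
apply: continuous_subspaceT => x.
apply/cvgrPdist_lt => e e0.
have e1 : e = (complex.Re e)%:C by rewrite RRe_real // gtr0_real.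
have e2 : 0 < complex.Re e by move: e0; rewrite e1 ltcR.
near=> y; rewrite -rmorphB /= -normr_normc normc_real e1 ltcR.
by near: y; apply: (@cvgr_dist_lt _ R^o) => //; exact: cvg_id.
Unshelve. all: by end_near.
Qed.

Lemma complex_segment_off_cut b lo hi : b < lo ->
  complex_segment lo hi `<=` off_cut b.
Proof.
move=> blo _ [z /= zJ <-] [_ /andP[_ zb]]; move: zJ.
by rewrite in_itv /= => /andP[lz _]; move: (lt_le_trans blo lz); rewrite ltNge zb.
Qed.

Lemma singular_pairW (F : scalar_field) n m (W : 'M[R[i]]_(n, m)) s u v :
  singular_pair F W s u v -> singular_pair ComplexScalars W s u v.
Proof. by case=> _ n1 e1 e2; split => //; split; apply/mxOverP. Qed.

End Segment.

(** * Overlaps of the singular vectors of a simple spike *)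

Theorem corollary3p9 (R : realType) (F : scalar_field)
  (d : nat -> measure_display) (Omega : forall n, measurableType (d n))
  (Pr : forall n, probability (Omega n) R)
  (c : R) (m : nat -> nat)
  (X P : forall n, Omega n -> 'M[R[i]]_(n, m n))
  (r : forall n, Omega n -> nat)
  (U : forall n (w : Omega n), 'M[R[i]]_(n, r n w))
  (V : forall n (w : Omega n), 'M[R[i]]_(m n, r n w))
  (theta : forall n (w : Omega n), 'I_(r n w) -> R)
  (mu : probability R R)
  (a1 a2 : R) (G : seq (R -> (R[i])^o)) (K : set (R[i])^o)
  (i : forall n, Omega n -> nat) (th : R)
  (uh : forall n, Omega n -> 'cV[R[i]]_n)
  (vh : forall n, Omega n -> 'cV[R[i]]_(m n))
  (* dimensions *)
  (c_range : 0 < c <= 1)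
  (le_nm : forall n, (n <= m n)%N)
  (cvg_c : (fun n => n%:R / (m n)%:R : R) @ \oo --> c)
  (* model *)
  (X_random : forall n, random_mx (X n))
  (X_scalar : forall n w, X n w \is a mxOver (in_scalars F))
  (P_random : forall n, random_mx (P n))
  (P_rank : forall n w, \rank (P n w) = r n w)
  (U_stiefel : forall n w, stiefel F (U n w))
  (V_stiefel : forall n w, stiefel F (V n w))
  (theta_gt0 : forall n w k, 0 < theta n w k)
  (theta_sorted : forall n w (k l : 'I_(r n w)), (k <= l)%N ->
     theta n w l <= theta n w k)
  (P_svd : forall n w, P n w = U n w *m Theta_mx (theta n w) *m (V n w)^t*)
  (* standing assumptions *)
  (noise : global_noise_law Pr X mu)
  (edge_cond : edge_condition mu c)
  (law : local_law Pr X U V mu c)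
  (* the stable interval [a1, a2] with contour G *)
  (J_stable : stable_interval Pr theta mu c a1 a2 G)
  (K_compact : compact K)
  (K_off_cut : K `<=` off_cut (edge mu))
  (K_nbhd : contour_image G `<=` interior K)
  (compat : weighted_compatibility Pr X U V theta mu c K)
  (* the only location in [a1, a2] comes from the simple spike theta_{n,i} *)
  (one_location : whp Pr (fun n => [set w |
     exists2 k : 'I_(r n w), k = i n w :> nat &
       forall l, (a1 <= rho mu c (theta n w l) <= a2) <-> l = k]))
  (spike_cvg : cvg_prob_at Pr i theta th)
  (spike_super : theta_star mu c < th)
  (* the corresponding singular vectors *)
  (uvh : forall n w, sv_count (X n w + P n w) a1 a2 = 1%N ->
     exists2 s : R, a1 <= s <= a2 &
       singular_pair F (X n w + P n w) s (uh n w) (vh n w)) :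
  whp Pr (fun n => [set w | sv_count (X n w + P n w) a1 a2 = 1%N]) /\
  [/\ cvg_prob_at Pr i (fun n w k =>
        Normc.normc (inner (col k (U n w)) (uh n w)) ^+ 2) (kappaL mu c th),
      cvg_prob_at Pr i (fun n w k =>
        Normc.normc (inner (col k (V n w)) (vh n w)) ^+ 2) (kappaR mu c th),
      cvg_prob Pr (fun n w => \big[Num.max/0]_(k < r n w | k != i n w :> nat)
        Normc.normc (inner (col k (U n w)) (uh n w))) 0,
      cvg_prob Pr (fun n w => \big[Num.max/0]_(k < r n w | k != i n w :> nat)
        Normc.normc (inner (col k (V n w)) (vh n w))) 0 &
      cvg_prob_at Pr i (fun n w k => Normc.normc
        (inner (col k (U n w)) (uh n w) * (inner (col k (V n w)) (vh n w))^*
         - (kappaLR mu c th)%:C)) 0].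
Proof.
have [mu_ge0 mu_cpt _ opn] := noise.
have [J_edge [delta delta0 sep] _ _ _] := J_stable.
have [brho _] := rhoP mu_ge0 mu_cpt c_range edge_cond spike_super.
pose lo := spike_lo mu c a1 th; pose hi := spike_hi mu c a2 th.
have blo : edge mu < lo by rewrite lt_min brho andbT; case/andP: J_edge.
pose B := (edge mu + lo) / 2.
have bB : edge mu < B by rewrite /B; lra.
have Blo : B < lo by rewrite /B; lra.
have [eps [eps0 wlaw]] := law _ (@complex_segment_compact R lo hi)
  (@complex_segment_off_cut R _ lo hi blo).
(* positive, because its square root is the step of a difference quotient *)
pose ev n := `|eps n| + n.+1%:R^-1.
have ev_gt0 n : 0 < ev n by rewrite ltr_wpDl.
have ev_cvg : ev @ \oo --> (0 : R).
  rewrite -(addr0 (0 : R)) -{1}(normr0 R); apply: cvgD; first exact: cvg_norm.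
  exact: cvg_harmonic.
have wop : whp Pr (fun n => [set w | opnorm (X n w) <= B]).
  apply: whp_mono (opn (B - edge mu) _); last by rewrite subr_gt0.
  by move=> n w /= /ltr_normlP[_ h]; lra.
(* all the conclusions, uniformly over the singular pairs located in J *)
pose good e n (w : Omega n) := exists2 k : 'I_(r n w), k = i n w :> nat &
  sv_count (X n w + P n w) a1 a2 = 1%N /\
  forall s u v, a1 <= s <= a2 ->
    singular_pair ComplexScalars (X n w + P n w) s u v ->
  [/\ `|Normc.normc (inner (col k (U n w)) u) ^+ 2 - kappaL mu c th| < e,
      `|Normc.normc (inner (col k (V n w)) v) ^+ 2 - kappaR mu c th| < e,
      (forall l, l != k -> Normc.normc (inner (col l (U n w)) u) < e /\
                           Normc.normc (inner (col l (V n w)) v) < e) &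
      Normc.normc (inner (col k (U n w)) u * (inner (col k (V n w)) v)^*
        - (kappaLR mu c th)%:C) < e].
have wgood e : 0 < e -> whp Pr (fun n => [set w | good e n w]).
  move=> e0; have [eta0 eta00 spike] := single_spike mu_ge0 mu_cpt c_range edge_cond
    J_edge delta0 spike_super bB Blo e0.
  have wall := whp_and (whp_and wop wlaw)
    (whp_and sep (whp_and one_location (spike_cvg _ eta00))).
  have small : \forall n \near \oo, ev n < eta0 by exact: (cvgr_lt _ ev_cvg eta0 eta00).
  apply: (whp_eventually small _ wall).
  move=> n evn w /= [[XB lawn] [sepn [[k ki loc] [k' ki' thk]]]].
  have kk : k' = k by apply: ord_inj; rewrite ki ki'.
  rewrite kk in thk; exists k => //; rewrite P_svd.
  apply: (spike _ _ _ _ _ _ _ _ (ev n)) => //.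
  - by case: (U_stiefel n w).
  - by case: (V_stiefel n w).
  - by rewrite ev_gt0.
  move=> z zJ; have [|_ h] := lawn z%:C; first by exists z => //=; rewrite in_itv.
  by apply: (le_trans h); rewrite (le_trans (ler_norm _)) // lerDl.
have pair e n w : good e n w -> exists2 s, a1 <= s <= a2 &
    singular_pair ComplexScalars (X n w + P n w) s (uh n w) (vh n w).
  move=> [k _ [cnt _]]; have [s sJ sp] := uvh n w cnt.
  by exists s => //; exact: singular_pairW sp.
split; first by apply: whp_mono (wgood 1 ltr01) => n w /= [k _ []].
split=> e e0; apply: whp_mono (wgood e e0) => n w /= gw;
  have [s sJ sp] := pair _ _ _ gw; have [k ki [_ /(_ _ _ _ sJ sp)[gL gR gO gLR]]] := gw.
- by exists k.
- by exists k.
- rewrite subr0 ger0_norm; last exact: bigmax_ge_id.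
  apply: bigmax_lt => // l li; apply: (gO l _).1.
  by apply: contra li => /eqP ->; rewrite ki.
- rewrite subr0 ger0_norm; last exact: bigmax_ge_id.
  apply: bigmax_lt => // l li; apply: (gO l _).2.
  by apply: contra li => /eqP ->; rewrite ki.
- by exists k => //; rewrite subr0 ger0_norm ?normc_ge0.
Qed.
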